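(* Let $\epsilon>0$. There exists a deterministic algorithm which, given a number $\alpha>0$ and an $n$ by $n$ bipartite $\alpha$-expander $\mathbb{G}$, outputs a $(1+\epsilon)^n$-approximation of $\operatorname{Perm}(\mathbb{G})$, i.e. a value $\hat Z$ with $$(1+\epsilon)^{-n}\operatorname{Perm}(\mathbb{G})\le \hat Z\le (1+\epsilon)^{n}\operatorname{Perm}(\mathbb{G}),$$ and whose running time is $\exp\big(O(\sqrt{\epsilon^{-1}\alpha^{-1}n}\,\log^3 n)\big)$. Moreover, the running time of the algorithm is polynomial in $n$ whenever the maximum degree $\Delta$ of $\mathbb{G}$ and $\alpha$ are constants (that is, restricted to inputs with fixed $\alpha$ and fixed bound on $\Delta$, with $\epsilon$ fixed).
   Context: An $n$ by $n$ bipartite graph $\mathbb{G}$ is a simple undirected bipartite graph with node set $V=V_1\cup V_2$ (disjoint parts), $|V_1|=|V_2|=n$, and edge set $E$, each edge joining a node of $V_1$ to a node of $V_2$. For a set of nodes $A$, $N(A)$ denotes the set of neighbors of nodes in $A$. The degree of $\mathbb{G}$ is $\Delta=\max_{v\in V}\Delta(v)$, where $\Delta(v)$ is the number of neighbors of $v$. For $\alpha>0$, $\mathbb{G}$ is an $\alpha$-expander if for both $i=1,2$ and every set $A\subset V_i$ with $|A|\le n/2$ one has $|N(A)|\ge (1+\alpha)|A|$. $\operatorname{Perm}(\mathbb{G})$ is the permanent $\sum_{\sigma}\prod_{i=1}^n a_{i,\sigma(i)}$ ($\sigma$ ranging over all permutations of $\{1,\dots,n\}$) of the $0,1$ matrix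 $(a_{ij})$ with rows indexed by $V_1$ and columns by $V_2$, where $a_{ij}=1$ exactly when the $i$-th node of $V_1$ and the $j$-th node of $V_2$ are adjacent; equivalently it is the number of perfect matchings of $\mathbb{G}$. Running time bounds are asymptotic as $n\to\infty$, with $\epsilon$ a fixed constant; the constant implied in $O(\cdot)$ is absolute. *)

(* Defs.v *)
From HB Require Import structures.
From mathcomp Require Import all_boot all_order all_algebra all_fingroup.
From mathcomp Require Import all_classical all_reals all_analysis.

Set Implicit Arguments.
Unset Strict Implicit.
Unset Printing Implicit Defensive.

Import Order.TTheory GRing.Theory Num.Theory.
Local Open Scope ring_scope.

(* The i-th node of V1 is [inl i], the j-th node of V2 is [inr j]. *)
Definition node (n : nat) : finType := ('I_n + 'I_n)%type.

(* [G i j] says that the i-th node of V1 and the j-th node of V2 are joined;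
   every such relation is a simple bipartite graph, and conversely. *)
Definition bigraph (n : nat) := rel 'I_n.

Definition V1 n : {set node n} := [set inl i | i : 'I_n].
Definition V2 n : {set node n} := [set inr j | j : 'I_n].

Definition adj n (G : bigraph n) : rel (node n) := fun u v =>
  match u, v with
  | inl i, inr j => G i j
  | inr j, inl i => G i j
  | _, _ => false
  end.

Definition neighbors n (G : bigraph n) (A : {set node n}) : {set node n} :=
  [set v | [exists u in A, adj G u v]].

Definition degree n (G : bigraph n) (v : node n) : nat :=
  #|[set u | adj G v u]|.

Definition max_degree n (G : bigraph n) : nat :=
  (\max_(v : node n) degree G v)%N.

Definition expander (R : realType) n (alpha : R) (G : bigraph n) : Prop :=
  forall A : {set node n}, A \subset V1 n \/ A \subset V2 n ->
    (#|A|%:R : R) <= n%:R / 2 ->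
    (1 + alpha) * #|A|%:R <= #|neighbors G A|%:R.

Definition permanent n (G : bigraph n) : nat :=
  (\sum_(s : 'S_n) \prod_(i < n) (G i (s i) : nat))%N.

(* Model of computation: the random access machine of Cook-Reckhow and
   Aho-Hopcroft-Ullman under the logarithmic cost criterion, with structured
   control flow.  There is a read-only random access input and a single work
   memory, both indexed by nat and holding natural numbers.  Every operation
   costs the total bit length of the numbers (addresses included) it handles;
   the machine is thus polynomially equivalent to Turing machines. *)
Inductive expr : Type :=
| Const of nat
| Input of expr         (* contents of the input cell with that address *)
| Mem of expr           (* contents of the work cell with that address *)
| Add of expr & expr
| Sub of expr & expr    (* truncated at 0 *)
| Mul of expr & expr
| Div of expr & expr.   (* quotient rounded down; 0 if the divisor is 0 *)

Inductive cmd : Type :=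
| Skip
| Store of expr & expr  (* [Store a e] writes e at address a *)
| Seq of cmd & cmd
| If of expr & cmd & cmd
| While of expr & cmd.  (* nonzero means true *)

Definition memory := nat -> nat.

Definition update (m : memory) (a v : nat) : memory :=
  fun x => if x == a then v else m x.

Definition bitlen (k : nat) : nat := (trunc_log 2 k).+1.

Fixpoint eval (inp : nat -> nat) (m : memory) (e : expr) : nat :=
  match e with
  | Const c => c
  | Input a => inp (eval inp m a)
  | Mem a => m (eval inp m a)
  | Add e1 e2 => (eval inp m e1 + eval inp m e2)%N
  | Sub e1 e2 => (eval inp m e1 - eval inp m e2)%N
  | Mul e1 e2 => (eval inp m e1 * eval inp m e2)%N
  | Div e1 e2 => (eval inp m e1 %/ eval inp m e2)%N
  end.

Fixpoint ecost (inp : nat -> nat) (m : memory) (e : expr) : nat :=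
  match e with
  | Const c => bitlen c
  | Input a | Mem a =>
      (ecost inp m a + bitlen (eval inp m a) + bitlen (eval inp m e))%N
  | Add e1 e2 | Sub e1 e2 | Mul e1 e2 | Div e1 e2 =>
      (ecost inp m e1 + ecost inp m e2
       + bitlen (eval inp m e1) + bitlen (eval inp m e2))%N
  end.

(* [exec inp c m t m']: started in memory m on input inp, the program c halts
   after running time t with final memory m'. *)
Inductive exec (inp : nat -> nat) : cmd -> memory -> nat -> memory -> Prop :=
| ExSkip m : exec inp Skip m 1 m
| ExStore m a e :
    exec inp (Store a e) m
      (ecost inp m a + ecost inp m e
       + bitlen (eval inp m a) + bitlen (eval inp m e))%N
      (update m (eval inp m a) (eval inp m e))
| ExSeq c1 c2 m t1 m1 t2 m2 :
    exec inp c1 m t1 m1 -> exec inp c2 m1 t2 m2 ->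
    exec inp (Seq c1 c2) m (t1 + t2)%N m2
| ExIfTrue e c1 c2 m t m1 :
    eval inp m e != 0%N -> exec inp c1 m t m1 ->
    exec inp (If e c1 c2) m (ecost inp m e + t)%N m1
| ExIfFalse e c1 c2 m t m1 :
    eval inp m e = 0%N -> exec inp c2 m t m1 ->
    exec inp (If e c1 c2) m (ecost inp m e + t)%N m1
| ExWhileFalse e c m :
    eval inp m e = 0%N -> exec inp (While e c) m (ecost inp m e) m
| ExWhileTrue e c m t1 m1 t2 m2 :
    eval inp m e != 0%N -> exec inp c m t1 m1 ->
    exec inp (While e c) m1 t2 m2 ->
    exec inp (While e c) m (ecost inp m e + t1 + t2)%N m2.

(* The machine is deterministic, in its result as well as in its running
   time. *)
Lemma exec_det inp c m t1 m1 t2 m2 :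
  exec inp c m t1 m1 -> exec inp c m t2 m2 -> t1 = t2 /\ m1 = m2.
Proof.
move=> H; elim: H t2 m2 => {c m t1 m1} /=.
- by move=> m t m' H; inversion H.
- by move=> m a e t m' H; inversion H.
- move=> c1 c2 m t1 m1 t2 m2 _ IH1 _ IH2 t m' H.
  inversion H as [| |? ? ? ? ? ? ? E1 E2| | | |]; subst.
  by have [? ?] := IH1 _ _ E1; subst; have [-> ->] := IH2 _ _ E2.
- move=> e c1 c2 m t m1 h _ IH t' m' H.
  inversion H as [| | |? ? ? ? ? ? _ E|? ? ? ? ? ? h0 _| |]; subst.
    by have [-> ->] := IH _ _ E.
  by rewrite h0 in h.
- move=> e c1 c2 m t m1 h _ IH t' m' H.
  inversion H as [| | |? ? ? ? ? ? h0 _|? ? ? ? ? ? _ E| |]; subst.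
    by rewrite h in h0.
  by have [-> ->] := IH _ _ E.
- move=> e c m h t m' H.
  inversion H as [| | | | |? ? ? _|? ? ? ? ? ? ? h0 _ _]; subst => //.
  by rewrite h in h0.
- move=> e c m t1 m1 t2 m2 h _ IH1 _ IH2 t m' H.
  inversion H as [| | | | |? ? ? h0|? ? ? ? ? ? ? _ E1 E2]; subst.
    by rewrite h0 in h.
  by have [? ?] := IH1 _ _ E1; subst; have [-> ->] := IH2 _ _ E2.
Qed.

(* Entry (i, j) of the adjacency matrix, 0 when i or j is not below n. *)
Definition entry n (G : bigraph n) (i j : nat) : nat :=
  [exists x : 'I_n, exists y : 'I_n, [&& x == i :> nat, y == j :> nat & G x y]].

(* The input: n is in cell 0, entry (i, j) of the adjacency matrix in cell
   2 (i n + j) + 1, and the k-th binary truncation floor (2^k alpha) of the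
   real number alpha in cell 2 k + 2.  The machine pays for each truncation
   that it reads, in proportion to its bit length. *)
Definition encode (R : realType) n (alpha : R) (G : bigraph n) : nat -> nat :=
  fun a => match a with
  | 0 => n
  | b.+1 => if odd b then Num.truncn (2 ^+ b./2 * alpha)
            else entry G (b./2 %/ n) (b./2 %% n)
  end.

(* The program P, started on a blank memory, halts after running time t,
   leaving the numerator p and the denominator q of its output p / q in work
   cells 0 and 1. *)
Definition runs (P : cmd) (inp : nat -> nat) (t p q : nat) : Prop :=
  exists m : memory,
    [/\ exec inp P (fun _ => 0%N) t m, p = m 0%N, q = m 1%N & q != 0%N].

Definition approximates (R : realType) n (eps : R) (G : bigraph n) (Z : R) :=
  (1 + eps) ^- n * (permanent G)%:R <= Z /\ Z <= (1 + eps) ^+ n * (permanent G)%:R.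

(* Main.v *)
Require Import Defs.
From HB Require Import structures.
From mathcomp Require Import all_boot all_order all_algebra all_fingroup.
From mathcomp Require Import all_classical all_reals all_analysis.
From mathcomp Require Import ring lra zify.

(** Give every node v a weight c v > 0 and let H be the sum over all matchings of
    the product of the weights of the unmatched nodes, the holes.  The ratios
    H(A) / H(A + v) satisfy a recursion along self-avoiding walks.  If the weight
    of a row i is s^-2 times the sum of 1 / c j over its neighbours j, truncating the
    recursion at depth t makes a relative error of at most s^2 (1 - 1/s)^(t/2).

    The column weights start at 1.  As long as some column has, according to the
    truncated ratios, a much smaller probability of being a hole than the load that
    the rows put on it, its weight is doubled.  Every doubling lowers H by a definite
    factor, so this stops after polynomially many rounds, and then a random matching
    has O(n / s) holes on average.  In an expander at least half of the k row holes of
    a matching start an alternating walk to an unmatched column with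
    O(alpha^-1 log(n / k)) matching edges, which bounds the number of these matchings
    in terms of the permanent.  By Gibbs' inequality ln H - ln Perm is therefore
    O(n / E) once s is E / alpha times logarithms, and H is a product of ratios times
    column weights.  The recursion has depth min(2 n, 20 s J) with J logarithmic, and
    evaluating it by brute force takes time n^O(depth). *)

Set Implicit Arguments.
Unset Strict Implicit.
Unset Printing Implicit Defensive.

Import Order.TTheory GRing.Theory Num.Theory.
Local Open Scope ring_scope.

(** * Weighted matchings *)

(** With equal weights the recursion forgets its boundary values at a rate that deteriorates with
    the degree. Row weights proportional to the sum of 1 / c j over the neighbours remove this
    dependence: among the terms of the denominator of a row ratio the average hole probability is
    then at least 1 / s (the row's own weight counting as 1), and the corresponding part of a
    column's denominator is free of error.

    The price is that H counts imperfect matchings with very uneven weights. Comparing it with the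
    permanent requires few row holes on average and, in addition, a small expected logarithm of the
    product of the weights of the holes. The former holds once no column is overloaded, because load
    times hole probability never exceeds s^-2. The latter is the reason for raising weights only
    where the load dominates: a column of weight above 1 then has a hole probability of at most its
    load, so its logarithm can be charged to its rows, where concavity bounds it by the logarithm of
    the degree. *)

Section MatchingPolynomial.
Variables (R : realFieldType) (V : finType) (e : rel V).
Hypothesis e_sym : symmetric e.
Implicit Types (A U : {set V}) (s : {perm V}) (c : V -> R).

(* A matching of the subgraph induced on U is encoded as the involution that
   swaps the ends of its edges; its fixed points in U are the holes. *)
Definition matching U s :=
  [forall v, s (s v) == v] &&
  [forall v, (s v != v) ==> (e v (s v) && (v \in U))].

Definition hole_poly c U :=
  \sum_(s | matching U s) \prod_(v in U | s v == v) c v.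

Lemma matchingP U s :
  reflect ((forall v, s (s v) = v) /\
           (forall v, s v != v -> e v (s v) /\ v \in U)) (matching U s).
Proof.
apply: (iffP andP) => [[/forallP h1 /forallP h2]|[h1 h2]]; split.
- by move=> v; apply/eqP.
- by move=> v sv; move: (h2 v); rewrite sv => /andP.
- by apply/forallP => v; rewrite h1.
- by apply/forallP => v; apply/implyP => /h2 [-> ->].
Qed.

Lemma matching1 U : matching U 1%g.
Proof. by apply/matchingP; split=> v; rewrite !perm1 // eqxx. Qed.

Lemma matching_out U s v : matching U s -> v \notin U -> s v = v.
Proof.
by move=> /matchingP[_ h] vU; apply/eqP/negPn/negP => /h [_]; apply/negP.
Qed.

Lemma matching_drop A s v : s v = v ->
  matching (v |: A) s = matching (A :\ v) s.
Proof.
move=> sv; apply/matchingP/matchingP => -[h1 h2]; split=> // u su.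
  have [euv hu] := h2 u su; split=> //; move: hu su; rewrite !inE.
  by case: (eqVneq u v) => [->|//]; rewrite sv eqxx.
have [euv hu] := h2 u su; split=> //; move: hu; rewrite !inE.
by move=> /andP[_ ->]; rewrite orbT.
Qed.

(** Multiplication by the transposition inserts the edge between v and w; this bijection turns the
    matchings that use the edge into matchings that avoid both ends. *)
Lemma matching_swap A s v w : v \notin A -> w \in A -> e v w ->
  s v = v -> s w = w ->
  matching (v |: A) (s * tperm v w)%g = matching (A :\ w) s.
Proof.
move=> vA wA evw sv sw.
have vw : v != w by apply: contraNneq vA => ->.
have svE u : (s u == v) = (u == v) by rewrite -{1}sv (inj_eq perm_inj).
have swE u : (s u == w) = (u == w) by rewrite -{1}sw (inj_eq perm_inj).
have tE u : (s * tperm v w)%g u =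
    if u == v then w else if u == w then v else s u.
  rewrite permM; have [->|uv] := eqVneq u v; first by rewrite sv tpermL.
  have [->|uw] := eqVneq u w; first by rewrite sw tpermR.
  by rewrite tpermD // eq_sym ?svE ?swE.
apply/matchingP/matchingP => -[h1 h2]; split.
- move=> u; have := h1 u; rewrite tE tE.
  have [->|uv] := eqVneq u v; first by rewrite !sv.
  have [->|uw] := eqVneq u w; first by rewrite !sw.
  by rewrite svE swE (negbTE uv) (negbTE uw).
- move=> u su; have := h2 u; rewrite tE !inE.
  have [uv|uv] := eqVneq u v; first by rewrite uv sv eqxx in su.
  have [uw|uw] := eqVneq u w; first by rewrite uw sw eqxx in su.
  by move/(_ su).
- move=> u; rewrite !tE.
  have [->|uv] := eqVneq u v; first by rewrite eq_sym (negbTE vw) eqxx.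
  have [->|uw] := eqVneq u w; first by rewrite eqxx.
  by rewrite svE swE (negbTE uv) (negbTE uw).
- move=> u; rewrite tE !inE.
  have [->|uv] := eqVneq u v; first by split.
  have [->|uw] := eqVneq u w; first by rewrite e_sym wA.
  by move=> /h2; rewrite !inE uw.
Qed.

Lemma hole_poly_fixed c A v : v \notin A ->
  \sum_(s | matching (v |: A) s && (s v == v))
     \prod_(u in v |: A | s u == u) c u = c v * hole_poly c A.
Proof.
move=> vA; have AvE : A :\ v = A.
  by apply/setP => u; rewrite !inE; case: eqP => // ->; rewrite (negbTE vA).
rewrite /hole_poly big_distrr /=; apply: eq_big => [s|s].
  apply/andP/idP => [[h /eqP sv]|h]; first by rewrite -AvE -matching_drop.
  have sv := matching_out h vA; split; last exact/eqP.
  by rewrite matching_drop // AvE.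
move=> /andP[_ /eqP sv]; rewrite (bigD1 v) /=; last by rewrite !inE eqxx sv /=.
congr (_ * _); apply: eq_bigl => u; rewrite !inE.
by case: (eqVneq u v) => [->|]; rewrite ?(negbTE vA) ?andbF ?andbT.
Qed.

(** Either v is a hole, or it is matched to some w, and removing that edge leaves a matching of A
    without w. *)
Lemma hole_poly_rec c A v : v \notin A ->
  hole_poly c (v |: A) =
    c v * hole_poly c A + \sum_(w in A | e v w) hole_poly c (A :\ w).
Proof.
move=> vA; rewrite {1}/hole_poly (bigID (fun s : {perm V} => s v == v)) /=.
rewrite hole_poly_fixed //; congr (_ + _).
rewrite (partition_big (fun s : {perm V} => s v)
           (fun w => (w \in A) && e v w)) /=; last first.
  move=> s /andP[/matchingP[h1 h2] sv]; have [es _] := h2 _ sv.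
  have : s (s v) != s v by rewrite h1 eq_sym.
  by move=> /h2 [_]; rewrite !inE (negbTE sv) es => /= ->.
apply: eq_bigr => w /andP[wA evw].
have vw : v != w by apply: contraNneq vA => ->.
have tK s : (s * tperm v w * tperm v w)%g = s by rewrite -mulgA tperm2 mulg1.
rewrite (reindex_onto (fun s => (s * tperm v w)%g) (fun s => (s * tperm v w)%g));
  last by move=> s _; exact: tK.
apply: eq_big => [s|s].
  rewrite tK eqxx andbT permM; apply/idP/idP.
    move=> /andP[/andP[h _] /eqP tsv].
    have sv : s v = v by apply: (@perm_inj _ (tperm v w)); rewrite tsv tpermL.
    have sw : s w = w.
      apply: (@perm_inj _ (tperm v w)); rewrite tpermR.
      have /matchingP[/(_ v) + _] := h.
      by rewrite !permM sv tpermL.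
    by rewrite -(matching_swap vA wA evw sv sw).
  move=> h; have sv : s v = v by apply: (matching_out h); rewrite !inE negb_and vA orbT.
  have sw : s w = w by apply: (matching_out h); rewrite !inE eqxx.
  by rewrite matching_swap // h sv tpermL eqxx eq_sym vw.
move=> /andP[/andP[/andP[h _] /eqP tsv] _].
have sv : s v = v.
  by apply: (@perm_inj _ (tperm v w)); rewrite -permM tsv tpermL.
have sw : s w = w.
  apply: (@perm_inj _ (tperm v w)); rewrite tpermR.
  have /matchingP[/(_ v) + _] := h.
  by rewrite !permM sv tpermL.
apply: eq_bigl => u; rewrite !inE permM.
have [->|uv] := eqVneq u v; first by rewrite sv tpermL eq_sym (negbTE vw) (negbTE vA) andbF.
have [->|uw] := eqVneq u w; first by rewrite sw tpermR (negbTE vw) andbF.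
have svE : (s u == v) = (u == v) by rewrite -{1}sv (inj_eq perm_inj).
have swE : (s u == w) = (u == w) by rewrite -{1}sw (inj_eq perm_inj).
by rewrite /= tpermD // eq_sym ?svE ?swE.
Qed.

Section Positive.
Variable c : V -> R.
Hypothesis c_gt0 : forall v, 0 < c v.

Lemma hole_poly_gt0 U : 0 < hole_poly c U.
Proof.
rewrite /hole_poly (bigD1 1%g) ?matching1 //=.
apply: ltr_pwDl; first exact: prodr_gt0.
by apply: sumr_ge0 => s _; apply: prodr_ge0 => v _; exact: ltW.
Qed.

Definition ratio A v := hole_poly c A / hole_poly c (v |: A).

Lemma ratio_gt0 A v : 0 < ratio A v.
Proof. by rewrite divr_gt0 // hole_poly_gt0. Qed.

Lemma ratio_rec A v : v \notin A ->
  (ratio A v)^-1 = c v + \sum_(w in A | e v w) ratio (A :\ w) w.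
Proof.
move=> vA; rewrite /ratio invf_div hole_poly_rec // mulrDl.
rewrite mulfK ?gt_eqF ?hole_poly_gt0 // mulr_suml; congr (_ + _).
by apply: eq_bigr => w /andP[wA _]; rewrite finset.setD1K.
Qed.

Lemma ratio_le_invc A v : v \notin A -> ratio A v <= (c v)^-1.
Proof.
move=> vA; rewrite -[ratio A v]invrK lef_pV2 ?posrE ?invr_gt0 ?ratio_gt0 //.
by rewrite ratio_rec // lerDl sumr_ge0 // => w _; exact/ltW/ratio_gt0.
Qed.

End Positive.
End MatchingPolynomial.

(** * Decay of the truncation error *)

Section Bipartite.
Variables (R : realFieldType) (V : finType) (e : rel V) (row : pred V).
Hypothesis e_sym : symmetric e.
Hypothesis e_row : forall v w, e v w -> row w = ~~ row v.
Implicit Types (A U : {set V}) (c : V -> R).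

Let ratio_recE c := fun (h : forall v, 0 < c v) => ratio_rec e_sym h.

Lemma ratio_leV c c' A A' v :
  (forall v, 0 < c v) -> (forall v, 0 < c' v) -> v \notin A -> v \notin A' ->
  c v + \sum_(w in A | e v w) ratio e c (A :\ w) w <=
  c' v + \sum_(w in A' | e v w) ratio e c' (A' :\ w) w ->
  ratio e c' A' v <= ratio e c A v.
Proof.
move=> hc hc' vA vA' h.
rewrite -[leLHS]invrK -[leRHS]invrK lef_pV2 ?posrE ?invr_gt0 ?ratio_gt0 //.
by rewrite !ratio_recE.
Qed.

(** The inversion in the recursion reverses inequalities and every edge changes sides, so all
    weights of one side act with the same sign on the ratios of a given side. *)
Lemma ratio_mono c c' A v :
  (forall v, 0 < c v) -> (forall v, 0 < c' v) ->
  (forall v, row v -> c' v <= c v) -> (forall v, ~~ row v -> c v <= c' v) ->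
  v \notin A ->
  (row v -> ratio e c A v <= ratio e c' A v) /\
  (~~ row v -> ratio e c' A v <= ratio e c A v).
Proof.
move=> hc hc' hr hk; have [k] := ubnP #|A|.
elim: k => // k IH in A v *; rewrite ltnS => Ak vA.
have IHw w : w \in A -> e v w ->
    (row w -> ratio e c (A :\ w) w <= ratio e c' (A :\ w) w) /\
    (~~ row w -> ratio e c' (A :\ w) w <= ratio e c (A :\ w) w).
  move=> wA _; apply: IH; last by rewrite !inE eqxx.
  by move: Ak; rewrite (cardsD1 w) wA.
split=> rv; apply: ratio_leV => //; apply: lerD; auto;
  apply: ler_sum => w /andP[wA evw]; apply IHw => //;
  by rewrite (e_row evw) ?rv.
Qed.

(** Deleting u is the limit of an infinite weight at u, which explains the signs; they propagate
    through the recursion as in [ratio_mono]. *)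
Lemma ratio_remove c A u v : (forall v, 0 < c v) -> v \notin A ->
  (row u != row v -> ratio e c A v <= ratio e c (A :\ u) v) /\
  (row u = row v -> ratio e c (A :\ u) v <= ratio e c A v).
Proof.
move=> hc; have [k] := ubnP #|A|.
elim: k => // k IH in A v *; rewrite ltnS => Ak vA.
have vAu : v \notin A :\ u by rewrite !inE (negbTE vA) andbF.
have AC w : A :\ u :\ w = A :\ w :\ u by apply/setP=> x; rewrite !inE andbCA.
have IHw w : w \in A -> e v w ->
    (row u = row v -> ratio e c (A :\ w) w <= ratio e c (A :\ u :\ w) w) /\
    (row u != row v -> ratio e c (A :\ u :\ w) w <= ratio e c (A :\ w) w).
  move=> wA evw; have [||h1 h2] := IH (A :\ w) w.
  - by move: Ak; rewrite (cardsD1 w) wA.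
  - by rewrite !inE eqxx.
  rewrite AC (e_row evw) in h1 h2 *; split=> ruv; [apply: h1|apply: h2].
    by rewrite ruv; case: (row v).
  by move: ruv; case: (row u); case: (row v).
split=> ruv; apply: ratio_leV => //; rewrite lerD2l.
  rewrite [leRHS](bigID (pred1 u)) /= -[leLHS]add0r; apply: lerD.
    by apply: sumr_ge0 => w _; exact/ltW/ratio_gt0.
  rewrite [leRHS](eq_bigl (fun w => (w \in A :\ u) && e v w)).
    apply: ler_sum => w /andP[+ evw]; rewrite !inE => /andP[_ wA].
    by have [_ /(_ ruv)] := IHw w wA evw.
  by move=> w; rewrite !inE andbC andbA.
rewrite [leRHS](eq_bigl (fun w => (w \in A) && e v w)).
  by apply: ler_sum => w /andP[wA evw]; have [/(_ ruv)] := IHw w wA evw.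
move=> w; rewrite !inE; case: eqVneq => // ->.
by case evu: (e v u); rewrite ?andbF //; move: ruv; rewrite (e_row evu); case: (row v).
Qed.

Section Truncation.
Variable c : V -> R.
Hypothesis c_gt0 : forall v, 0 < c v.

(** The boundary values are the trivial upper bound 1 / c v for rows and the trivial lower bound 0
    for columns. By parity every row value is then an upper bound and every column value a lower
    bound. *)
Fixpoint trunc_ratio t A v : R :=
  if t is t'.+1 then (c v + \sum_(w in A | e v w) trunc_ratio t' (A :\ w) w)^-1
  else if row v then (c v)^-1 else 0.

Lemma trunc_ratio_ge0 t A v : 0 <= trunc_ratio t A v.
Proof.
elim: t A v => [|t IH] A v /=; first by case: ifP => // _; rewrite invr_ge0 ltW.
by rewrite invr_ge0 addr_ge0 ?sumr_ge0 // ltW.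
Qed.

Lemma trunc_den_gt0 t A v : 0 < c v + \sum_(w in A | e v w) trunc_ratio t (A :\ w) w.
Proof. by rewrite ltr_pwDl // sumr_ge0 // => w _; exact: trunc_ratio_ge0. Qed.

Lemma ratio_den_gt0 A v : 0 < c v + \sum_(w in A | e v w) ratio e c (A :\ w) w.
Proof. by rewrite ltr_pwDl // sumr_ge0 // => w _; exact/ltW/ratio_gt0. Qed.

Lemma ratioE A v : v \notin A ->
  ratio e c A v = (c v + \sum_(w in A | e v w) ratio e c (A :\ w) w)^-1.
Proof. by move=> vA; rewrite -ratio_recE // invrK. Qed.

Lemma trunc_ratio_bound t A v : v \notin A ->
  (row v -> ratio e c A v <= trunc_ratio t A v) /\
  (~~ row v -> trunc_ratio t A v <= ratio e c A v).
Proof.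
elim: t A v => [|t IH] A v vA /=.
  split=> rv; rewrite ?rv ?(negbTE rv); first exact: ratio_le_invc.
  exact/ltW/ratio_gt0.
rewrite ratioE //; split=> rv;
  rewrite lef_pV2 ?posrE ?trunc_den_gt0 ?ratio_den_gt0 // lerD2l;
  apply: ler_sum => w /andP[wA evw]; apply IH;
  by rewrite ?inE ?eqxx ?(e_row evw) ?rv.
Qed.

(** Every level deletes a vertex, so the boundary values are never reached. *)
Lemma trunc_ratio_exact t A v : v \notin A -> (#|A| < t)%N ->
  trunc_ratio t A v = ratio e c A v.
Proof.
elim: t A v => // t IH A v vA; rewrite ltnS => At /=; rewrite ratioE //.
congr (_ + _)^-1; apply: eq_bigr => w /andP[wA _]; apply: IH.
  by rewrite !inE eqxx.
by move: At; rewrite (cardsD1 w) wA.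
Qed.

Section Decay.
Variable s : R.
Hypothesis s_ge2 : 2 <= s.
Hypothesis load : forall i, row i -> \sum_(j | e i j) (c j)^-1 <= s ^+ 2 * c i.

(* Bounds the relative error of the truncation at depth [t] of a row ratio. *)
Definition theta t := s ^+ 2 * (1 - s^-1) ^+ t./2.

Let s_gt0 : 0 < s. Proof. by apply: lt_le_trans s_ge2; lra. Qed.

Let invs_le1 : 0 <= 1 - s^-1.
Proof. by rewrite subr_ge0 invf_le1 //; have := s_ge2; lra. Qed.

Lemma theta_ge0 t : 0 <= theta t.
Proof. by rewrite mulr_ge0 ?exprn_ge0 // ltW. Qed.

Lemma theta_step t : theta t.+2 = theta t * (1 - s^-1).
Proof. by rewrite /theta (_ : t.+2./2 = t./2.+1) // (exprSr _ t./2) mulrA. Qed.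

(* Since [2 l y <= c y^2 + l^2 / c], applied with [l = 1 / (2 s)]. *)
Lemma hole_mass (P : pred V) (Q : V -> R) i : row i ->
  (forall j, P j -> e i j) ->
  (c i + \sum_(j | P j) Q j) / s <= c i + \sum_(j | P j) c j * Q j ^+ 2.
Proof.
move=> ri Pe.
have h1 : \sum_(j | P j) (Q j / s - (c j)^-1 / (4 * s ^+ 2)) <=
          \sum_(j | P j) c j * Q j ^+ 2.
  apply: ler_sum => j _; rewrite -subr_ge0.
  have -> : c j * Q j ^+ 2 - (Q j / s - (c j)^-1 / (4 * s ^+ 2)) =
      c j * (Q j - (c j * 2 * s)^-1) ^+ 2.
    by field; rewrite !gt_eqF.
  by rewrite mulr_ge0 ?sqr_ge0 ?ltW.
have h2 : \sum_(j | P j) (c j)^-1 <= s ^+ 2 * c i.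
  apply: le_trans (load ri); rewrite [leRHS](bigID P) /=.
  rewrite [X in _ <= X + _](eq_bigl P); last first.
    by move=> j; case Pj: (P j); rewrite ?andbF // Pe.
  by rewrite lerDl sumr_ge0 // => j _; rewrite invr_ge0 ltW.
rewrite sumrB -!mulr_suml in h1.
have h3 : (\sum_(j | P j) (c j)^-1) / (4 * s ^+ 2) <= c i / 4.
  rewrite ler_pdivrMr ?mulr_gt0 ?exprn_gt0 //; apply: le_trans h2 _.
  by have -> : c i / 4 * (4 * s ^+ 2) = s ^+ 2 * c i by field.
have h4 : c i / s <= c i / 2.
  by rewrite ler_wpM2l ?(ltW (c_gt0 i)) // lef_pV2 ?posrE //; lra.
have := c_gt0 i; rewrite mulrDl; lra.
Qed.

(* Tangent-line form of Jensen's inequality for [x |-> 1 / (1 + th x)]. *)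
Lemma convex_step (P : pred V) (Q p : V -> R) (ci th k : R) :
  0 <= th -> 0 <= k -> 0 < ci -> (forall j, P j -> 0 <= Q j) ->
  (forall j, P j -> p j <= 1) ->
  \sum_(j | P j) Q j * (1 - p j) <= k * (ci + \sum_(j | P j) Q j) ->
  (ci + \sum_(j | P j) Q j) / (1 + th * k) <=
  ci + \sum_(j | P j) Q j / (1 + th * (1 - p j)).
Proof.
move=> th0 k0 ci0 Q0 p1 h; set w := 1 + th * k; set S := \sum_(j | P j) Q j in h *.
have w0 : 0 < w by rewrite ltr_pwDl // mulr_ge0.
have tang u : 0 < u -> (2 * w - u) / w ^+ 2 <= u^-1.
  move=> u0; rewrite -subr_ge0.
  have -> : u^-1 - (2 * w - u) / w ^+ 2 = (w - u) ^+ 2 / (u * w ^+ 2).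
    by field; rewrite !gt_eqF.
  by rewrite divr_ge0 ?sqr_ge0 // mulr_ge0 ?exprn_ge0 ?ltW.
have h1 : \sum_(j | P j) Q j * ((2 * w - (1 + th * (1 - p j))) / w ^+ 2) <=
          \sum_(j | P j) Q j / (1 + th * (1 - p j)).
  apply: ler_sum => j Pj; rewrite ler_wpM2l ?Q0 // tang //.
  by rewrite ltr_pwDl // mulr_ge0 // subr_ge0 p1.
have tci : ci * ((2 * w - 1) / w ^+ 2) <= ci.
  by have := ler_wpM2l (ltW ci0) (tang 1 ltr01); rewrite invr1 mulr1.
apply: le_trans (lerD tci h1).
set Y := \sum_(j | P j) Q j * (1 - p j) in h.
have -> : \sum_(j | P j) Q j * ((2 * w - (1 + th * (1 - p j))) / w ^+ 2) =
    ((2 * w - 1) * S - th * Y) / w ^+ 2.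
  rewrite /S /Y !mulr_sumr -sumrB mulr_suml; apply: eq_bigr => j _.
  by field; rewrite gt_eqF.
rewrite -subr_ge0.
have -> : ci * ((2 * w - 1) / w ^+ 2) + ((2 * w - 1) * S - th * Y) / w ^+ 2 -
    (ci + S) / w = th * (k * (ci + S) - Y) / w ^+ 2.
  have -> : th * (k * (ci + S) - Y) = (w - 1) * (ci + S) - th * Y by rewrite /w; ring.
  by field; rewrite gt_eqF.
by rewrite divr_ge0 ?exprn_ge0 ?(ltW w0) // mulr_ge0 // subr_ge0.
Qed.

(** In the denominator of a column j only the neighbour terms carry an error; its own weight is
    exact. A relative row error theta therefore becomes theta (1 - p j) at the column, with p j = c
    j * ratio its hole probability. [convex_step] averages this over the columns of a row, and
    [hole_mass] yields the factor 1 - 1 / s for every two levels. *)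
Lemma trunc_ratio_decay t A v : v \notin A ->
  (row v -> trunc_ratio t A v <= (1 + theta t) * ratio e c A v) /\
  (~~ row v -> ratio e c A v <= (1 + theta t) * trunc_ratio t.+1 A v).
Proof.
have invM1 (u x y : R) : 0 < x -> 0 < y -> 0 < u -> x <= u * y -> y^-1 <= u * x^-1.
  move=> x0 y0 u0 h; rewrite -[y^-1]mul1r ler_pdivrMr // mulrAC ler_pdivlMr //.
  by rewrite mul1r.
have th1 u : 0 < 1 + theta u by rewrite ltr_pwDl // theta_ge0.
have colP u : (forall A v, v \notin A -> row v ->
    trunc_ratio u A v <= (1 + theta u) * ratio e c A v) ->
    forall A v, v \notin A -> ~~ row v ->
    ratio e c A v <= (1 + theta u) * trunc_ratio u.+1 A v.
  move=> hu B x xB rx /=; rewrite ratioE //; apply: invM1;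
    rewrite ?trunc_den_gt0 ?ratio_den_gt0 // mulrDr; apply: lerD.
    by rewrite ler_peMl ?lerDl ?theta_ge0 // ltW.
  rewrite mulr_sumr; apply: ler_sum => w /andP[_ exw]; apply: hu.
    by rewrite !inE eqxx.
  by rewrite (e_row exw).
suff rowP u : forall A v, v \notin A -> row v ->
    trunc_ratio u A v <= (1 + theta u) * ratio e c A v.
  by move=> vA; split=> rv; [exact: rowP | apply: colP => //; exact: rowP].
(* At depths 0 and 1 the truncated row value is 1 / c x; the load hypothesis bounds the neglected
   neighbour terms by s ^ 2 * c x. *)
have base (B : {set V}) x : x \notin B -> row x ->
    (c x)^-1 <= (1 + s ^+ 2) * ratio e c B x.
  move=> xB rx; rewrite ratioE //; apply: invM1; rewrite ?ratio_den_gt0 //.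
    by rewrite ltr_pwDl // exprn_ge0 // ltW.
  rewrite mulrDl mul1r lerD2l; apply: le_trans (load rx).
  rewrite big_mkcond [leRHS]big_mkcond; apply: ler_sum => j _.
  have cj : 0 <= (c j)^-1 by rewrite invr_ge0 ltW.
  case: (e x j); rewrite ?andbF // andbT; case: ifP => // _.
  by apply: ratio_le_invc; rewrite // !inE eqxx.
(* Depth u + 2 is reached from depth u, so two consecutive depths are carried along. *)
suff: (forall A v, v \notin A -> row v ->
        trunc_ratio u A v <= (1 + theta u) * ratio e c A v) /\
      (forall A v, v \notin A -> row v ->
        trunc_ratio u.+1 A v <= (1 + theta u.+1) * ratio e c A v) by case.
elim: u => [|u [IH0 IH1]]; split=> B x xB rx.
- by rewrite /= rx /theta /= expr0 mulr1; exact: base.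
- rewrite /= /theta /= expr0 mulr1; rewrite big1 ?addr0; first exact: base.
  by move=> w /andP[_ exw]; rewrite (e_row exw) rx.
- exact: IH1.
have hc j : ~~ row j -> forall D : {set V}, j \notin D -> 
    ratio e c D j / (1 + theta u * (1 - c j * ratio e c D j)) <= trunc_ratio u.+1 D j.
  move=> rj D jD /=; set q := ratio e c D j.
  have q0 : 0 < q by exact: ratio_gt0.
  have qi : q^-1 = c j + \sum_(w in D | e j w) ratio e c (D :\ w) w by exact: ratio_recE.
  have p1 : c j * q <= 1 by rewrite -ler_pdivlMr // mul1r qi lerDl sumr_ge0 // => w _; exact/ltW/ratio_gt0.
  have d0 : 0 < 1 + theta u * (1 - c j * q).
    by rewrite ltr_pwDl // mulr_ge0 ?theta_ge0 // subr_ge0.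
  have qd0 : 0 < (1 + theta u * (1 - c j * q)) / q by rewrite divr_gt0.
  rewrite -invf_div lef_pV2 ?posrE ?trunc_den_gt0 //.
  have -> : (1 + theta u * (1 - c j * q)) / q =
      c j + (1 + theta u) * (q^-1 - c j) by field; rewrite gt_eqF.
  rewrite lerD2l qi [c j + _]addrC addrK mulr_sumr; apply: ler_sum => w /andP[_ ejw].
  by apply: IH0; rewrite ?(e_row ejw) // !inE eqxx.
have -> : trunc_ratio u.+2 B x =
  (c x + \sum_(w in B | e x w) trunc_ratio u.+1 (B :\ w) w)^-1 by [].
rewrite ratioE //; apply: invM1; [exact: ratio_den_gt0|exact: trunc_den_gt0|exact: th1|].
rewrite theta_step -ler_pdivrMl; last by rewrite -theta_step.
rewrite mulrC.
have P1 j : (j \in B) && e x j -> c j * ratio e c (B :\ j) j <= 1.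
  move=> _; rewrite -ler_pdivlMl // mulr1 ratio_le_invc // ?inE ?eqxx //.
have conv := @convex_step (fun j => (j \in B) && e x j) (fun j => ratio e c (B :\ j) j)
  (fun j => c j * ratio e c (B :\ j) j) (c x) (theta u) (1 - s^-1) (theta_ge0 u) invs_le1
  (c_gt0 x) (fun j _ => ltW (ratio_gt0 e c_gt0 _ _)) P1.
apply: le_trans (conv _) _.
  have := @hole_mass (fun j => (j \in B) && e x j) (fun j => ratio e c (B :\ j) j) x rx
    (fun j h => proj2 (andP h)).
  set S := \sum_(j | _) ratio _ _ _ _; set S2 := \sum_(j | _) c j * _.
  rewrite (_ : \sum_(j | _) _ = S - S2); first by rewrite mulrBl mul1r [s^-1 * _]mulrC; lra.
  by rewrite -sumrB; apply: eq_bigr => j _; ring.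
rewrite lerD2l; apply: ler_sum => j /andP[_ exj]; apply: hc.
  by rewrite (e_row exj) rx.
by rewrite !inE eqxx.
Qed.

End Decay.
End Truncation.
End Bipartite.

(** * Column weights *)

Lemma ln_le_sub1 (R : realType) (x : R) : 0 < x -> ln x <= x - 1.
Proof.
by move=> x0; rewrite (_ : ln x = ln (1 + (x - 1))) ?le_ln1Dx //; [lra|congr ln; ring].
Qed.

Section Weights.
Variables (R : realType) (V : finType) (e : rel V) (row : pred V).
Hypothesis e_sym : symmetric e.
Hypothesis e_row : forall v w, e v w -> row w = ~~ row v.
Implicit Types (A U : {set V}) (c x : V -> R).

Lemma eq_hole_poly c c' A : {in A, c =1 c'} -> hole_poly e c A = hole_poly e c' A.
Proof.
move=> h; apply: eq_bigr => s _; apply: eq_bigr => v /andP[vA _]; exact: h.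
Qed.

Lemma setC1K (v : V) : v |: ~: [set v] = [set: V]%SET.
Proof. by apply/setP => u; rewrite !inE orbN. Qed.

Lemma notin_setC1 (v : V) : v \notin ~: [set v].
Proof. by rewrite !inE eqxx. Qed.

Definition ratioT c v := ratio e c (~: [set v]) v.

(** The probability that v is unmatched in a random matching whose weight is the product over its
    holes ([hole_sum]). *)
Definition hole c v := c v * ratioT c v.

Lemma ratioT_gt0 c v : (forall v, 0 < c v) -> 0 < ratioT c v.
Proof. by move=> hc; rewrite /ratioT ratio_gt0. Qed.

Lemma hole_gt0 c v : (forall v, 0 < c v) -> 0 < hole c v.
Proof. by move=> hc; rewrite mulr_gt0 ?ratioT_gt0. Qed.

(** The weight of v occurs at most once in every term, so H is affine in it, with slope H without
    v. *)
Lemma hole_poly_affine c c' v : (forall v, 0 < c v) ->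
  (forall u, u != v -> c' u = c u) ->
  hole_poly e c' [set: V]%SET =
  hole_poly e c [set: V]%SET * (1 + (c' v - c v) * ratioT c v).
Proof.
move=> hc h; rewrite /ratioT /ratio setC1K mulrDr mulr1 mulrCA.
rewrite [X in _ = _ + _ * X]mulrCA mulfV ?gt_eqF ?hole_poly_gt0 // mulr1.
rewrite -(setC1K v) !hole_poly_rec ?notin_setC1 //.
rewrite (eq_hole_poly (c := c') (c' := c)); last by move=> u; rewrite !inE; exact: h.
rewrite [X in _ + X = _](eq_bigr (fun w => hole_poly e c (~: [set v] :\ w))).
  by rewrite mulrBl; ring.
move=> w _; apply: eq_hole_poly => u; rewrite !inE => /andP[_]; exact: h.
Qed.

(** The rows of S are lowered one by one. Lowering the others only raises the ratio of row i, and c'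
    i - c i is nonpositive, so the factor 1 + (c' i - c i) * ratio is at most the exponential formed
    with the original ratio. *)
Lemma hole_poly_lower_rows c c' (S : {set V}) :
  (forall v, 0 < c v) -> (forall v, 0 < c' v) ->
  (forall v, v \in S -> row v /\ c' v <= c v) ->
  (forall v, v \notin S -> c' v = c v) ->
  hole_poly e c' [set: V]%SET <=
  hole_poly e c [set: V]%SET * \prod_(i in S) expR ((c' i - c i) * ratioT c i).
Proof.
move=> hc; have [k] := ubnP #|S|.
elim: k => // k IH in c' S *; rewrite ltnS => Sk hc' hS hS'.
have [S0|[i iS]] := set_0Vmem S.
  rewrite S0 big_set0 mulr1 le_eqVlt (eq_hole_poly (c := c') (c' := c)) ?eqxx //.
  by move=> v _; apply: hS'; rewrite S0 inE.
pose c1 v := if v == i then c i else c' v.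
have hc1 v : 0 < c1 v by rewrite /c1; case: eqP.
have [ri ci] := hS i iS.
have IH1 := IH c1 (S :\ i) _ hc1 _ _.
have aff : hole_poly e c' [set: V]%SET =
    hole_poly e c1 [set: V]%SET * (1 + (c' i - c1 i) * ratioT c1 i).
  by apply: hole_poly_affine => // u /negbTE ui; rewrite /c1 ui.
rewrite aff (big_setD1 i) //= mulrC [leRHS]mulrCA.
have c1i : c1 i = c i by rewrite /c1 eqxx.
apply: ler_pM.
- have := hole_poly_gt0 e hc' [set: V]%SET.
  by rewrite aff (pmulr_rgt0 _ (hole_poly_gt0 e hc1 _)) => /ltW.
- exact/ltW/hole_poly_gt0.
- apply: le_trans (expR_ge1Dx _) _; rewrite ler_expR c1i ler_wnM2l ?subr_le0 //.
  have [] := @ratio_mono R V e row e_sym e_row c c1 (~: [set i]) i hc hc1.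
  + by move=> v rv; rewrite /c1; case: eqP => [->//|_]; have [/hS[_ ->]|/hS'->] := boolP (v \in S).
  + move=> v rv; rewrite /c1; case: eqP => [->//|_].
    have [/hS[rv' _]|/hS'->//] := boolP (v \in S); by rewrite rv' in rv.
  + exact: notin_setC1.
  + by move=> /(_ ri).
- rewrite [leRHS](_ : _ = hole_poly e c [set: V]%SET *
    \prod_(j in S :\ i) expR ((c1 j - c j) * ratioT c j)); last first.
    congr (_ * _); apply: eq_bigr => j; rewrite !inE => /andP[/negbTE ji _].
    by rewrite /c1 ji.
  apply: IH1.
  + by move: Sk; rewrite (cardsD1 i) iS.
  + move=> v; rewrite !inE => /andP[/negbTE vi vS]; rewrite /c1 vi; exact: hS.
  + move=> v; rewrite !inE negb_and negbK /c1; case: eqP => [->//|_] /=; exact: hS'.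
Qed.

Section Load.
Variable s : R.
Hypothesis s_ge2 : 2 <= s.
Hypothesis row_nbr : forall i, row i -> exists j, e i j.

Let s_gt0 : 0 < s. Proof. by apply: lt_le_trans s_ge2; lra. Qed.
Let s2_gt0 : 0 < s ^+ 2. Proof. by rewrite exprn_gt0. Qed.

(* The least row weights for which the truncation error decays. *)
Definition wts x v := if row v then s ^- 2 * \sum_(j | e v j) (x j)^-1 else x v.

Definition double x k v : R := if v == k then 2 * x k else x v.

(* Expected number of holes that the rows place on account of the column j. *)
Definition row_load x j := (\sum_(i | e j i) ratioT (wts x) i) / (s ^+ 2 * x j).

Lemma wts_gt0 x : (forall v, 0 < x v) -> forall v, 0 < wts x v.
Proof.
move=> hx v; rewrite /wts; case: ifP => // rv.
have [j evj] := row_nbr rv; rewrite mulr_gt0 ?invr_gt0 // (bigD1 j) //=.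
by rewrite ltr_pwDl ?invr_gt0 // sumr_ge0 // => i _; rewrite invr_ge0 ltW.
Qed.

Lemma double_gt0 x k : (forall v, 0 < x v) -> forall v, 0 < double x k v.
Proof. by move=> hx v; rewrite /double; case: eqP => // _; rewrite mulr_gt0. Qed.

Lemma wts_col x v : ~~ row v -> wts x v = x v.
Proof. by rewrite /wts => /negbTE ->. Qed.

Lemma wts_double_col x k v : ~~ row v -> wts (double x k) v = double x k v.
Proof. by rewrite /wts => /negbTE ->. Qed.

Lemma wts_double_row x k i : (forall v, 0 < x v) -> ~~ row k -> row i ->
  wts (double x k) i = wts x i - (if e i k then (2 * s ^+ 2 * x k)^-1 else 0).
Proof.
move=> hx rk ri; rewrite /wts ri.
have [eik|eik] := boolP (e i k); last first.
  rewrite subr0; congr (_ * _); apply: eq_bigr => j eij; rewrite /double.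
  by case: eqP => // jk; rewrite jk (negbTE eik) in eij.
rewrite !(bigD1 k eik) /= {1}/double eqxx.
rewrite (eq_bigr (fun j => (x j)^-1)); last first.
  by move=> j /andP[_ /negbTE jk]; rewrite /double jk.
by field; rewrite !gt_eqF.
Qed.

Lemma wts_double_le x k v : (forall v, 0 < x v) -> ~~ row k ->
  (row v -> wts (double x k) v <= wts x v) /\
  (~~ row v -> wts x v <= wts (double x k) v).
Proof.
move=> hx rk; split=> rv.
  rewrite wts_double_row // gerBl; case: ifP => // _.
  by rewrite invr_ge0 ltW // !mulr_gt0.
rewrite wts_double_col // {1}/wts (negbTE rv) /double; case: eqP => // ->.
by rewrite ler_peMl ?(ltW (hx _)) //; lra.
Qed.

Lemma ratioT_double x k v : (forall v, 0 < x v) -> ~~ row k ->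
  (row v -> ratioT (wts x) v <= ratioT (wts (double x k)) v) /\
  (~~ row v -> ratioT (wts (double x k)) v <= ratioT (wts x) v).
Proof.
move=> hx rk; apply: (ratio_mono e_sym e_row).
- exact: wts_gt0.
- exact/wts_gt0/double_gt0.
- by move=> u ru; have [/(_ ru)] := @wts_double_le x k u hx rk.
- by move=> u ru; have [_ /(_ ru)] := @wts_double_le x k u hx rk.
- exact: notin_setC1.
Qed.

(** Each row next to k loses the weight (2 s ^ 2 x k)^-1, which gains exp(- load / 2). After that,
    doubling x k costs at most 1 + hole, because lowered rows can only decrease the ratio of k. The
    intermediate weights [c1] separate the two effects. *)
Lemma potential_decrease x k : (forall v, 0 < x v) -> ~~ row k ->
  hole_poly e (wts (double x k)) [set: V]%SET <=
  hole_poly e (wts x) [set: V]%SET *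
    expR (hole (wts x) k - row_load x k / 2).
Proof.
move=> hx rk; have hc := wts_gt0 hx; have hc2 := wts_gt0 (double_gt0 k hx).
pose c1 v := if v == k then wts x v else wts (double x k) v.
have hc1 v : 0 < c1 v by rewrite /c1; case: ifP.
have c1k : c1 k = x k by rewrite /c1 eqxx /wts (negbTE rk).
rewrite (@hole_poly_affine c1 _ k hc1); last by move=> u /negbTE uk; rewrite /c1 uk.
rewrite wts_double_col // c1k /double eqxx expRD mulrC [leRHS]mulrCA.
have -> : 2 * x k - x k = x k by ring.
have c1le v : row v -> c1 v <= wts x v.
  by move=> rv; rewrite /c1; case: eqP => // _; have [/(_ rv)] := @wts_double_le x k v hx rk.
apply: ler_pM.
- by rewrite addr_ge0 // mulr_ge0 ?(ltW (hx _)) // ltW // ratioT_gt0.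
- exact/ltW/hole_poly_gt0.
- apply: le_trans (expR_ge1Dx _) _; rewrite ler_expR /hole wts_col //.
  rewrite ler_pM2l //.
  have c1ge v : ~~ row v -> wts x v <= c1 v.
    move=> rv; rewrite /c1; case: eqP => // /eqP vk.
    by have [_ /(_ rv)] := @wts_double_le x k v hx rk.
  have [_] := @ratio_mono R V e row e_sym e_row (wts x) c1 (~: [set k]) k hc hc1
     c1le c1ge (notin_setC1 k).
  exact.
have -> : - (row_load x k / 2) =
    \sum_(i in [set i | e k i]) (c1 i - wts x i) * ratioT (wts x) i.
  rewrite /row_load mulrAC mulr_suml mulr_suml -sumrN.
  apply: eq_big => [i|i eki]; first by rewrite inE.
  have ri : row i by rewrite (e_row eki) rk.
  have ik : (i == k) = false by apply/negbTE/eqP => ik; rewrite ik (negbTE rk) in ri.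
  rewrite /c1 ik wts_double_row // e_sym eki.
  by field; rewrite !gt_eqF.
rewrite expR_sum; apply: hole_poly_lower_rows => // v; rewrite inE.
  move=> ekv; have rv : row v; first by rewrite (e_row ekv) rk.
  by split=> //; exact: c1le.
move=> ekv; rewrite /c1; case: eqP => // /eqP vk.
have [rv|rv] := boolP (row v).
  by rewrite wts_double_row // e_sym (negbTE ekv) subr0.
by rewrite wts_double_col // /double (negbTE vk) /wts (negbTE rv).
Qed.

(** The invariant under which the logarithm of a raised column weight can be charged to the rows in
    [sum_hole_ln]. *)
Definition tame x := forall j, ~~ row j ->
  1 <= x j /\ (1 < x j -> hole (wts x) j <= row_load x j).

Lemma row_load_double x j k : (forall v, 0 < x v) -> ~~ row k -> ~~ row j ->
  row_load x j <= row_load (double x k) j * (if j == k then 2 else 1).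
Proof.
move=> hx rk rj.
have h : \sum_(i | e j i) ratioT (wts x) i <=
         \sum_(i | e j i) ratioT (wts (double x k)) i.
  apply: ler_sum => i eji; have ri : row i by rewrite (e_row eji) rj.
  by have [/(_ ri)] := @ratioT_double x k i hx rk.
have -> : row_load (double x k) j * (if j == k then 2 else 1) =
    (\sum_(i | e j i) ratioT (wts (double x k)) i) / (s ^+ 2 * x j).
  rewrite /row_load /double; case: eqP => [->|_]; last by rewrite mulr1.
  by field; rewrite !gt_eqF.
by rewrite /row_load ler_pM2r // invr_gt0 mulr_gt0.
Qed.

Lemma hole_double x j k : (forall v, 0 < x v) -> ~~ row k -> ~~ row j ->
  hole (wts (double x k)) j <= hole (wts x) j * (if j == k then 2 else 1).
Proof.
move=> hx rk rj; rewrite /hole wts_double_col // wts_col // mulrAC.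
have -> : double x k j = x j * (if j == k then 2 else 1).
  by rewrite /double; case: eqP => [->|_]; rewrite ?mulr1 // mulrC.
have [_ /(_ rj) h] := @ratioT_double x k j hx rk.
by rewrite ler_wpM2l // mulr_ge0 ?(ltW (hx _)) //; case: eqP.
Qed.

(** A doubling at most doubles the hole probability of k and at most halves its load, whence the
    factor 4. At the other columns loads only grow and hole probabilities only fall. *)
Lemma tame_double x k : (forall v, 0 < x v) -> ~~ row k -> tame x ->
  hole (wts x) k <= row_load x k / 4 -> tame (double x k).
Proof.
move=> hx rk tx hk j rj; have [x1 hj] := tx j rj; split.
  by rewrite /double; have [] := tx k rk; case: eqP => // _; lra.
move=> dx; have := row_load_double hx rk rj; have := hole_double hx rk rj.
case: eqP dx => [-> _|jk dx].
  have h0 := hole_gt0 k (wts_gt0 hx); lra.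
move: dx; rewrite /double; case: eqP => // _ /hj; lra.
Qed.

(** Every row next to j has weight at least 1 / (s ^ 2 x j), hence ratio at most s ^ 2 x j, which
    bounds the denominator of j. This is the least progress that a doubling makes. *)
Lemma hole_col_ge x j : (forall v, 0 < x v) -> ~~ row j ->
  (1 + #|V|%:R * s ^+ 2)^-1 <= hole (wts x) j.
Proof.
move=> hx rj; have hc := wts_gt0 hx.
have xj : wts x j = x j by rewrite /wts (negbTE rj).
have h0 := hole_gt0 j hc.
rewrite -[leRHS]invrK lef_pV2 ?posrE ?invr_gt0 //; last first.
  by rewrite ltr_pwDl // mulr_ge0 ?(ltW s2_gt0).
rewrite /hole invfM /ratioT ratio_rec ?notin_setC1 //.
rewrite xj mulrC mulrDl divff ?gt_eqF // lerD2l ler_pdivrMr //.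
apply: (@le_trans _ _ (\sum_(w : V) s ^+ 2 * x j)); last first.
  by rewrite sumr_const -[leRHS]mulrA mulr_natl.
rewrite big_mkcond; apply: ler_sum => i _.
case: ifP => [/andP[_ eji]|_]; last by rewrite mulr_ge0 ?(ltW s2_gt0) ?(ltW (hx j)).
have ri : row i by rewrite (e_row eji) rj.
apply: le_trans (ratio_le_invc e_sym hc _) _; first by rewrite !inE eqxx.
rewrite -[leRHS]invrK lef_pV2 ?posrE ?invr_gt0 ?mulr_gt0 // invfM /wts ri.
rewrite ler_wpM2l ?invr_ge0 ?(ltW s2_gt0) // (bigD1 j) 1?e_sym //=.
by rewrite lerDl sumr_ge0 // => w _; rewrite invr_ge0 ltW.
Qed.

Lemma row_adj i j : ~~ row j -> (row i && e i j) = e j i.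
Proof.
move=> rj; rewrite (e_sym i j); case eji: (e j i); last by rewrite andbF.
by rewrite (e_row eji) rj.
Qed.

(** Double counting over the edges: the weight of a row is a sum over its columns, hence so is its
    hole probability. *)
Lemma sum_hole_rows x : (forall v, 0 < x v) ->
  \sum_(i | row i) hole (wts x) i = \sum_(j | ~~ row j) row_load x j.
Proof.
move=> hx; rewrite (eq_bigr (fun i => \sum_(j | e i j) ratioT (wts x) i / (s ^+ 2 * x j))).
  rewrite (exchange_big_dep (fun j => ~~ row j)) /=; last first.
    by move=> i j ri eij; rewrite (e_row eij) ri.
  apply: eq_bigr => j rj; rewrite /row_load mulr_suml; apply: eq_bigl => i.
  by rewrite row_adj.
move=> i ri; rewrite /hole {1}/wts ri mulrAC mulr_sumr; apply: eq_bigr => j _.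
by field; rewrite !gt_eqF.
Qed.

(** Up to s ^ -2 the product is the ratio of j times the sum of the ratios of its rows. Deleting j
    only raises the latter, and with the raised ratios the product is the probability that j is
    matched. *)
Lemma load_hole_le x j : (forall v, 0 < x v) -> ~~ row j ->
  row_load x j * hole (wts x) j <= s ^- 2.
Proof.
move=> hx rj; have hc := wts_gt0 hx.
rewrite /row_load /hole wts_col //.
have -> : (\sum_(i | e j i) ratioT (wts x) i) / (s ^+ 2 * x j) *
   (x j * ratioT (wts x) j) = s ^- 2 * (ratioT (wts x) j * \sum_(i | e j i) ratioT (wts x) i).
  by field; rewrite !gt_eqF.
rewrite ler_piMr ?invr_ge0 ?(ltW s2_gt0) //.
rewrite -ler_pdivlMl ?ratioT_gt0 // mulr1 {2}/ratioT ratio_rec ?notin_setC1 //.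
rewrite -[leLHS]add0r; apply: lerD; first exact: ltW.
rewrite big_mkcond [leRHS]big_mkcond; apply: ler_sum => i _.
case eji: (e j i) => /=; last by rewrite andbF.
have ij : i != j by apply/eqP => ij; rewrite ij in eji; have := e_row eji; case: (row j).
rewrite !inE ij /= /ratioT.
have -> : ~: [set j] :\ i = ~: [set i] :\ j by apply/setP => u; rewrite !inE andbC.
have [/(_ _) + _] := @ratio_remove R V e row e_sym e_row (wts x) (~: [set i]) j i hc (notin_setC1 i).
by apply; rewrite (e_row eji); case: (row j).
Qed.

(** Load and hole probability are inversely related by [load_hole_le], so a load of at most 16 times
    the hole probability is at most 4 / s. *)
Lemma sum_hole_rows_le x n : (forall v, 0 < x v) ->
  #|[set j | ~~ row j]| = n ->
  (forall j, ~~ row j -> row_load x j <= 16 * hole (wts x) j) ->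
  \sum_(i | row i) hole (wts x) i <= 4 * n%:R / s.
Proof.
move=> hx cn h; rewrite sum_hole_rows //.
(* [g <= g^2 s / 8 + 2 / s], and [g^2 <= 16 / s^2] *)
apply: (@le_trans _ _ (\sum_(j | ~~ row j) 4 / s)).
  apply: ler_sum => j rj; have h0 := hole_gt0 j (wts_gt0 hx).
  have g0 : 0 <= row_load x j.
    apply: divr_ge0; last exact/ltW/mulr_gt0.
    by apply: sumr_ge0 => i _; exact/ltW/ratioT_gt0/wts_gt0.
  have h1 : row_load x j ^+ 2 <= (4 / s) ^+ 2.
    rewrite [leRHS]exprMn [s^-1 ^+ 2]exprVn; have := load_hole_le hx rj.
    have := ler_wpM2l g0 (h j rj); rewrite -expr2.
    set g := row_load x j; set q := hole _ j; set a := s ^- 2.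
    rewrite [g * (16 * q)]mulrCA => h2 h3.
    have -> : 4 ^+ 2 * a = 16 * a by ring.
    by apply: le_trans h2 _; rewrite ler_pM2l.
  by rewrite -(ler_pXn2r (n := 2)) ?nnegrE // divr_ge0 // ltW.
rewrite sumr_const -mulr_natr le_eqVlt; apply/orP; left; apply/eqP.
by rewrite -cn cardsE; ring.
Qed.

(* By concavity of the logarithm, the distribution with density [1 / x j] on the
   neighbours of the row [i] has entropy at most the logarithm of its degree. *)
Lemma entropy_row x i (D : R) : (forall v, 0 < x v) -> row i ->
  #|[set j | e i j]|%:R <= D ->
  \sum_(j | e i j) (x j)^-1 * ln (x j) +
  (\sum_(j | e i j) (x j)^-1) * ln (\sum_(j | e i j) (x j)^-1) <=
  (\sum_(j | e i j) (x j)^-1) * ln D.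
Proof.
move=> hx ri hD; set S := \sum_(j | e i j) (x j)^-1.
have [j0 ej0] := row_nbr ri.
have S0 : 0 < S.
  by rewrite /S (bigD1 j0) //= ltr_pwDl ?invr_gt0 // sumr_ge0 // => j _; rewrite invr_ge0 ltW.
have D0 : 0 < D.
  apply: lt_le_trans hD; rewrite ltr0n card_gt0; apply/set0Pn; exists j0.
  by rewrite inE.
rewrite -subr_ge0.
have -> : S * ln D - (\sum_(j | e i j) (x j)^-1 * ln (x j) + S * ln S) =
    \sum_(j | e i j) - ((x j)^-1 * ln (x j * S / D)).
  rewrite sumrN /S !mulr_suml -big_split /= -sumrB -sumrN; apply: eq_bigr => j _.
  rewrite !lnM ?lnV ?posrE ?mulr_gt0 ?invr_gt0 //; ring.
apply: (@le_trans _ _ (\sum_(j | e i j) (x j)^-1 * (1 - x j * S / D))).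
  rewrite (eq_bigr (fun j => (x j)^-1 - S / D)).
    rewrite sumrB subr_ge0 sumr_const -mulr_natl -/S mulrA ler_pdivrMr //.
    by rewrite mulrC ler_pM2l //; move: hD; rewrite cardsE.
  by move=> j _; field; rewrite !gt_eqF.
apply: ler_sum => j _; rewrite -[leRHS]mulrN ler_wpM2l ?invr_ge0 ?(ltW (hx j)) //.
have p0 : 0 < x j * S / D by rewrite divr_gt0 // mulr_gt0.
by rewrite lerNr opprB ln_le_sub1.
Qed.

(** On the columns, hole probabilities may be replaced by loads, either by tameness or because ln 1
    = 0. Split along the edges, the loads join the term of their row, where [entropy_row] applies;
    the factor s ^ -2 inside the logarithm of the row weight only helps. *)
Lemma sum_hole_ln x (D : R) : (forall v, 0 < x v) -> tame x ->
  (forall i, row i -> #|[set j | e i j]|%:R <= D) ->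
  \sum_v hole (wts x) v * ln (wts x v) <=
  (\sum_(i | row i) hole (wts x) i) * ln D.
Proof.
move=> hx tx hD; rewrite (bigID row) /=.
have h1 : \sum_(j | ~~ row j) hole (wts x) j * ln (wts x j) <=
          \sum_(j | ~~ row j) row_load x j * ln (x j).
  apply: ler_sum => j rj; have [x1 h] := tx j rj; rewrite [X in ln X]wts_col //.
  have [xj|xj] := ltP 1 (x j); first by rewrite ler_wpM2r ?ln_ge0 // h.
  have -> : x j = 1 by apply/eqP; rewrite eq_le xj x1.
  by rewrite ln1 !mulr0.
apply: le_trans (lerD (lexx _) h1) _.
have -> : \sum_(j | ~~ row j) row_load x j * ln (x j) =
   \sum_(i | row i) \sum_(j | e i j) ratioT (wts x) i / (s ^+ 2 * x j) * ln (x j).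
  rewrite (exchange_big_dep (fun j => ~~ row j)) /=; last first.
    by move=> i j ri eij; rewrite (e_row eij) ri.
  apply: eq_bigr => j rj; rewrite /row_load !mulr_suml; apply: eq_bigl => i.
  by rewrite row_adj.
rewrite mulr_suml -big_split /=; apply: ler_sum => i ri.
have r0 := ratioT_gt0 i (wts_gt0 hx).
have := entropy_row hx ri (hD i ri); set S := \sum_(j | e i j) (x j)^-1.
have [j0 ej0] := row_nbr ri.
have S0 : 0 < S.
  by rewrite /S (bigD1 j0) //= ltr_pwDl ?invr_gt0 // sumr_ge0 // => j _; rewrite invr_ge0 ltW.
have -> : \sum_(j | e i j) ratioT (wts x) i / (s ^+ 2 * x j) * ln (x j) =
   ratioT (wts x) i / s ^+ 2 * \sum_(j | e i j) (x j)^-1 * ln (x j).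
  by rewrite mulr_sumr; apply: eq_bigr => j _; rewrite invfM; ring.
set Y := \sum_(j | e i j) (x j)^-1 * ln (x j) => h.
have wi : wts x i = s ^- 2 * S by rewrite /wts ri.
rewrite /hole wi lnM ?posrE ?invr_gt0 //.
have ls : ln (s ^- 2) <= 0.
  by rewrite ln_le0 // invf_le1 // exprn_ege1 //; have := s_ge2; lra.
have -> : s ^- 2 * S * ratioT (wts x) i * (ln (s ^- 2) + ln S) +
   ratioT (wts x) i / s ^+ 2 * Y =
   ratioT (wts x) i / s ^+ 2 * (Y + S * ln S + S * ln (s ^- 2)) by ring.
have -> : s ^- 2 * S * ratioT (wts x) i * ln D = ratioT (wts x) i / s ^+ 2 * (S * ln D) by ring.
apply: ler_wpM2l; first by rewrite ltW // divr_gt0.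
by apply: le_trans h; rewrite gerDl mulr_ge0_le0 // ltW.
Qed.

End Load.
End Weights.

(** * Alternating walks *)

Section Augmentation.
Local Open Scope nat_scope.
Variables (V : finType) (e : rel V) (row : pred V) (n K : nat).
Hypothesis e_sym : symmetric e.
Hypothesis e_row : forall v w, e v w -> row w = ~~ row v.
Hypothesis card_rows : #|[set v | row v]| = n.
Hypothesis card_cols : #|[set v | ~~ row v]| = n.
Hypothesis n_gt1 : 1 < n.
Hypothesis K_gt0 : 0 < K.
Implicit Types (A U : {set V}) (s : {perm V}).

Definition nbrs A : {set V} := [set v | [exists u in A, e u v]].

Hypothesis expands : forall A,
  A \subset [set v | row v] \/ A \subset [set v | ~~ row v] ->
  #|A|.*2 <= n -> K.+1 * #|A| <= K * #|nbrs A|.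

Lemma nbrsP A v : reflect (exists2 u, u \in A & e u v) (v \in nbrs A).
Proof. by rewrite inE; apply: (iffP exists_inP). Qed.

Lemma nbrs_sub A (B : {set V}) : A \subset B -> nbrs A \subset nbrs B.
Proof.
move=> AB; apply/fintype.subsetP => v /nbrsP[u uA euv]; apply/nbrsP; exists u => //.
exact: (fintype.subsetP AB).
Qed.

Lemma nbrs_cols A : A \subset [set v | row v] -> nbrs A \subset [set v | ~~ row v].
Proof.
move=> AB; apply/fintype.subsetP => v /nbrsP[u /(fintype.subsetP AB) + euv].
by rewrite !inE (e_row euv) negbK.
Qed.

(* The odds [a / (n - a)] of a set of rows grow by the factor [(K + 1) / K],
   also beyond half of the rows: there the columns outside [nbrs A] expand. *)
Lemma expand_odds A : A \subset [set v | row v] ->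
  K.+1 * (#|A| * (n - #|nbrs A|)) <= K * (#|nbrs A| * (n - #|A|)).
Proof.
move=> AR; have An : #|A| <= n by rewrite -card_rows subset_leq_card.
have NC := nbrs_cols AR.
have [hA|hA] := leqP #|A|.*2 n.
  have h := expands (or_introl AR) hA.
  have aN : #|A| <= #|nbrs A|.
    by rewrite -(leq_pmul2l K_gt0); apply: leq_trans h; rewrite leq_mul2r leqnSn orbT.
  rewrite !mulnA; apply: leq_mul => //; exact: leq_sub2l.
(* A subset of n./2 rows already has more than n./2 neighbours, so the columns outside [nbrs A] are
   few enough for the expansion hypothesis. *)
have [A0 A0A cA0] : exists2 A0 : {set V}, A0 \subset A & #|A0| = n./2.
  have : n./2 <= #|A| by lia.
  by case/card_geqP => l [ul sl lA]; exists [set x in l];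
     [apply/fintype.subsetP => x; rewrite inE => /lA | rewrite cardsE -sl; apply/card_uniqP].
have hN : n./2 < #|nbrs A|.
  have hA0 : #|A0|.*2 <= n by rewrite cA0; lia.
  have := expands (or_introl (fintype.subset_trans A0A AR)) hA0; rewrite cA0 => h.
  have h2 : n./2 < #|nbrs A0| by nia.
  exact: leq_trans h2 (subset_leq_card (nbrs_sub A0A)).
set U := [set v | ~~ row v] :\: nbrs A.
have cU : #|U| = n - #|nbrs A| by rewrite cardsDS // card_cols.
have UC : U \subset [set v | ~~ row v] by exact: finset.subsetDl.
have NU : #|nbrs U| <= n - #|A|.
  rewrite -card_rows -cardsDS //; apply/subset_leq_card/fintype.subsetP => v.
  move=> /nbrsP[u uU euv]; rewrite finset.in_setD; apply/andP; split.
    apply/negP => vA; move: uU; rewrite finset.in_setD => /andP[/negP[]].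
    by apply/nbrsP; exists v => //; rewrite e_sym.
  by move: (fintype.subsetP UC _ uU); rewrite !inE (e_row euv).
have hU : #|U|.*2 <= n by rewrite cU; lia.
have := expands (or_intror UC) hU; rewrite cU => h.
have h1 : K.+1 * (n - #|nbrs A|) <= K * (n - #|A|).
  by apply: leq_trans h _; rewrite leq_mul2l NU orbT.
have aN : #|A| <= #|nbrs A|.
  have : n - #|nbrs A| <= n - #|A|.
    by rewrite -(leq_pmul2l K_gt0); apply: leq_trans h1; rewrite leq_mul2r leqnSn orbT.
  lia.
by rewrite mulnCA [X in _ <= X]mulnCA; apply: leq_mul.
Qed.

Definition row_holes s := [set i | row i && (s i == i)].

Definition near0 s := [set i | row i && [exists j, e i j && (s j == j)]].

(* Rows from which an alternating walk with at most [t] matching edges reaches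
   an unmatched column. *)
Fixpoint near t s : {set V} :=
  if t is t'.+1 then
    near t' s :|:
    [set i | row i && [exists j, [&& e i j, s j != j & s j \in near t' s]]]
  else near0 s.

Lemma near_le t u s : t <= u -> near t s \subset near u s.
Proof.
move=> /subnKC <-; elim: (u - t) => [|d IH]; first by rewrite addn0.
by rewrite addnS; apply: fintype.subset_trans IH _; exact: finset.subsetUl.
Qed.

Lemma matching_row s j : matching e [set: V]%SET s -> s j != j -> row (s j) = ~~ row j.
Proof. by move=> /matchingP[_ h] /h[ej _]; exact: e_row. Qed.

Section FixedMatching.
Variable s : {perm V}.
Hypothesis sM : matching e [set: V]%SET s.
Variable k : nat.
Hypothesis k_gt0 : 0 < k.
Hypothesis holes : #|row_holes s| = k.

Let sK v : s (s v) = v. Proof. by have /matchingP[] := sM. Qed.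

Lemma card_matched_cols : #|[set j | ~~ row j && (s j != j)]| = n - k.
Proof.
have -> : [set j | ~~ row j && (s j != j)] =
    [set s i | i in [set v | row v] :\: row_holes s].
  apply/setP => j; rewrite !inE; apply/andP/imsetP => [[rj sj]|[i]].
    exists (s j); rewrite ?sK // !inE sK (matching_row sM sj) rj /=.
    by rewrite eq_sym sj.
  rewrite !inE => /andP[+ ri ->]; rewrite ri /= => si.
  by rewrite (matching_row sM si) ri sK eq_sym.
rewrite card_imset; last exact: perm_inj.
rewrite cardsDS ?card_rows ?holes //.
by apply/fintype.subsetP => v; rewrite !inE => /andP[].
Qed.

Let far t := [set v | row v] :\: near t s.

Let far_rows t : far t \subset [set v | row v]. Proof. exact: finset.subsetDl. Qed.

Let far_nbrs0 : #|nbrs (far 0)| <= n - k.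
Proof.
rewrite -card_matched_cols; apply/subset_leq_card/fintype.subsetP => j.
move=> /nbrsP[i]; rewrite !inE => /andP[+ ri eij]; rewrite ri /= => /existsPn/(_ j).
by rewrite eij (e_row eij) ri.
Qed.

Let far_nbrsS t : #|nbrs (far t.+1)| <= #|far t|.
Proof.
rewrite -(card_imset (far t) (@perm_inj _ s)); apply/subset_leq_card.
apply/fintype.subsetP => j /nbrsP[i] + eij.
rewrite finset.in_setD /= finset.in_setU negb_or => /andP[/andP[inear]].
rewrite inE => + ri; rewrite inE in ri; rewrite ri /= => /existsPn/(_ j).
have sj : s j != j.
  apply: contraNneq inear => sj.
  apply: (fintype.subsetP (near_le s (leq0n t))).
  by rewrite inE ri; apply/existsP; exists j; rewrite eij sj eqxx.
rewrite eij sj /= => jn; apply/imsetP; exists (s j); rewrite ?sK //.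
by rewrite !inE jn (matching_row sM sj) (e_row eij) ri.
Qed.

(** The far rows at level 0 see only the n - k matched columns, and the neighbours of [far t.+1] are
    matched into [far t]. By [expand_odds] the odds of the far sets thus start below n / k and lose
    a factor K / (K + 1) at every level. *)
Let far_odds t : 0 < #|far t| ->
  K.+1 ^ t.+1 * (#|far t| * k) <= K ^ t.+1 * (n * (n - #|far t|)).
Proof.
have An u : #|far u| <= n by rewrite -card_rows subset_leq_card.
have kn : k <= n.
  rewrite -holes -card_rows; apply/subset_leq_card/fintype.subsetP => v.
  by rewrite !inE => /andP[].
elim: t => [|t IH] f0.
  have h := expand_odds (far_rows 0); rewrite !expn1.
  apply: (leq_trans (n := K.+1 * (#|far 0| * (n - #|nbrs (far 0)|)))).
    by rewrite !leq_mul2l; have := far_nbrs0; lia.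
  apply: leq_trans h _; rewrite leq_mul2l; apply/orP; right; apply: leq_mul => //.
  by have := far_nbrs0; lia.
have ft : 0 < #|far t|.
  apply: leq_trans f0 _; apply/subset_leq_card/finset.setDS/near_le; exact: leqnSn.
have {}IH := IH ft.
have bt : 0 < n - #|far t|.
  rewrite lt0n; apply/eqP => b0; move: IH; rewrite b0 !muln0 leqn0 !muln_eq0.
  by rewrite expn_eq0 /= !gtn_eqF.
have h : K.+1 * (#|far t.+1| * (n - #|far t|)) <= K * (#|far t| * (n - #|far t.+1|)).
  apply: leq_trans (leq_trans (expand_odds (far_rows t.+1)) _).
    by rewrite !leq_mul2l; have := far_nbrsS t; lia.
  by rewrite leq_mul2l; apply/orP; right; apply: leq_mul => //; exact: far_nbrsS.
have p0 : 0 < #|far t| * (n - #|far t|) by rewrite muln_gt0 ft.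
rewrite -(leq_pmul2l p0) !(expnS _ t.+1).
move: (K.+1 ^ t.+1) (K ^ t.+1) (n - #|far t|) (n - #|far t.+1|) h IH => a b x y h IH.
apply: leq_trans (leq_trans (leq_mul IH h) _); apply: eq_leq; ring.
Qed.

(** By Bernoulli's inequality (1 + 1 / K) ^ K is at least 2, so K levels halve the odds of the far
    rows. After K * m levels at most n ^ 2 / (2 ^ m k), hence at most k / 2, rows are far. *)
Lemma card_near m : 2 * n ^ 2 <= 2 ^ m * k ^ 2 ->
  k <= 2 * #|row_holes s :&: near (K * m) s|.
Proof.
move=> hm; set l := K * m.
have far_le : 2 * #|far l| <= k.
  have [->|f0] := posnP #|far l|; first by rewrite muln0.
  have h := far_odds f0.
  have bern : 2 * K ^ K <= K.+1 ^ K.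
    have h1 j : K ^ j * (K + j) <= K * K.+1 ^ j.
      elim: j => [|j IH]; first by rewrite !expn0 mul1n addn0 muln1.
      rewrite !expnS; move: (K ^ j) (K.+1 ^ j) IH => a b; nia.
    rewrite -(leq_pmul2l K_gt0); apply: leq_trans (h1 K); apply: eq_leq; ring.
  have h2 : 2 ^ m * K ^ l <= K.+1 ^ l.
    rewrite /l !expnM -expnMn; case: (m) => [|m']; first by rewrite !expn0.
    by rewrite leq_exp2r.
  have Kl : 0 < K ^ l by rewrite expn_gt0 K_gt0.
  have h3 : 2 ^ m * (#|far l| * k) <= n ^ 2.
    have hK : K.+1 ^ l.+1 * (#|far l| * k) <= K.+1 * (K ^ l * n ^ 2).
      apply: leq_trans h _; rewrite expnS -!mulnA; apply: leq_mul => //.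
      rewrite leq_mul2l; apply/orP; right; rewrite leq_mul2l leq_subr orbT //.
    move: hK; rewrite expnS -mulnA leq_pmul2l // => hK.
    rewrite -(leq_pmul2l Kl); apply: leq_trans hK; rewrite mulnA leq_mul2r.
    by rewrite [K ^ l * _]mulnC h2 orbT.
  nia.
have : k <= #|row_holes s :&: near l s| + #|far l|.
  rewrite -{1}holes -(cardsID (near l s) (row_holes s)) leq_add2l.
  apply/subset_leq_card/fintype.subsetP => v; rewrite !inE => /andP[->].
  by case/andP => ->.
lia.
Qed.

End FixedMatching.
End Augmentation.

(** * Counting matchings by their number of holes *)

Section MatchingCounts.
Local Open Scope nat_scope.
Variables (V : finType) (e : rel V) (row : pred V) (D : nat).
Hypothesis e_sym : symmetric e.
Hypothesis e_row : forall v w, e v w -> row w = ~~ row v.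
Implicit Types (A U : {set V}) (s : {perm V}) (k : nat).

Definition matchings (k : nat) :=
  [set s | matching e [set: V]%SET s & #|row_holes row s| == k].

Hypothesis degree_row : forall i, row i -> #|[set j | e i j]| <= D.

(** One step of a walk taken backwards: the hole p.2 takes its d-th neighbour j, whose former
    partner becomes the hole. Conjugation by the transposition of the two rows exchanges their
    roles. An index beyond the degree yields the default p.2, harmless because the images are only
    counted from above. *)
Definition slide (p : {perm V} * V) (d : 'I_D) : {perm V} * V :=
  let j := nth p.2 (enum [set j | e p.2 j]) d in
  ((p.1 ^ tperm p.2 (p.1 j))%g, p.1 j).

Fixpoint near_pairs (k t : nat) : {set {perm V} * V} :=
  if t is t'.+1 then
    near_pairs k t' :|: [set slide p.1 p.2 | p in finset.setX (near_pairs k t') [set: 'I_D]%SET]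
  else [set p | [&& p.1 \in matchings k, p.2 \in row_holes row p.1
                  & p.2 \in near0 e row p.1]].

Lemma card_near_pairs k t : #|near_pairs k t| <= #|near_pairs k 0| * D.+1 ^ t.
Proof.
elim: t => [|t IH]; first by rewrite expn0 muln1.
apply: leq_trans (leq_card_setU _ _) _; rewrite expnSr mulnA.
apply: leq_trans (leq_mul IH (leqnn D.+1)); rewrite mulnSr addnC leq_add2r.
by apply: leq_trans (leq_imset_card _ _) _; rewrite cardsX cardsT card_ord.
Qed.

(** Matching the hole i to an adjacent unmatched column removes one hole. The new matching and i
    determine the old one: the edge at i is removed again. *)
Lemma card_near_pairs0 k : 
  #|near_pairs k 0| <= #|matchings k.-1| * #|[set v | row v]|.
Proof.
rewrite -cardsX.
pose g (p : {perm V} * V) := ((p.1 * tperm p.2 (p.1 p.2))%g, p.2).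
apply: leq_trans (leq_imset_card g _); apply/subset_leq_card/fintype.subsetP.
move=> [s i]; rewrite !inE /= => /and3P[/andP[sM /eqP sk] /andP[ri /eqP si]].
rewrite ri /= => /existsP[j /andP[eij /eqP sj]].
have rj : ~~ row j by rewrite (e_row eij) ri.
have ij : i != j by apply: contraNneq rj => <-.
have tK : (s * tperm i j * tperm i j)%g = s by rewrite -mulgA tperm2 mulg1.
apply/imsetP; exists ((s * tperm i j)%g, i); last first.
  by rewrite /g /= permM si tpermL tK.
have h2 : (forall v, s (s v) = v) /\ (forall v, s v != v -> e v (s v) /\ v \in [set: V]%SET).
  exact/matchingP.
rewrite !inE /= ri andbT; apply/andP; split.
  rewrite -(setC1K i) matching_swap ?inE ?eqxx 1?eq_sym //.
  apply/matchingP; case: h2 => h1 h2; split=> // v sv; have [ev _] := h2 v sv.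
  split=> //; rewrite !inE; apply/andP; split.
    by apply: contraNneq sv => ->; rewrite sj.
  by apply: contraNneq sv => ->; rewrite si.
have -> : row_holes row (s * tperm i j)%g = row_holes row s :\ i.
  apply/setP => v; rewrite !inE permM.
  have [->|vi] := eqVneq v i; first by rewrite si tpermL eq_sym (negbTE ij) andbF.
  have [rv|] /= := boolP (row v) => //.
  have vj : v != j by apply: contraTneq rv => ->.
  have [->|svi] := eqVneq (s v) i.
    by rewrite tpermL !(eq_sym _ v) (negbTE vj) (negbTE vi).
  rewrite tpermD 1?eq_sym //.
  by apply: contraNneq vj => svj; rewrite -(perm_inj (etrans svj (esym sj))).
by rewrite -sk (cardsD1 i (row_holes row s)) !inE ri si eqxx.
Qed.

Section Shift.
Variables (s : {perm V}) (i j : V).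
Hypotheses (sM : matching e [set: V]%SET s) (ri : row i) (si : s i = i).
Hypotheses (eij : e i j) (sj : s j != j).

Let i1 := s j.
Let s' := (s ^ tperm i i1)%g.

Let sK v : s (s v) = v. Proof. by have /matchingP[] := sM. Qed.
Let rj : ~~ row j. Proof. by rewrite (e_row eij) ri. Qed.
Let ri1 : row i1. Proof. by rewrite (matching_row e_row sM sj). Qed.
Let ii1 : i != i1.
Proof.
apply: contraNneq sj => ii; have := sK j; rewrite -/i1 -ii si => ij.
by rewrite ij.
Qed.

Lemma shiftE v : s' v =
  if v == i then j else if v == i1 then i1 else if v == j then i else s v.
Proof.
have vE : s' v = tperm i i1 (s (tperm i i1 v)) by rewrite /s' conjgE tpermV !permM.
have ji : i != j by apply: contraNneq rj => <-.
rewrite vE; have [->|vi] := eqVneq v i; first by rewrite tpermL sK tpermD // eq_sym.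
have [->|vi1] := eqVneq v i1; first by rewrite tpermR si tpermL.
rewrite [tperm i i1 v]tpermD 1?eq_sym //.
have [->|vj] := eqVneq v j; first by rewrite tpermR.
rewrite tpermD //; first by rewrite -[i]si (inj_eq perm_inj) eq_sym.
by rewrite (inj_eq perm_inj) eq_sym.
Qed.

Lemma shift_row_holes : row_holes row s' = i1 |: (row_holes row s :\ i).
Proof.
apply/setP => v; rewrite !inE shiftE.
have [->|vi] := eqVneq v i.
  by rewrite (negbTE ii1) /=; case: eqP rj => [->|]; rewrite ?ri ?andbF.
have [->|vi1] := eqVneq v i1; first by rewrite ri1 eqxx.
by have [->|vj //] := eqVneq v j; rewrite (negbTE rj).
Qed.

Lemma shift_matchings k : s \in matchings k -> s' \in matchings k.
Proof.
rewrite !inE sM /= => /eqP hk; apply/andP; split.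
  apply/matchingP; have /matchingP[h1 h2] := sM.
  have iE : s' i = j by rewrite shiftE eqxx.
  have jE : s' j = i.
    have ji : j == i = false by apply/negbTE; apply: contraNneq rj => ->.
    have ji1 : j == i1 = false by apply/negbTE; apply: contraNneq rj => ->.
    by rewrite shiftE ji ji1 eqxx.
  have i1E : s' i1 = i1 by rewrite shiftE eq_sym (negbTE ii1) eqxx.
  split=> v.
    have [->|vi] := eqVneq v i; first by rewrite iE jE.
    have [->|vi1] := eqVneq v i1; first by rewrite !i1E.
    have [->|vj] := eqVneq v j; first by rewrite jE iE.
    rewrite [s' v]shiftE (negbTE vi) (negbTE vi1) (negbTE vj) shiftE.
    rewrite -{1}si (inj_eq perm_inj) (negbTE vi) (inj_eq perm_inj) (negbTE vj).
    by rewrite -{1}[j]sK (inj_eq perm_inj) (negbTE vi1).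
  have [->|vi] := eqVneq v i; first by rewrite iE !inE.
  have [->|vi1] := eqVneq v i1; first by rewrite i1E eqxx.
  have [->|vj] := eqVneq v j; first by rewrite jE !inE e_sym.
  by rewrite shiftE (negbTE vi) (negbTE vi1) (negbTE vj) => /h2.
rewrite shift_row_holes cardsU1 !inE (cardsD1 i) !inE ri si eqxx in hk *.
by rewrite [s i1]sK (eq_sym j) (negbTE sj) !andbF /= hk.
Qed.

(* The walk from [x] survives the shift unless it runs through [i1]. *)
Lemma near_shift t x : t = 0 \/ i1 \notin near e row t.-1 s ->
  x \in near e row t s -> x \in near e row t s'.
Proof.
elim: t x => [|t IH] x.
  move=> _; rewrite !inE => /andP[rx /existsP[j' /andP[exj' /eqP sj']]].
  rewrite rx; apply/existsP; exists j'; rewrite exj' shiftE.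
  have rj' : ~~ row j' by rewrite (e_row exj') rx.
  have -> : j' == i = false by apply/negbTE; apply: contraNneq rj' => ->.
  have -> : j' == i1 = false by apply/negbTE; apply: contraNneq rj' => ->.
  have -> : j' == j = false by apply/negbTE; apply: contraNneq sj => <-; rewrite sj'.
  by rewrite sj' eqxx.
case=> // /= i1n.
have {}IH y : y \in near e row t s -> y \in near e row t s'.
  apply: IH; case: (t) i1n => [|u] i1n; [by left|right].
  by apply: contra i1n; apply: (fintype.subsetP (near_le e row s (leqnSn u))).
rewrite !inE => /orP[/IH->//|/andP[rx /existsP[j' /and3P[exj' sj' jn]]]].
apply/orP; right; rewrite rx; apply/existsP; exists j'; rewrite exj' shiftE.
have rj' : ~~ row j' by rewrite (e_row exj') rx.
have -> : j' == i = false by apply/negbTE; apply: contraNneq rj' => ->.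
have -> : j' == i1 = false by apply/negbTE; apply: contraNneq rj' => ->.
have -> : j' == j = false by apply/negbTE; apply: contraNneq i1n => jj; rewrite /i1 -jj.
by rewrite sj' IH.
Qed.

End Shift.

(** Moving the hole along the first step of a shortest walk gives a pair one level lower, from which
    [slide] recovers the original. Shortness, that is i outside [near t], keeps the rest of the walk
    clear of the row that becomes the new hole. *)
Lemma near_pairs_near k t s i : s \in matchings k -> i \in row_holes row s ->
  i \in near e row t s -> (s, i) \in near_pairs k t.
Proof.
elim: t s i => [|t IH] s i sk hi.
  by move=> h; rewrite inE /= sk hi.
have [it|it] := boolP (i \in near e row t s).
  by move=> _; rewrite finset.in_setU IH.
have := hi; rewrite inE => /andP[ri /eqP si].
rewrite /= finset.in_setU (negbTE it) /= inE ri /= => /existsP[j /and3P[eij sj jn]].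
have sM : matching e [set: V]%SET s by move: sk; rewrite inE => /andP[].
have sK v : s (s v) = v by have /matchingP[] := sM.
set s' := (s ^ tperm i (s j))%g.
have h1 : (s', s j) \in near_pairs k t.
  apply: IH; first exact: shift_matchings.
    by rewrite shift_row_holes // !inE eqxx.
  apply: near_shift => //.
  case: (t) it => [|u] it; [by left|right].
  apply: contra it => jn'; rewrite finset.in_setU inE ri; apply/orP; right.
  by apply/existsP; exists j; rewrite eij sj.
rewrite finset.in_setU; apply/orP; right; apply/imsetP.
have rsj : row (s j) by rewrite (matching_row e_row sM sj) (e_row eij) ri.
have ejs : e (s j) j by rewrite e_sym; have /matchingP[_ /(_ _ sj)[]] := sM.
have jin : j \in enum [set j0 | e (s j) j0] by rewrite mem_enum inE.
have hd : index j (enum [set j0 | e (s j) j0]) < D.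
  by apply: leq_trans (degree_row rsj); rewrite cardE index_mem.
exists ((s', s j), Ordinal hd); first by rewrite !inE /= h1.
have s'j : s' j = i.
  have ji : j == i = false by apply/negbTE; apply: contraTneq eij => ->; apply/negP => /e_row; case: (row i).
  by rewrite /s' shiftE // ji eq_sym (negbTE sj) eqxx.
rewrite /slide /= nth_index // s'j; congr (_, _).
by rewrite /s' (tpermC i) -conjgM tperm2 conjg1.
Qed.

(** Double counting of pairs of a matching and a near hole: each matching with k holes has at least
    k / 2 of them, and there are at most n * D.+1 ^ (K * m) for each matching with k - 1 holes. *)
Lemma matchings_ratio n K k m :
  #|[set v | row v]| = n -> #|[set v | ~~ row v]| = n -> 1 < n -> 0 < K ->
  (forall A, A \subset [set v | row v] \/ A \subset [set v | ~~ row v] ->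
    #|A|.*2 <= n -> K.+1 * #|A| <= K * #|nbrs e A|) ->
  0 < k -> 2 * n ^ 2 <= 2 ^ m * k ^ 2 ->
  k * #|matchings k| <= 2 * n * D.+1 ^ (K * m) * #|matchings k.-1|.
Proof.
move=> cr cc n1 K0 hexp k0 hm; set l := K * m.
have h : \sum_(s in matchings k) #|row_holes row s :&: near e row l s| <=
         #|near_pairs k l|.
  rewrite (eq_bigr (fun s => \sum_(i in row_holes row s :&: near e row l s) 1)); last first.
    by move=> s _; rewrite sum1_card.
  rewrite pair_big_dep /= sum1_card; apply/subset_leq_card/fintype.subsetP => -[s i].
  rewrite unfold_in /= => /andP[sk]; rewrite finset.in_setI => /andP[hi ni].
  exact: near_pairs_near.
have h1 : k * #|matchings k| <= 2 * #|near_pairs k l|.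
  apply: leq_trans (leq_mul (leqnn 2) h).
  rewrite mulnC -sum_nat_const big_distrr /=; apply: leq_sum => s.
  rewrite inE => /andP[sM /eqP sk].
  exact: (card_near e_sym e_row cr cc n1 K0 hexp sM k0 sk hm).
apply: leq_trans h1 _; rewrite -!mulnA leq_mul2l /=.
apply: leq_trans (card_near_pairs k l) _; rewrite [D.+1 ^ l * _]mulnC mulnA leq_mul2r.
by rewrite mulnC -cr card_near_pairs0 orbT.
Qed.

End MatchingCounts.

(** * Entropy of a random matching *)

Section Entropy.
Variables (R : realType) (V : finType) (e : rel V) (row : pred V).
Hypothesis e_sym : symmetric e.
Implicit Types (s : {perm V}) (c : V -> R).

Local Notation T := [set: V]%SET.

Lemma hole_sum c v : (forall v, 0 < c v) ->
  \sum_(s | matching e T s && (s v == v))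
     \prod_(u in T | s u == u) c u / hole_poly e c T = hole e c v.
Proof.
move=> hc; rewrite -mulr_suml -{1 2}(setC1K v) hole_poly_fixed ?notin_setC1 //.
by rewrite /hole /ratioT /ratio setC1K mulrA.
Qed.

(* Gibbs' inequality for the measure [hole_poly] against the one that first
   chooses the number of holes of the rows geometrically and then a matching
   uniformly. *)
Lemma ln_hole_poly_le c (d a b : R) : (forall v, 0 < c v) -> 0 < d < 1 ->
  (forall k, (0 < #|matchings e row k|)%N ->
     ln (#|matchings e row k|%:R : R) <= a + b * k%:R) ->
  ln (hole_poly e c T) <= \sum_v hole e c v * ln (c v) +
    (\sum_(i | row i) hole e c i) * (b - ln d) - ln (1 - d) + a.
Proof.
move=> hc /andP[d0 d1] hM; set H := hole_poly e c T.
have H0 : 0 < H by exact: hole_poly_gt0.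
pose w s := \prod_(u in T | s u == u) c u.
have w0 s : 0 < w s by exact: prodr_gt0.
pose k s := #|row_holes row s|.
have k_in s : matching e T s -> s \in matchings e row (k s) by rewrite inE eqxx andbT.
have M0 s : matching e T s -> (0 < #|matchings e row (k s)|)%N.
  by move=> /k_in sk; apply/card_gt0P; exists s.
pose nu s := d ^+ k s * (1 - d) / #|matchings e row (k s)|%:R.
have nu0 s : matching e T s -> 0 < nu s.
  by move=> /M0 h; rewrite divr_gt0 ?ltr0n // mulr_gt0 ?exprn_gt0 // subr_gt0.
have sum_p : \sum_(s | matching e T s) w s / H = 1.
  by rewrite -mulr_suml -/H divff // gt_eqF.
have sum_nu : \sum_(s | matching e T s) nu s <= 1.
  have kV s : (k s < #|V|.+1)%N by rewrite ltnS max_card.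
  rewrite (partition_big (fun s => Ordinal (kV s)) predT) //=.
  apply: (@le_trans _ _ (\sum_(i < #|V|.+1) d ^+ i * (1 - d))).
    apply: ler_sum => i _.
    rewrite (eq_big (fun s => s \in matchings e row i)
        (fun s => d ^+ i * (1 - d) / #|matchings e row i|%:R)); first last.
    - by move=> s /andP[_ /eqP <-].
    - by move=> s; rewrite inE; congr (_ && _).
    rewrite sumr_const -[leLHS]mulr_natr.
    have [->|h] := posnP #|matchings e row i|.
      by rewrite mulr0 mulr_ge0 ?exprn_ge0 ?subr_ge0 // ltW.
    rewrite divfK; first exact: lexx.
    by rewrite pnatr_eq0 -lt0n.
  rewrite -mulr_suml mulrC -[X in X * _]opprB mulNr.
  by rewrite -subrX1 opprB gerBl exprn_ge0 // ltW.
(* From ln x <= x - 1; a total mass of [nu] below 1 only helps. *)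
have gibbs : 0 <= \sum_(s | matching e T s) w s / H * (ln (w s / H) - ln (nu s)).
  apply: (@le_trans _ _ (\sum_(s | matching e T s) (w s / H - nu s))).
    by rewrite sumrB sum_p subr_ge0.
  apply: ler_sum => s sM; have p0 : 0 < w s / H by rewrite divr_gt0.
  have q0 := nu0 s sM.
  have := ln_le_sub1 (divr_gt0 q0 p0); rewrite ln_div ?posrE // => h.
  have -> : w s / H - nu s = w s / H * (1 - nu s / (w s / H)).
    by rewrite mulrBr mulr1 mulrCA divff ?mulr1 // gt_eqF.
  by rewrite ler_wpM2l ?(ltW p0) //; lra.
have expand s : matching e T s -> ln (w s / H) - ln (nu s) <=
    \sum_(u | s u == u) ln (c u) + (k s)%:R * (b - ln d) - ln (1 - d) + a - ln H.
  move=> sM; rewrite ln_div ?posrE //.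
  rewrite /nu ln_div ?posrE ?mulr_gt0 ?exprn_gt0 ?subr_gt0 ?ltr0n ?M0 //.
  rewrite lnM ?posrE ?exprn_gt0 ?subr_gt0 // lnXn // -[ln d *+ k s]mulr_natl.
  have -> : ln (w s) = \sum_(u | s u == u) ln (c u).
    rewrite /w (eq_bigl (fun u => s u == u)); last by move=> u; rewrite inE.
    suff [] : 0 < \prod_(u | s u == u) c u /\
        ln (\prod_(u | s u == u) c u) = \sum_(u | s u == u) ln (c u) by [].
    elim/big_rec2: _ => [|u x y _ [y0 ly]]; first by rewrite ln1.
    by rewrite mulr_gt0 // lnM ?posrE // ly.
  have := hM _ (M0 s sM); set x := ln #|_|%:R; set y := \sum_(u | _) _; rewrite mulrBr. lra.
have {}expand : 0 <= \sum_(s | matching e T s) w s / H *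
    (\sum_(u | s u == u) ln (c u) + (k s)%:R * (b - ln d) - ln (1 - d) + a - ln H).
  apply: le_trans gibbs _; apply: ler_sum => s sM.
  by rewrite ler_wpM2l ?expand // divr_ge0 // ltW.
rewrite -subr_ge0; apply: le_trans expand _; rewrite le_eqVlt; apply/orP; left.
rewrite -/H; set z := - ln (1 - d) + a - ln H.
rewrite (eq_bigr (fun s => \sum_(u | s u == u) w s / H * ln (c u) +
   \sum_(u | row u && (s u == u)) w s / H * (b - ln d) + w s / H * z)); last first.
  move=> s _; rewrite -!mulr_sumr sumr_const -mulrA -mulr_natl.
  rewrite /k /row_holes cardsE /z; ring.
rewrite !big_split /= -mulr_suml sum_p mul1r.
have -> : \sum_(s | matching e T s) \sum_(u | s u == u) w s / H * ln (c u) =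
    \sum_v hole e c v * ln (c v).
  rewrite (exchange_big_dep predT) //=; apply: eq_bigr => v _.
  by rewrite -mulr_suml hole_sum.
have -> : \sum_(s | matching e T s) \sum_(u | row u && (s u == u)) w s / H * (b - ln d) =
    (\sum_(i | row i) hole e c i) * (b - ln d).
  rewrite (exchange_big_dep row) /=; last by move=> s v _ /andP[].
  rewrite mulr_suml; apply: eq_bigr => v rv.
  rewrite -mulr_suml -hole_sum //; congr (_ * _); apply: eq_bigl => s.
  by rewrite rv.
by apply/eqP; rewrite /z; ring.
Qed.

End Entropy.

(** * The permanent as the number of matchings without holes *)

Section Permanent.
Local Open Scope nat_scope.
Variables (n : nat) (G : bigraph n).

Definition is_row (v : node n) := if v is inl _ then true else false.

Lemma adj_sym : symmetric (adj G).
Proof. by case=> [i|i] [j|j]. Qed.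

Lemma adj_row v w : adj G v w -> is_row w = ~~ is_row v.
Proof. by case: v w => [i|i] [j|j]. Qed.

Lemma card_is_row : #|[set v | is_row v]| = n.
Proof.
rewrite -[RHS]card_ord -cardsT -(card_imset _ (@inl_inj 'I_n 'I_n)); apply: eq_card => v.
rewrite inE; apply/idP/imsetP => [|[i _ ->]//].
by case: v => // i _; exists i; rewrite ?inE.
Qed.

Lemma card_is_col : #|[set v | ~~ is_row v]| = n.
Proof.
rewrite -[RHS]card_ord -cardsT -(card_imset _ (@inr_inj 'I_n 'I_n)); apply: eq_card => v.
rewrite inE; apply/idP/imsetP => [|[i _ ->]//].
by case: v => // i _; exists i; rewrite ?inE.
Qed.

Definition swap_fun (s : 'S_n) (v : node n) : node n :=
  match v with inl i => inr (s i) | inr j => inl ((s^-1)%g j) end.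

Lemma swap_funK s : involutive (swap_fun s).
Proof. by case=> i /=; rewrite ?permK ?permKV. Qed.

Definition swap_perm (s : 'S_n) : {perm node n} := perm (inv_inj (swap_funK s)).

(** A matching without row holes sends each row to a column; this injection is a permutation because
    both sides have n nodes. *)
Lemma permanent_matchings : permanent G = #|matchings (adj G) is_row 0|.
Proof.
have -> : permanent G = #|[set s : 'S_n | [forall i, G i (s i)]]|.
  rewrite /permanent -sum1_card [RHS]big_mkcond /=; apply: eq_bigr => s _.
  rewrite inE; case: ifP => [/forallP h|/negbT/forallPn[i /negbTE h]].
    by rewrite big1 // => i _; rewrite h.
  by rewrite (bigD1 i) //= h.
have inj : injective swap_perm.
  move=> s t /permP h; apply/permP => i; have := h (inl i).
  by rewrite !permE => -[].
rewrite -(card_imset _ inj); apply: eq_card => t; apply/imsetP/idP.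
  move=> [s]; rewrite inE => /forallP h ->; rewrite inE; apply/andP; split.
    apply/matchingP; split=> v; first by rewrite !permE swap_funK.
    rewrite permE; case: v => [i|j] _ /=; rewrite inE; split=> //=.
    by have := h ((s^-1)%g j); rewrite permKV.
  rewrite cards_eq0; apply/eqP/setP => -[i|j]; rewrite !inE //=.
  by rewrite permE.
rewrite inE => /andP[tM]; rewrite cards_eq0 => /eqP h0.
have /matchingP[tK te] := tM.
have ti i : {j | t (inl i) = inr j}.
  case E: (t (inl i)) => [i'|j]; last by exists j.
  have := te (inl i); rewrite E; have [ii|ii] := eqVneq i' i.
    have : inl i \in row_holes is_row t by rewrite inE /= E ii.
    by rewrite h0 inE.
  have ne : (inl i' : node n) != inl i by apply: contraNneq ii => -[->].
  by move=> /(_ ne)[].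
pose f i := sval (ti i).
have fE i : t (inl i) = inr (f i) by rewrite /f; case: (ti i).
have f_inj : injective f.
  by move=> i i' ff; have := fE i; rewrite ff -fE => /perm_inj -[].
exists (perm f_inj).
  rewrite inE; apply/forallP => i; rewrite permE.
  by have := te (inl i); rewrite fE => /(_ isT)[].
apply/permP => -[i|j]; rewrite [swap_perm _ _]permE /=; first by rewrite fE permE.
have : t (inl ((perm f_inj)^-1%g j)) = inr j.
  by rewrite fE -[f _](permE f_inj) permKV.
by move=> <-; rewrite tK.
Qed.

Lemma permanent_le (R : realType) (c : node n -> R) : (forall v, 0 < c v)%R ->
  ((permanent G)%:R <= hole_poly (adj G) c [set: node n]%SET)%R.
Proof.
move=> hc; rewrite permanent_matchings /hole_poly.
rewrite (bigID (fun s : {perm node n} => #|row_holes is_row s| == 0)) /=.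
rewrite -[leLHS]addr0; apply: lerD; last first.
  by apply: sumr_ge0 => s _; apply: prodr_ge0 => v _; exact: ltW.
rewrite (eq_big (fun s => s \in matchings (adj G) is_row 0) (fun=> 1%R)).
- by rewrite sumr_const.
- by move=> s; rewrite inE.
move=> s /andP[sM /eqP s0]; apply: big_pred0 => v; rewrite inE /=.
have h0 : #|row_holes is_row s| = 0 by [].
have h : #|[set j | ~~ is_row j]| <= #|[set j | ~~ is_row j && (s j != j)]|.
  by rewrite (card_matched_cols adj_row card_is_row sM h0) subn0 card_is_col.
have hs : [set j | ~~ is_row j && (s j != j)] \subset [set j | ~~ is_row j].
  by apply/fintype.subsetP => x; rewrite !inE => /andP[].
have /setP/(_ v) : [set j | ~~ is_row j && (s j != j)] = [set j | ~~ is_row j].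
  by apply/eqP; rewrite finset.eqEcard hs h.
have := cards0_eq h0 => /setP/(_ v); rewrite !inE.
by case: (is_row v); case: (s v == v).
Qed.

End Permanent.

(** * Comparison of the hole polynomial with the permanent *)

Section MainBound.
Variables (R : realType) (n : nat) (G : bigraph n) (a L D : nat).
Hypothesis n_gt1 : (1 < n)%N.
Let K := (2 ^ a)%N.
Hypothesis expands : forall A : {set node n},
  A \subset [set v | is_row v] \/ A \subset [set v | ~~ is_row v] ->
  (#|A|.*2 <= n)%N -> (K.+1 * #|A| <= K * #|nbrs (adj G) A|)%N.
Hypothesis degree_row : forall i, is_row i -> (#|[set j | adj G i j]| <= D)%N.
Hypothesis D_lt : (D.+1 <= 2 ^ L)%N.
Hypothesis D_gt0 : (0 < D)%N.

Local Notation M := (fun k => #|matchings (adj G) (@is_row n) k|).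
Let b := (K * L)%N.

Let K_gt0 : (0 < K)%N. Proof. by rewrite expn_gt0. Qed.
Let L_gt0 : (0 < L)%N.
Proof. by case: L D_lt => // h; rewrite expn0 in h; lia. Qed.
Let b_gt0 : (0 < b)%N. Proof. by rewrite muln_gt0 K_gt0. Qed.
Let n_gt0 : (0 < n)%N. Proof. exact: ltnW. Qed.

Lemma matchings_ratio_adj k m : (0 < k)%N -> (2 * n ^ 2 <= 2 ^ m * k ^ 2)%N ->
  (k * M k <= 2 * n * D.+1 ^ (K * m) * M k.-1)%N.
Proof.
move=> k0 hm; apply: (matchings_ratio (adj_sym G) (@adj_row _ G) degree_row
  (card_is_row n) (card_is_col n) n_gt1 K_gt0 expands k0 hm).
Qed.

(** Downwards from the empty matching with its n holes: with any large m, [matchings_ratio_adj]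
    would make M k vanish if M k.-1 did. In particular a perfect matching exists. *)
Lemma matchings_gt0 k : (k <= n)%N -> (0 < M (n - k))%N.
Proof.
elim: k => [|k IH] kn.
  rewrite subn0; apply/card_gt0P; exists 1%g; rewrite inE matching1 /=.
  rewrite -[X in _ == X](card_is_row n); apply/eqP/eq_card => v.
  by rewrite !inE perm1 eqxx andbT.
have {}IH := IH (ltnW kn).
have k0 : (0 < n - k)%N by rewrite subn_gt0.
have hm : (2 * n ^ 2 <= 2 ^ (2 * n ^ 2) * (n - k) ^ 2)%N.
  apply: leq_trans (leq_pmulr _ _); first exact/ltnW/ltn_expl.
  by rewrite expn_gt0 k0.
have := matchings_ratio_adj k0 hm; rewrite -subnS => h.
rewrite lt0n; apply: contraTneq h => ->; rewrite muln0 -ltnNge muln_gt0 k0.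
exact: IH.
Qed.

Lemma permanent_gt0 : (0 < permanent G)%N.
Proof. by have := matchings_gt0 (leqnn n); rewrite subnn -permanent_matchings. Qed.

Lemma matchings_gtn k : (n < k)%N -> M k = 0%N.
Proof.
move=> nk; apply: eq_card0 => s; rewrite !inE; apply/negbTE; rewrite negb_and.
apply/orP; right; apply: contraTneq nk => <-; rewrite -leqNgt; apply: leq_trans (eq_leq (card_is_row n)).
by apply/subset_leq_card/fintype.subsetP => v; rewrite !inE => /andP[].
Qed.

(** For the least admissible m one has 2 ^ m <= (2 n / k) ^ 2. As D.+1 <= 2 ^ L, the number of walks
    is at most (2 ^ m) ^ b, and 2 b + 1 <= 3 b collects the exponents. *)
Lemma matchings_step k : (0 < k)%N -> (k <= n)%N ->
  ((M k)%:R : R) <= (4 * n%:R / k%:R) ^+ (3 * b) * (M k.-1)%:R.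
Proof.
move=> k0 kn.
have ex : exists m, (2 * n ^ 2 <= 2 ^ m * k ^ 2)%N.
  exists (2 * n ^ 2)%N; apply: leq_trans (leq_pmulr _ _); first exact/ltnW/ltn_expl.
  by rewrite expn_gt0 k0.
case: (ex_minnP ex) => m hm mmin.
have m_le : (2 ^ m * k ^ 2 <= 4 * n ^ 2)%N.
  case: m hm mmin => [|m] hm mmin.
    rewrite expn0 mul1n; apply: (@leq_trans (n ^ 2)); first by rewrite leq_exp2r.
    by rewrite leq_pmull.
  have : ~~ (2 * n ^ 2 <= 2 ^ m * k ^ 2)%N by apply/negP => /mmin; rewrite ltnn.
  rewrite -ltnNge (expnS 2 m) -mulnA.
  by move: (n ^ 2)%N (2 ^ m * k ^ 2)%N => x y; lia.
have h := matchings_ratio_adj k0 hm.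
have hD : (D.+1 ^ (K * m) <= (2 ^ m) ^ b)%N.
  rewrite -expnM (_ : m * b = L * (K * m))%N; last by rewrite /b; ring.
  rewrite [leqRHS]expnM; case: (K * m)%N => [|u]; first by rewrite !expn0.
  by rewrite leq_exp2r.
have k0R : (0 : R) < k%:R by rewrite ltr0n.
have h1 : (k%:R : R) * (M k)%:R <= 2 * n%:R * ((2 ^ m) ^ b)%:R * (M k.-1)%:R.
  rewrite -!natrM ler_nat; apply: leq_trans h _; rewrite leq_mul2r.
  by rewrite leq_mul2l hD !orbT.
set y : R := 2 * n%:R / k%:R.
have y1 : 1 <= y by rewrite ler_pdivlMr // mul1r -natrM ler_nat; lia.
have h2 : ((2 ^ m) ^ b)%:R <= (y ^+ 2) ^+ b.
  rewrite natrX lerXn2r ?nnegrE ?exprn_ge0 ?ler0n ?(le_trans ler01 y1) //.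
  rewrite /y expr_div_n ler_pdivlMr ?exprn_gt0 // exprMn.
  by rewrite -!natrX -!natrM ler_nat.
have h3 : (M k)%:R <= y * (y ^+ 2) ^+ b * (M k.-1)%:R.
  rewrite -(ler_pM2l k0R); apply: le_trans h1 _.
  have -> : k%:R * (y * (y ^+ 2) ^+ b * (M k.-1)%:R) =
      2 * n%:R * ((y ^+ 2) ^+ b) * (M k.-1)%:R.
    by rewrite /y; field; rewrite gt_eqF.
  by rewrite ler_wpM2r ?ler0n // ler_wpM2l // mulr_ge0 ?ler0n.
apply: le_trans h3 _; rewrite ler_wpM2r ?ler0n //.
rewrite -exprM -exprS; apply: (@le_trans _ _ (y ^+ (3 * b))).
  by rewrite ler_weXn2l //; move: b_gt0; lia.
rewrite lerXn2r ?nnegrE ?(le_trans ler01 y1) ?divr_ge0 ?mulr_ge0 ?ler0n //.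
by rewrite /y ler_pM2r ?invr_gt0 // ler_wpM2r ?ler0n // ler_nat.
Qed.

Lemma matchings_le k : (k <= n)%N ->
  ((M k)%:R : R) <= ((4 * n%:R) ^+ k / k`!%:R) ^+ (3 * b) * (permanent G)%:R.
Proof.
elim: k => [|k IH] kn.
  by rewrite expr0 fact0 divr1 expr1n mul1r -permanent_matchings.
apply: le_trans (matchings_step (ltn0Sn k) kn) _.
apply: le_trans (ler_wpM2l _ (IH (ltnW kn))) _.
  by rewrite exprn_ge0 // divr_ge0 // mulr_ge0.
rewrite mulrA -exprMn ler_wpM2r ?ler0n // le_eqVlt; apply/orP; left; apply/eqP.
congr (_ ^+ _); rewrite exprS factS natrM invfM; ring.
Qed.

(** Gibbs' inequality wants a bound that is linear in k. Splitting (4 n) ^ k / k! into (n d) ^ k /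
    k! and (4 / d) ^ k, and bounding the first factor by exp(n d), provides one with a free
    parameter d. *)
Lemma ln_matchings_le k (d : R) : 0 < d -> (0 < M k)%N ->
  ln ((M k)%:R : R) <= ln (permanent G)%:R + 3 * b%:R * (n%:R * d) +
    (3 * b%:R * ln (4 / d)) * k%:R.
Proof.
move=> d0 Mk.
have kn : (k <= n)%N by rewrite leqNgt; apply: contraL Mk => /matchings_gtn ->.
have p0 : (0 : R) < (permanent G)%:R by rewrite ltr0n permanent_gt0.
have n0 : (0 : R) < n%:R by rewrite ltr0n.
have q0 : 0 < (4 * n%:R) ^+ k / k`!%:R :> R by rewrite divr_gt0 ?exprn_gt0 ?mulr_gt0.
have : ln ((M k)%:R : R) <= ln (((4 * n%:R) ^+ k / k`!%:R) ^+ (3 * b) * (permanent G)%:R).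
  by rewrite ler_ln ?posrE ?ltr0n ?mulr_gt0 ?exprn_gt0 // matchings_le.
move/le_trans; apply; rewrite lnM ?posrE ?exprn_gt0 // lnXn //.
rewrite -[ln _ *+ (3 * b)]mulr_natr (natrM R 3 b).
rewrite addrC -addrA lerD2l.
have -> : 3 * b%:R * (n%:R * d) + 3 * b%:R * ln (4 / d) * k%:R =
    (n%:R * d + k%:R * ln (4 / d)) * (3 * b%:R) :> R by ring.
rewrite ler_wpM2r ?mulr_ge0 ?ler0n //.
have -> : (4 * n%:R) ^+ k / k`!%:R = ((n%:R * d) ^+ k / k`!%:R) * (4 / d) ^+ k :> R.
  rewrite [RHS]mulrAC -exprMn; congr (_ ^+ _ / _); field; exact: lt0r_neq0.
have e0 : 0 < (n%:R * d) ^+ k / k`!%:R by rewrite divr_gt0 ?exprn_gt0 ?mulr_gt0.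
have d4 : 0 < 4 / d by rewrite divr_gt0.
rewrite lnM ?posrE ?exprn_gt0 // lnXn // -[ln (4 / d) *+ k]mulr_natl lerD2r.
rewrite -[leRHS]expRK ler_ln ?posrE ?expR_gt0 //.
case: (k) => [|j]; first by rewrite expr0 fact0 divr1 -[leLHS]expR0 ler_expR mulr_ge0 // ltW.
apply: le_trans (expR_ge1Dxn j _); last by rewrite mulr_ge0 // ltW.
by rewrite lerDr.
Qed.

(** The 6 is 1 + 3 + 2: the expected row holes times their cost, at most (4 n / s) (5 b J) = n / E
    by the choice of s; the term 3 b n d = 3 n / E; and - ln (1 - d), at most 2 n / E. *)
Lemma hole_poly_close (x : node n -> R) (E J : nat) :
  let s := (20 * E * b * J)%:R : R in
  (1 < E)%N -> (E + a + L < J)%N -> (forall v, 0 < x v) ->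
  tame (adj G) (@is_row n) s x ->
  (forall i, is_row i -> exists j, adj G i j) ->
  (forall j, ~~ is_row j -> row_load (adj G) (@is_row n) s x j <=
     16 * hole (adj G) (wts (adj G) (@is_row n) s x) j) ->
  hole_poly (adj G) (wts (adj G) (@is_row n) s x) [set: node n]%SET <=
    (permanent G)%:R * expR (6 * n%:R / E%:R).
Proof.
move=> s E1 hJ hx tx hrow hload; set c := wts _ _ s x.
have E0 : (0 : R) < E%:R by rewrite ltr0n; lia.
have J0 : (0 : R) < J%:R by rewrite ltr0n; lia.
have b0 : (0 : R) < b%:R by rewrite ltr0n.
have b1 : (1 : R) <= b%:R by rewrite ler1n.
have n1 : (1 : R) <= n%:R by rewrite ler1n.
have E2 : (2 : R) <= E%:R by rewrite ler_nat.
have sE : s = 20 * E%:R * b%:R * J%:R by rewrite /s !natrM.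
have s_ge2 : 2 <= s.
  rewrite /s ler_nat; have : (0 < E * b * J)%N.
    by rewrite (muln_gt0 _ J) (muln_gt0 E b) b_gt0 andbT; apply/andP; split; lia.
  by rewrite -!mulnA; move: (E * _)%N => z; lia.
have hc : forall v, 0 < c v by apply: wts_gt0.
have p0 : (0 : R) < (permanent G)%:R by rewrite ltr0n permanent_gt0.
set Kh := \sum_(i | is_row i) hole (adj G) c i.
have Kh0 : 0 <= Kh by apply: sumr_ge0 => i _; exact/ltW/hole_gt0.
have KhE : Kh <= 4 * n%:R / s.
  apply: (sum_hole_rows_le (adj_sym G) (@adj_row _ G) s_ge2 hrow hx _ hload).
  exact: card_is_col.
(* The largest d for which 3 b n d stays within 3 n / E; its logarithm is still controlled by J. *)
pose d : R := (E%:R * b%:R)^-1.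
have d0 : 0 < d by rewrite invr_gt0 mulr_gt0.
have d_le : d <= E%:R^-1.
  by rewrite lef_pV2 ?posrE ?mulr_gt0 // ler_peMr // ltW.
have Ei : E%:R^-1 <= 2^-1 :> R by rewrite lef_pV2 ?posrE.
have d1 : d < 1 by lra.
have hole_ln : \sum_v hole (adj G) c v * ln (c v) <= Kh * ln D%:R.
  apply: (sum_hole_ln (adj_sym G) (@adj_row _ G) s_ge2 hrow hx tx) => i ri.
  by rewrite ler_nat degree_row.
have d01 : 0 < d < 1 by rewrite d0.
have := ln_hole_poly_le hc d01 (fun k => @ln_matchings_le k d d0).
rewrite -/Kh => main.
have ln_1d : - ln (1 - d) <= 2 * n%:R / E%:R.
  have h1 : 0 < 1 - d by lra.
  have := @ln_le_sub1 R (1 - d)^-1; rewrite invr_gt0 lnV ?posrE // => /(_ h1) h2.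
  apply: le_trans h2 _.
  have -> : (1 - d)^-1 - 1 = d / (1 - d) by field; rewrite gt_eqF.
  apply: (@le_trans _ _ (2 * d)).
    by rewrite ler_pdivrMr // mulrAC ler_peMl ?(ltW d0) //; lra.
  apply: (@le_trans _ _ (2 / E%:R)); first by rewrite ler_pM2l.
  by rewrite ler_pM2r ?invr_gt0 // ler_peMr.
have ln2 : ln 2 <= 1 :> R.
  by apply: le_trans (ln_le_sub1 _) _ => //; lra.
have lnd4 : ln (4 / d) <= J%:R.
  have -> : 4 / d = 2 ^+ a * (2 * 2 * E%:R * L%:R).
    rewrite /d (_ : b%:R = 2 ^+ a * L%:R :> R); last by rewrite /b (natrM R K L) natrX.
    by rewrite invrK; move: (2 ^+ a) (E%:R) (L%:R) => u v w; ring.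
  have lnE (u y z : R) : 0 < u -> 0 < y -> 0 < z ->
      ln (u * (2 * 2 * y * z)) = ln u + (ln 2 + ln 2 + ln y + ln z).
    move=> u0 y0 z0; have t0 : (0 : R) < 2 by [].
    by rewrite lnM ?posrE ?mulr_gt0 // (@lnM _ (2 * 2 * y)) ?posrE ?mulr_gt0 //
      (@lnM _ (2 * 2)) ?posrE ?mulr_gt0 // (@lnM _ 2) ?posrE.
  rewrite lnE ?exprn_gt0 ?E0 ?ltr0n // lnXn // -[ln 2 *+ a]mulr_natl.
  have hE : ln E%:R <= E%:R - 1 :> R by exact: ln_le_sub1.
  have hL : ln L%:R <= L%:R - 1 :> R by apply: ln_le_sub1; rewrite ltr0n.
  have ha : a%:R * ln 2 <= a%:R :> R by rewrite ler_piMr ?ler0n.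
  have hJR : E%:R + a%:R + L%:R <= J%:R :> R by rewrite -!natrD ler_nat ltnW.
  lra.
have lnd : - ln d <= J%:R.
  apply: le_trans lnd4; rewrite ln_div ?posrE //.
  by have : 0 <= ln 4 :> R; [rewrite ln_ge0 //; lra | lra].
have lnD : ln D%:R <= J%:R :> R.
  have DL : ln D%:R <= ln (2 ^+ L) :> R.
    by rewrite ler_ln ?posrE ?ltr0n ?exprn_gt0 // -natrX ler_nat ltnW.
  apply: le_trans DL _; rewrite lnXn // -[ln 2 *+ L]mulr_natl.
  apply: (@le_trans _ _ L%:R); first by rewrite ler_piMr ?ler0n.
  by rewrite ler_nat; apply: ltnW; apply: leq_ltn_trans hJ; exact: leq_addl.
have Xle : ln D%:R + (3 * b%:R * ln (4 / d) - ln d) <= 5 * b%:R * J%:R.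
  have h1 : 3 * b%:R * ln (4 / d) <= 3 * b%:R * J%:R.
    by rewrite ler_wpM2l ?mulr_ge0 ?(ltW b0).
  have h2 : J%:R <= b%:R * J%:R :> R by rewrite ler_peMl // ltW.
  lra.
have KX : Kh * ln D%:R + Kh * (3 * b%:R * ln (4 / d) - ln d) <= n%:R / E%:R.
  rewrite -mulrDr; apply: le_trans (ler_wpM2l Kh0 Xle) _.
  apply: (@le_trans _ _ (4 * n%:R / s * (5 * b%:R * J%:R))).
    by rewrite ler_wpM2r // !mulr_ge0 ?ler0n.
  rewrite sE le_eqVlt; apply/orP; left; apply/eqP; field.
  by rewrite !gt_eqF.
have nd : 3 * b%:R * (n%:R * d) = 3 * (n%:R / E%:R) by rewrite /d; field; rewrite !gt_eqF.
have H0 := hole_poly_gt0 (adj G) hc [set: node n]%SET.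
rewrite -[leLHS]lnK ?posrE // -[(permanent G)%:R]lnK ?posrE // -expRD ler_expR.
rewrite nd in main.
have -> : 6 * n%:R / E%:R = 6 * (n%:R / E%:R) :> R by rewrite mulrA.
have e2 : 2 * n%:R / E%:R = 2 * (n%:R / E%:R) :> R by rewrite mulrA.
rewrite e2 in ln_1d; lra.
Qed.

End MainBound.

(** * The search for column weights *)

Section Output.
Variables (R : realType) (n : nat) (G : bigraph n).
Local Notation e := (adj G).
Local Notation row := (@is_row n).
Local Notation T := [set: node n]%SET.
Local Notation H c := (hole_poly (adj G) c [set: node n]%SET).

Definition rows_from (i : nat) : {set node n} :=
  [set v : node n | if v is inl r then (i <= r)%N else true].

Lemma rows_from0 : rows_from 0 = T.
Proof. by apply/setP => -[r|j]; rewrite !inE. Qed.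

Lemma rows_fromS (i : 'I_n) : rows_from i = inl i |: rows_from i.+1.
Proof.
apply/setP => -[r|j]; rewrite !inE //=.
by rewrite leq_eqVlt eq_sym.
Qed.

Lemma rows_fromS_notin (i : 'I_n) : inl i \notin rows_from i.+1.
Proof. by rewrite inE ltnn. Qed.

Lemma rows_from_setD1 (i : 'I_n) : rows_from i :\ inl i = rows_from i.+1.
Proof.
rewrite rows_fromS finset.setU1K //; exact: rows_fromS_notin.
Qed.

Lemma hole_poly_cols (c : node n -> R) :
  hole_poly e c (rows_from n) = \prod_(j < n) c (inr j).
Proof.
have matching_id s : matching e (rows_from n) s = (s == 1%g).
  apply/idP/eqP => [sM|->]; last exact: matching1.
  apply/permP => v; rewrite perm1; apply/eqP/negPn/negP => sv.
  have /matchingP[sK se] := sM; have [ev vU] := se v sv.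
  have [_] : e (s v) (s (s v)) /\ s v \in rows_from n by apply: se; rewrite sK eq_sym.
  move: vU ev; rewrite !inE; case: v {sv} => [r|j]; first by rewrite leqNgt ltn_ord.
  by case: (s _) => // r _ _; rewrite leqNgt ltn_ord.
rewrite /hole_poly (big_pred1 1%g); last by move=> s; rewrite matching_id.
rewrite (eq_bigl (fun v => ~~ row v)); last first.
  by case=> v; rewrite !inE perm1 eqxx andbT //= leqNgt ltn_ord.
rewrite (reindex_omap inr (fun v => if v is inr j then Some j else None)) /=.
  by apply: eq_bigl => j; rewrite eqxx.
by case.
Qed.

Lemma telescope (c : node n -> R) : (forall v, 0 < c v) ->
  H c = \prod_(i < n) (ratio e c (rows_from i.+1) (inl i))^-1 *
        \prod_(j < n) c (inr j).
Proof.
move=> hc; rewrite -rows_from0 -hole_poly_cols.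
suff: forall m (mn : (m <= n)%N), hole_poly e c (rows_from 0) =
    \prod_(i < m) (ratio e c (rows_from i.+1) (inl (widen_ord mn i)))^-1 *
    hole_poly e c (rows_from m).
  move=> /(_ n (leqnn n)) ->; congr (_ * _); apply: eq_bigr => i _.
  by congr (ratio _ _ _ (inl _))^-1; apply: val_inj.
elim=> [|m IH] mn; first by rewrite big_ord0 mul1r.
rewrite (IH (ltnW mn)) big_ord_recr /= -mulrA; congr (_ * _).
  by apply: eq_bigr => i _; congr (ratio _ _ _ (inl _))^-1; apply: val_inj.
rewrite /ratio invf_div mulfVK; last by rewrite gt_eqF // hole_poly_gt0.
have -> : inl (widen_ord mn ord_max) |: rows_from m.+1 = rows_from m.
  by rewrite (rows_fromS (widen_ord mn ord_max)).
by [].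
Qed.

(* The product of the ratios telescopes over the rows; without rows, every column
   is a hole. *)
Definition estimate (c : node n -> R) t :=
  \prod_(i < n) (trunc_ratio e row c t (rows_from i.+1) (inl i))^-1 *
  \prod_(j < n) c (inr j).

Definition accurate (c : node n -> R) t (eta : R) :=
  forall (A : {set node n}) v, v \notin A ->
    (row v -> ratio e c A v <= trunc_ratio e row c t A v
              <= (1 + eta) * ratio e c A v) /\
    (~~ row v -> trunc_ratio e row c t A v <= ratio e c A v
              <= (1 + eta) * trunc_ratio e row c t A v).

Lemma estimate_close c t eta : (forall v, 0 < c v) -> 0 <= eta -> accurate c t eta ->
  estimate c t <= H c <= (1 + eta) ^+ n * estimate c t.
Proof.
move=> hc eta0 acc; rewrite telescope // /estimate.
have acci (i : 'I_n) := proj1 (acc _ _ (rows_fromS_notin i)) isT.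
have r0 (i : 'I_n) := ratio_gt0 e hc (rows_from i.+1) (inl i).
have t0 (i : 'I_n) : 0 < trunc_ratio e row c t (rows_from i.+1) (inl i).
  by have /andP[h _] := acci i; exact: lt_le_trans h.
have c0 : 0 <= \prod_(j < n) c (inr j) by apply: prodr_ge0 => j _; exact: ltW.
apply/andP; split.
  rewrite ler_wpM2r //; apply: ler_prod => i _; rewrite invr_ge0 (ltW (t0 i)) /=.
  by rewrite lef_pV2 ?posrE //; have /andP[] := acci i.
rewrite mulrA ler_wpM2r // -[X in (1 + eta) ^+ X]card_ord -prodr_const -big_split /=.
apply: ler_prod => i _; rewrite invr_ge0 (ltW (r0 i)) /=.
have /andP[_ h] := acci i.
by rewrite ler_pdivlMr // mulrC ler_pdivrMr // mulrC.
Qed.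

Section Search.
Variables (s : R) (t : nat) (eta : R).
Hypothesis s_ge2 : 2 <= s.
Hypothesis eta01 : 0 <= eta <= 1.
Hypothesis row_nbr : forall i, row i -> exists j, e i j.
Local Notation W := (wts e row s).
Local Notation Q x := (fun v => trunc_ratio e row (W x) t (~: [set v]) v).

Definition overweight (x : node n -> R) (j : node n) :=
  16 * s ^+ 2 * x j ^+ 2 * Q x j < \sum_(i | e j i) Q x i.

Let s_gt0 : 0 < s. Proof. by apply: lt_le_trans s_ge2; lra. Qed.

(** Of the 16 in [overweight], truncation takes a factor 2 at the rows and a factor 2 at the column.
    What remains is hole <= load / 4, exactly the demand of [tame_double], and it makes ln H fall by
    at least the hole probability of k. *)
Lemma overweight_step x k : (forall v, 0 < x v) -> ~~ row k ->
  accurate (W x) t eta -> tame e row s x -> overweight x k ->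
  tame e row s (double x k) /\
  H (W (double x k)) <=
    H (W x) * expR (- (1 + #|node n|%:R * s ^+ 2)^-1).
Proof.
move=> hx rk acc tx ow; have /andP[eta0 eta1] := eta01.
have hc := wts_gt0 s_ge2 row_nbr hx.
have hload : hole e (W x) k <= row_load e row s x k / 4.
  have qk : ratioT e (W x) k <= 2 * Q x k.
    have [_ /(_ rk)/andP[_ h]] := acc (~: [set k]) k (notin_setC1 k).
    apply: le_trans h _; rewrite ler_wpM2r ?trunc_ratio_ge0 //; lra.
  have qi : \sum_(i | e k i) Q x i <= 2 * \sum_(i | e k i) ratioT e (W x) i.
    rewrite mulr_sumr; apply: ler_sum => i eki.
    have ri : row i by rewrite (adj_row eki) rk.
    have [/(_ ri)/andP[_ h] _] := acc (~: [set i]) i (notin_setC1 i).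
    apply: le_trans h _; rewrite ler_wpM2r //; last lra.
    exact/ltW/ratio_gt0.
  have s2 : 0 < s ^+ 2 * x k by rewrite mulr_gt0 // exprn_gt0.
  rewrite /hole wts_col // /row_load -mulrA -invfM ler_pdivlMr; last by rewrite mulr_gt0.
  rewrite -(ler_pM2l (ltr0n R 2)) ; apply: le_trans qi.
  apply: le_trans (ltW ow).
  have -> : 2 * (x k * ratioT e (W x) k * (s ^+ 2 * x k * 4)) =
     8 * s ^+ 2 * x k ^+ 2 * ratioT e (W x) k by ring.
  have -> : 16 * s ^+ 2 * x k ^+ 2 * Q x k = 8 * s ^+ 2 * x k ^+ 2 * (2 * Q x k) by ring.
  by rewrite ler_wpM2l // !mulr_ge0 ?exprn_ge0 // ltW.
split.
  exact: (tame_double (adj_sym G) (@adj_row _ G) s_ge2 row_nbr).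
apply: le_trans (potential_decrease (adj_sym G) (@adj_row _ G) s_ge2 row_nbr hx rk) _.
rewrite ler_wpM2l ?(ltW (hole_poly_gt0 _ hc _)) // ler_expR.
have := hole_col_ge (adj_sym G) (@adj_row _ G) s_ge2 row_nbr hx rk; lra.
Qed.

(** Here the truncation errors have the helpful sign: rows are overestimated and columns
    underestimated. *)
Lemma settled_load x : (forall v, 0 < x v) -> accurate (W x) t eta ->
  (forall j, ~~ row j -> ~ overweight x j) ->
  forall j, ~~ row j -> row_load e row s x j <= 16 * hole e (W x) j.
Proof.
move=> hx acc hs j rj; have /negP := hs j rj; rewrite -leNgt => h.
have qj : Q x j <= ratioT e (W x) j.
  by have [_ /(_ rj)/andP[]] := acc (~: [set j]) j (notin_setC1 j).
have qi : \sum_(i | e j i) ratioT e (W x) i <= \sum_(i | e j i) Q x i.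
  apply: ler_sum => i eji; have ri : row i by rewrite (adj_row eji) rj.
  by have [/(_ ri)/andP[]] := acc (~: [set i]) i (notin_setC1 i).
have s2 : 0 < s ^+ 2 * x j by rewrite mulr_gt0 // exprn_gt0.
rewrite /row_load /hole wts_col // ler_pdivrMr //.
apply: le_trans qi (le_trans h _).
have -> : 16 * (x j * ratioT e (W x) j) * (s ^+ 2 * x j) =
  16 * s ^+ 2 * x j ^+ 2 * ratioT e (W x) j by ring.
by rewrite ler_wpM2l // !mulr_ge0 ?exprn_ge0 // ltW.
Qed.

(** With unit column weights every inverse row ratio is at most n + n: a row weight of at most n and
    at most n column ratios of at most 1. The crude bound 2 n <= exp(2 n) suffices. *)
Lemma hole_poly_init (x : node n -> R) : (forall v, x v = 1) -> (0 < n)%N ->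
  H (W x) <= expR (2 * n%:R ^+ 2).
Proof.
move=> x1 n0; have hx v : 0 < x v by rewrite x1.
have hc := wts_gt0 s_ge2 row_nbr hx.
rewrite telescope // [X in _ * X]big1; last by move=> j _; rewrite wts_col.
rewrite mulr1; apply: (@le_trans _ _ (\prod_(i < n) expR (2 * n%:R))); last first.
  by rewrite prodr_const card_ord -expRM_natr ler_expR expr2 mulrA.
apply: ler_prod => i _; rewrite invr_ge0 (ltW (ratio_gt0 _ hc _ _)) /=.
rewrite (ratio_rec (adj_sym G) hc (rows_fromS_notin i)).
have deg : \sum_(j | e (inl i) j) (1 : R) <= n%:R.
  rewrite sumr_const ler_nat -[leqRHS](card_is_col n).
  by apply/subset_leq_card/fintype.subsetP => -[r|j]; rewrite inE.
apply: (@le_trans _ _ (n%:R + n%:R)).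
  apply: lerD.
    rewrite /wts /=; apply: (@le_trans _ _ (\sum_(j | e (inl i) j) (x j)^-1)).
      rewrite ler_piMl ?sumr_ge0 // => [j _|]; first by rewrite x1 invr1.
      by rewrite invf_le1 ?exprn_gt0 // exprn_ege1 //; have := s_ge2; lra.
    by under eq_bigr => j _ do rewrite x1 invr1.
  apply: le_trans deg; rewrite big_mkcond [leRHS]big_mkcond; apply: ler_sum => j _.
  case: j => [r|j]; first by rewrite andbF.
  case eij: (e (inl i) (inr j)); rewrite ?andbF // andbT; case: ifP => // _.
  apply: le_trans (ratio_le_invc (adj_sym G) hc _) _; first by rewrite !inE eqxx.
  by rewrite wts_col // x1 invr1.
have -> : n%:R + n%:R = 2 * n%:R :> R by ring.
have := expR_ge1Dx (2 * n%:R : R); lra.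
Qed.

(** The program runs a fixed number of rounds; the first alternative covers those that remain after
    the search has settled. *)
Definition search_inv r (x : node n -> R) := [/\ forall v, 0 < x v, tame e row s x &
  (forall j, ~~ row j -> ~ overweight x j) \/
  H (W x) <= expR (2 * n%:R ^+ 2 - r%:R * (1 + #|node n|%:R * s ^+ 2)^-1)].

Lemma search_inv0 (x : node n -> R) : (0 < n)%N -> (forall v, x v = 1) -> search_inv 0 x.
Proof.
move=> n0 x1; split; first by move=> v; rewrite x1.
  by move=> j _; rewrite x1 ltxx.
by right; rewrite mul0r subr0; exact: hole_poly_init.
Qed.

Lemma search_inv_double r x k : search_inv r x -> accurate (W x) t eta ->
  ~~ row k -> overweight x k -> search_inv r.+1 (double x k).
Proof.
move=> [hx tx h] acc rk ow.
have [tx' hH] := overweight_step hx rk acc tx ow.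
split=> //; first exact: double_gt0.
right; case: h => [/(_ k rk)//|h]; apply: le_trans hH _.
apply: le_trans (ler_wpM2r _ h) _; first exact: expR_ge0.
by rewrite -expRD ler_expR -natr1; lra.
Qed.

Lemma search_inv_settled r r' x : (forall j, ~~ row j -> ~ overweight x j) ->
  search_inv r x -> search_inv r' x.
Proof. by move=> h [hx tx _]; split=> //; left. Qed.

(** H is at least the permanent, hence at least 1, while 8 n ^ 3 s ^ 2 exceeds 2 n ^ 2 (1 + 2 n s ^
    2), the number of doublings after which the bound on H reaches 1. *)
Lemma search_inv_end r x : (0 < n)%N -> 8 * n%:R ^+ 3 * s ^+ 2 <= r%:R ->
  (0 < permanent G)%N -> search_inv r x -> forall j, ~~ row j -> ~ overweight x j.
Proof.
move=> n0 hr per0 [hx tx [//|h]]; exfalso.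
have hc := wts_gt0 s_ge2 row_nbr hx.
have H1 : 1 <= H (W x).
  by apply: le_trans (permanent_le G hc); rewrite ler1n.
have n1 : (1 : R) <= n%:R by rewrite ler1n.
have s1 : 1 <= s ^+ 2 by rewrite exprn_ege1 //; have := s_ge2; lra.
have := le_trans H1 h; rewrite -[leLHS]expR0 ler_expR.
have -> : #|node n| = (2 * n)%N by rewrite card_sum !card_ord addnn mul2n.
rewrite natrM; set d := 1 + _.
have s20 : 0 <= s ^+ 2 := le_trans ler01 s1.
have d0 : 0 < d by rewrite ltr_pwDl // mulr_ge0 // mulr_ge0 ?ler0n.
rewrite leNgt subr_lt0 ltr_pdivlMr // => /negP; apply.
apply: lt_le_trans hr; rewrite /d.
have a1 : 1 <= n%:R * s ^+ 2 by apply: le_trans s1 _; rewrite ler_peMl.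
have n2 : 0 < n%:R ^+ 2 :> R by rewrite exprn_gt0 // ltr0n.
have := ler_wpM2l (ltW n2) a1; rewrite mulr1; set u := n%:R in n2 *; set v := s ^+ 2 => h2.
have -> : 2 * u ^+ 2 * (1 + 2 * u * v) = 2 * u ^+ 2 + 4 * (u ^+ 2 * (u * v)) by ring.
have -> : 8 * u ^+ 3 * v = 8 * (u ^+ 2 * (u * v)) by ring.
lra.
Qed.

End Search.
End Output.

(** * Choice of the scale and the depth *)

Section Depth.
Variables (R : realType) (n : nat) (G : bigraph n) (a L E J : nat).
Hypothesis n_gt1 : (1 < n)%N.
Hypothesis E_gt1 : (1 < E)%N.
Hypothesis L_gt0 : (0 < L)%N.
Hypothesis J_gt : (E + a + L < J)%N.
Hypothesis row_nbr : forall i : node n, is_row i -> exists j, adj G i j.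
Local Notation e := (adj G).
Local Notation row := (@is_row n).

(* [2 ^ a] stands for [1 / alpha], [2 ^ L] bounds the degrees and [J] the
   logarithm of [E * 2 ^ a * 2 ^ L].  The minimum in [depth] is at most the
   geometric mean, which is where the square root in the running time comes from. *)
Definition scale := (20 * E * (2 ^ a * L) * J)%N.
Definition depth := minn (20 * scale * J) (2 * n).

Lemma scale_gt0 : (0 < scale)%N.
Proof. by rewrite /scale !muln_gt0 expn_gt0 /= L_gt0; lia. Qed.

Lemma scale_ge20 : (20 <= scale)%N.
Proof.
rewrite /scale -!mulnA leq_pmulr // !muln_gt0 expn_gt0 /= L_gt0; lia.
Qed.

Lemma scale_le : (scale ^ 2 * E <= 2 ^ (9 * J))%N.
Proof.
have hE : (E <= 2 ^ E)%N by exact/ltnW/ltn_expl.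
have hL : (L <= 2 ^ L)%N by exact/ltnW/ltn_expl.
have hJ : (J <= 2 ^ J)%N by exact/ltnW/ltn_expl.
have h1 : (scale <= 2 ^ (5 + E + (a + L) + J))%N.
  rewrite /scale !expnD; apply: leq_mul => //; apply: leq_mul; first exact: leq_mul.
  by rewrite leq_mul2l hL orbT.
apply: (@leq_trans ((2 ^ (5 + E + (a + L) + J)) ^ 2 * 2 ^ E)).
  by apply: leq_mul => //; rewrite leq_exp2r.
by rewrite -expnM -expnD leq_exp2l //; move: J_gt E_gt1; lia.
Qed.

Lemma invs_pow : (1 - (scale%:R)^-1) ^+ scale <= 2^-1 :> R.
Proof.
have s0 : (0 : R) < scale%:R by rewrite ltr0n scale_gt0.
have si : (scale%:R)^-1 <= 1 :> R by rewrite invf_le1 // ler1n scale_gt0.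
apply: (@le_trans _ _ (expR (- (scale%:R)^-1) ^+ scale)).
  rewrite lerXn2r ?nnegrE ?subr_ge0 ?expR_ge0 //.
  by apply: le_trans (expR_ge1Dx _).
rewrite -expRM_natr mulNr mulVf ?gt_eqF // expRN lef_pV2 ?posrE ?expR_gt0 //.
by have := expR_ge1Dx (1 : R); lra.
Qed.

(** A block of [scale] factors 1 - 1 / s is worth at most 1 / 2, and 9 J halvings outweigh s ^ 2 E.
    Two levels per factor give the 18. *)
Lemma theta_small u : (18 * scale * J <= u)%N -> theta (scale%:R : R) u <= E%:R^-1.
Proof.
move=> hu; have s0 : (0 : R) < scale%:R by rewrite ltr0n scale_gt0.
have E0 : (0 : R) < E%:R by rewrite ltr0n; lia.
have si : 0 <= 1 - (scale%:R)^-1 :> R by rewrite subr_ge0 invf_le1 // ler1n scale_gt0.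
have hu2 : (scale * (9 * J) <= u./2)%N.
  by rewrite (_ : scale * (9 * J) = (18 * scale * J)./2)%N ?half_leq //; lia.
rewrite /theta; apply: (@le_trans _ _ (scale%:R ^+ 2 * 2^-1 ^+ (9 * J))).
  rewrite ler_wpM2l ?exprn_ge0 ?ler0n //.
  apply: (@le_trans _ _ ((1 - (scale%:R)^-1) ^+ (scale * (9 * J)))).
    by apply: ler_wiXn2l.
  rewrite exprM lerXn2r ?nnegrE ?exprn_ge0 ?invr_ge0 //.
  exact: invs_pow.
rewrite exprVn -[leRHS]mul1r ler_pdivlMr // mulrAC ler_pdivrMr ?exprn_gt0 // mul1r.
by rewrite -!natrX -natrM ler_nat scale_le.
Qed.

(** At depth 2 n the truncation is exact, since no self-avoiding walk is longer. Otherwise the depth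
    is 20 s J; columns lag one level behind rows, for which 20 instead of 18 leaves room. *)
Lemma depth_accurate (x : node n -> R) : (forall v, 0 < x v) ->
  accurate G (wts e row scale%:R x) depth E%:R^-1.
Proof.
move=> hx A v vA; set c := wts _ _ _ x.
have s_ge2 : 2 <= scale%:R :> R by rewrite ler_nat; apply: leq_trans scale_ge20.
have s0 : (0 : R) < scale%:R by rewrite ltr0n scale_gt0.
have hc : forall v, 0 < c v by apply: wts_gt0.
have E0 : (0 : R) < E%:R by rewrite ltr0n; lia.
have load i : row i -> \sum_(j | e i j) (c j)^-1 <= scale%:R ^+ 2 * c i.
  move=> ri; rewrite le_eqVlt; apply/orP; left; apply/eqP.
  rewrite /c [in RHS]/wts ri mulrA mulfV ?mul1r; last by rewrite gt_eqF // exprn_gt0.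
  by apply: eq_bigr => j eij; rewrite wts_col // (adj_row eij) ri.
have [b1 b2] := @trunc_ratio_bound R _ e row (adj_sym G) (@adj_row _ G) c hc depth A v vA.
have r0 : 0 <= ratio e c A v by exact/ltW/ratio_gt0.
have t0 : 0 <= trunc_ratio e row c depth A v by exact: trunc_ratio_ge0.
have e1 y : 0 <= y -> y <= (1 + E%:R^-1) * y :> R.
  by move=> y0; rewrite ler_peMl // lerDl invr_ge0 ltW.
have [small|large] := leqP (20 * scale * J) (2 * n)%N; last first.
  have dE : depth = (2 * n)%N by rewrite /depth (minn_idPr _) // ltnW.
  have ex : trunc_ratio e row c depth A v = ratio e c A v.
    apply: trunc_ratio_exact => //; first exact: adj_sym.
    rewrite dE.
    have := max_card (mem (v |: A)); rewrite cardsU1 vA add1n.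
    by rewrite card_sum !card_ord addnn -mul2n.
  by rewrite ex lexx e1.
have dE : depth = (20 * scale * J)%N by rewrite /depth (minn_idPl _).
have J0 : (0 < J)%N by apply: leq_ltn_trans J_gt.
have sJ : (20 <= scale * J)%N by apply: leq_trans (leq_pmulr _ J0); exact: scale_ge20.
have dec u := @trunc_ratio_decay R _ e row (adj_sym G) (@adj_row _ G) c hc _ s_ge2 load u A v vA.
split=> rv.
  rewrite b1 //=; apply: le_trans (proj1 (dec depth) rv) _.
  rewrite ler_wpM2r // lerD2l theta_small // dE -!mulnA leq_mul2r.
  by rewrite orbT.
rewrite b2 //=; have := proj2 (dec depth.-1) rv.
rewrite prednK; last by rewrite dE -mulnA muln_gt0 /= (leq_trans _ sJ).
move=> h; apply: le_trans h _; rewrite ler_wpM2r // lerD2l theta_small //.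
by rewrite dE -!mulnA; move: (scale * J)%N sJ => z; lia.
Qed.

(** Truncation only lowers the estimate, so the two errors act on opposite sides: exp(6 n / E)
    bounds it from above and (1 + 1 / E) ^ n from below. *)
Lemma estimate_approximates (eps : R) (D : nat) (x : node n -> R) :
  (forall A : {set node n},
    A \subset [set v | is_row v] \/ A \subset [set v | ~~ is_row v] ->
    (#|A|.*2 <= n)%N -> ((2 ^ a).+1 * #|A| <= 2 ^ a * #|nbrs e A|)%N) ->
  (forall i, is_row i -> (#|[set j | e i j]| <= D)%N) ->
  (D.+1 <= 2 ^ L)%N -> (0 < D)%N ->
  0 < eps -> expR (6 / E%:R) <= 1 + eps ->
  (forall v, 0 < x v) -> tame e row scale%:R x ->
  (forall j, ~~ row j -> ~ overweight G scale%:R depth x j) ->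
  approximates eps G (estimate G (wts e row scale%:R x) depth).
Proof.
move=> hexp hD DL D0 eps0 hE hx tx settled.
have s_ge2 : 2 <= scale%:R :> R by rewrite ler_nat; apply: leq_trans scale_ge20.
have E0 : (0 : R) < E%:R by rewrite ltr0n; lia.
have E1 : E%:R^-1 <= 1 :> R by rewrite invf_le1 // ler1n; lia.
have hc := wts_gt0 s_ge2 row_nbr hx.
have acc := depth_accurate hx.
have load := settled_load s_ge2 hx acc settled.
have close := hole_poly_close n_gt1 hexp hD DL D0 E_gt1 J_gt hx tx row_nbr load.
have := estimate_close hc _ acc; rewrite invr_ge0 (ltW E0) => /(_ isT)/andP[est1 est2].
have perH := permanent_le G hc.
have p0 : 0 < 1 + eps by rewrite ltr_pwDl // ltW.
rewrite /approximates; split.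
  rewrite ler_pdivrMl ?exprn_gt0 //; apply: le_trans perH (le_trans est2 _).
  rewrite ler_wpM2r //.
    rewrite /estimate mulr_ge0 // prodr_ge0 // => i _; last exact: ltW.
    by rewrite invr_ge0 trunc_ratio_ge0.
  rewrite lerXn2r ?nnegrE ?(ltW p0) ?addr_ge0 ?invr_ge0 ?(ltW E0) //.
  apply: le_trans hE; apply: le_trans (expR_ge1Dx _); rewrite lerD2l.
  by rewrite ler_peMl ?invr_ge0 ?(ltW E0) //; lra.
apply: le_trans est1 (le_trans close _); rewrite mulrC ler_wpM2r ?ler0n //.
have -> : 6 * n%:R / E%:R = (6 / E%:R) * n%:R :> R by rewrite mulrAC.
by rewrite expRM_natr lerXn2r ?nnegrE ?expR_ge0 // ltW.
Qed.

End Depth.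

(** * Programs with bounded loops *)

Section Programs.
Local Open Scope nat_scope.

(* The work memory is shared by 32 arrays; cell [i] of the array [k] has the
   address [32 i + k].  Cell 0 of an array serves as a register. *)
Definition state := nat -> nat -> nat.

Inductive hexpr :=
| HC of nat
| HA of nat & hexpr
| HAdd of hexpr & hexpr
| HSub of hexpr & hexpr
| HMul of hexpr & hexpr
| HDiv of hexpr & hexpr.

Inductive hcmd :=
| HSkip
| HSet of nat & hexpr & hexpr
| HLoad of nat & hexpr
| HSeq of hcmd & hcmd
| HIf of hexpr & hcmd & hcmd
| HFor of nat & nat & hcmd.

Fixpoint hev (st : state) (x : hexpr) : nat :=
  match x with
  | HC c => c
  | HA k x => st k (hev st x)
  | HAdd x y => hev st x + hev st y
  | HSub x y => hev st x - hev st y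
  | HMul x y => hev st x * hev st y
  | HDiv x y => hev st x %/ hev st y
  end.

Definition upd (st : state) k i v : state :=
  fun k' i' => if (k' == k) && (i' == i) then v else st k' i'.

Definition flat (st : state) : memory := fun a => st (a %% 32) (a %/ 32).

Fixpoint ce (x : hexpr) : expr :=
  match x with
  | HC c => Const c
  | HA k x => Defs.Mem (Add (Mul (Const 32) (ce x)) (Const k))
  | HAdd x y => Add (ce x) (ce y)
  | HSub x y => Defs.Sub (ce x) (ce y)
  | HMul x y => Mul (ce x) (ce y)
  | HDiv x y => Div (ce x) (ce y)
  end.

Definition reg r := HA r (HC 0).

Fixpoint cc (p : hcmd) : cmd :=
  match p with
  | HSkip => Skip
  | HSet k x y => Store (Add (Mul (Const 32) (ce x)) (Const k)) (ce y)
  | HLoad k x => Store (Const k) (Input (ce x))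
  | HSeq p q => Seq (cc p) (cc q)
  | HIf x p q => If (ce x) (cc p) (cc q)
  | HFor r l p => Seq (Store (Const r) (Const 0))
      (While (ce (HSub (reg l) (reg r)))
        (Seq (cc p) (Store (Add (Mul (Const 32) (Const 0)) (Const r))
                       (ce (HAdd (reg r) (HC 1))))))
  end.

Fixpoint eok (x : hexpr) : bool :=
  match x with
  | HC c => true
  | HA k x => (k < 32) && eok x
  | HAdd x y | HSub x y | HMul x y | HDiv x y => eok x && eok y
  end.

Fixpoint cok (p : hcmd) : bool :=
  match p with
  | HSkip => true
  | HSet k x y => [&& k < 32, eok x & eok y]
  | HLoad k x => (k < 32) && eok x
  | HSeq p q => cok p && cok q
  | HIf x p q => [&& eok x, cok p & cok q]
  | HFor r l p => [&& r < 32, l < 32, l != r & cok p]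
  end.

Fixpoint loops (p : hcmd) : nat :=
  match p with
  | HSkip | HSet _ _ _ | HLoad _ _ => 0
  | HSeq p q | HIf _ p q => maxn (loops p) (loops q)
  | HFor _ _ p => (loops p).+1
  end.

Fixpoint writes (p : hcmd) : seq nat :=
  match p with
  | HSkip => [::]
  | HSet k _ _ | HLoad k _ => [:: k]
  | HSeq p q | HIf _ p q => writes p ++ writes q
  | HFor r _ p => r :: writes p
  end.

Definition bounded b (st : state) := forall k i, st k i < 2 ^ b.

Lemma flatE st k i : k < 32 -> flat st (32 * i + k) = st k i.
Proof.
by move=> k32; rewrite /flat mulnC modnMDl divnMDl // modn_small // divn_small // addn0.
Qed.

Lemma update_flat st k i v : k < 32 ->
  update (flat st) (32 * i + k) v = flat (upd st k i v).
Proof.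
move=> k32; apply/funext => a; rewrite /update /upd /flat.
have -> : (a == 32 * i + k) = (a %% 32 == k) && (a %/ 32 == i); last by [].
apply/eqP/andP => [->|[/eqP <- /eqP <-]]; last by rewrite mulnC -divn_eq.
by rewrite mulnC modnMDl divnMDl // modn_small // divn_small // addn0 !eqxx.
Qed.

Lemma update_flat0 st k v : k < 32 -> update (flat st) k v = flat (upd st k 0 v).
Proof. by move=> k32; rewrite -update_flat // muln0. Qed.

Lemma eval_ce inp st x : eok x -> Defs.eval inp (flat st) (ce x) = hev st x.
Proof.
elim: x => //= [k x IH /andP[k32 /IH ->]|x IHx y IHy|x IHx y IHy|x IHx y IHy|x IHx y IHy].
- exact: flatE.
all: by move=> /andP[/IHx -> /IHy ->].
Qed.

Lemma bitlen_le v B : 0 < B -> v < 2 ^ B -> bitlen v <= B.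
Proof.
move=> B0 h; rewrite /bitlen.
have [->|v0] := posnP v; first by rewrite trunc_log0.
by rewrite -(ltn_exp2l (m := 2)) // (leq_ltn_trans _ h) // trunc_logP.
Qed.

Lemma ltn_bitlen v : v < 2 ^ bitlen v.
Proof. exact: trunc_log_ltn. Qed.

Lemma ltn_2expW v u w : v < 2 ^ u -> u <= w -> v < 2 ^ w.
Proof. by move=> h uw; apply: leq_trans h _; rewrite leq_exp2l. Qed.

Lemma bitlen_op f u v : f <= u + v \/ f <= u * v -> bitlen f <= bitlen u + bitlen v.
Proof.
move=> h; apply: bitlen_le; first by rewrite addn_gt0.
have := ltn_bitlen u; have := ltn_bitlen v; rewrite expnD.
have : 1 < 2 ^ bitlen u by rewrite -{1}(expn0 2) ltn_exp2l.
have : 1 < 2 ^ bitlen v by rewrite -{1}(expn0 2) ltn_exp2l.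
move: (2 ^ bitlen u) (2 ^ bitlen v) => A B; case: h => h *;
  apply: leq_ltn_trans h _; nia.
Qed.

(** The expression is fixed, so all intermediate values are longer than the stored numbers by a
    constant factor at most; K must not depend on input or state. *)
Lemma expr_cost x : exists K, forall inp b st, eok x -> 0 < b -> bounded b st ->
  bitlen (hev st x) <= K * b /\ ecost inp (flat st) (ce x) <= K * b.
Proof.
have op x1 x2 (f : nat -> nat -> nat) :
    (forall u v, f u v <= u + v \/ f u v <= u * v) ->
    (exists K, forall inp b st, eok x1 -> 0 < b -> bounded b st ->
      bitlen (hev st x1) <= K * b /\ ecost inp (flat st) (ce x1) <= K * b) ->
    (exists K, forall inp b st, eok x2 -> 0 < b -> bounded b st ->
      bitlen (hev st x2) <= K * b /\ ecost inp (flat st) (ce x2) <= K * b) ->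
    exists K, forall inp b st, eok x1 && eok x2 -> 0 < b -> bounded b st ->
      bitlen (f (hev st x1) (hev st x2)) <= K * b /\
      ecost inp (flat st) (ce x1) + ecost inp (flat st) (ce x2) +
        bitlen (Defs.eval inp (flat st) (ce x1)) + bitlen (Defs.eval inp (flat st) (ce x2)) <= K * b.
  move=> hf [K1 h1] [K2 h2]; exists (2 * (K1 + K2)).
  move=> inp b st /andP[k1 k2] b0 hb.
  have [v1 c1] := h1 inp b st k1 b0 hb; have [v2 c2] := h2 inp b st k2 b0 hb.
  have := bitlen_op (hf (hev st x1) (hev st x2)).
  rewrite !eval_ce // -mulnA mulnDl; move: (K1 * b) (K2 * b) v1 c1 v2 c2; lia.
elim: x => [c|k x [K IH]|x IHx y IHy|x IHx y IHy|x IHx y IHy|x IHx y IHy].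
- by exists (bitlen c) => inp b st _ b0 hb; rewrite leq_pmulr.
- exists (5 * (K + bitlen 32 + bitlen k + 1)) => inp b st /andP[k32 ok] b0 hb.
  have [v c] := IH inp b st ok b0 hb.
  have m1 : bitlen (32 * hev st x) <= bitlen 32 + bitlen (hev st x).
    by apply: bitlen_op; right.
  have a1 : bitlen (32 * hev st x + k) <= bitlen (32 * hev st x) + bitlen k.
    by apply: bitlen_op; left.
  have r1 : bitlen (st k (hev st x)) <= b by apply: bitlen_le.
  have k1 : bitlen k <= bitlen k * b by rewrite leq_pmulr.
  have k2 : bitlen 32 <= bitlen 32 * b by rewrite leq_pmulr.
  have -> : 5 * (K + bitlen 32 + bitlen k + 1) * b =
    5 * (K * b + bitlen 32 * b + bitlen k * b + b) by ring.
  rewrite /= flatE // eval_ce //.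
  move: (bitlen 32) (bitlen 32 * b) (bitlen k) (bitlen k * b) (K * b) (bitlen _) (bitlen _)
    (bitlen _) (bitlen _) (ecost _ _ _) m1 a1 r1 k1 k2 v c.
  lia.
- by apply: (op x y addn) => // u v; left.
- by apply: (op x y subn) => // u v; left; lia.
- by apply: (op x y muln) => // u v; right.
- by apply: (op x y divn) => // u v; left; apply: leq_trans (leq_div _ _) _; lia.
Qed.

Lemma updE st k i v k' i' :
  upd st k i v k' i' = if (k' == k) && (i' == i) then v else st k' i'.
Proof. by []. Qed.

Lemma notin_sub (s s' : seq nat) k : all (fun l => l \in s) s' -> k \notin s -> k \notin s'.
Proof. by move=> /allP h; apply: contra; exact: h. Qed.

Lemma upd_out (s : seq nat) st k i v k' i' : k \in s -> k' \notin s ->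
  upd st k i v k' i' = st k' i'.
Proof.
by move=> ks k's; rewrite /upd; have -> : k' == k = false by apply/negbTE; apply: contraNneq k's => ->.
Qed.

Section WP.
Variables (inp : nat -> nat) (b W : nat).

(* Every stored value must be below [2 ^ b] and every loop must run at most [W]
   times. *)
Fixpoint wp (p : hcmd) (Q : state -> Prop) (st : state) : Prop :=
  match p with
  | HSkip => Q st
  | HSet k x y => hev st y < 2 ^ b /\ Q (upd st k (hev st x) (hev st y))
  | HLoad k x => inp (hev st x) < 2 ^ b /\ Q (upd st k 0 (inp (hev st x)))
  | HSeq p q => wp p (wp q Q) st
  | HIf x p q => if hev st x == 0 then wp q Q st else wp p Q st
  | HFor r l p => st l 0 <= W /\ exists I : nat -> state -> Prop,
      [/\ I 0 (upd st r 0 0),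
          forall j st', j < st l 0 -> I j st' -> st' r 0 = j -> st' l 0 = st l 0 ->
            wp p (fun st'' => [/\ I j.+1 (upd st'' r 0 j.+1), st'' r 0 = j &
                                  st'' l 0 = st l 0]) st' &
          forall st', I (st l 0) st' -> st' l 0 = st l 0 -> st' r 0 = st l 0 -> Q st']
  end.

Lemma wp_skipE Q st : wp HSkip Q st = Q st. Proof. by []. Qed.

Lemma wp_setE k x y Q st : wp (HSet k x y) Q st =
  (hev st y < 2 ^ b /\ Q (upd st k (hev st x) (hev st y))).
Proof. by []. Qed.

Lemma wp_loadE k x Q st : wp (HLoad k x) Q st =
  (inp (hev st x) < 2 ^ b /\ Q (upd st k 0 (inp (hev st x)))).
Proof. by []. Qed.

Lemma wp_seqE p q Q st : wp (HSeq p q) Q st = wp p (wp q Q) st. Proof. by []. Qed.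

Lemma wp_ifE x p q Q st : wp (HIf x p q) Q st =
  if hev st x == 0 then wp q Q st else wp p Q st.
Proof. by []. Qed.

Lemma wp_mono p (Q Q' : state -> Prop) st :
  (forall st', Q st' -> Q' st') -> wp p Q st -> wp p Q' st.
Proof.
elim: p Q Q' st => [|k x y|k x|p IHp q IHq|x p IHp q IHq|r l p IHp] Q Q' st QQ' /=.
- exact: QQ'.
- by case=> ? /QQ'.
- by case=> ? /QQ'.
- by apply: IHp => st'; exact: IHq.
- by case: ifP => _; [exact: IHq | exact: IHp].
- by case=> hW [I [h0 hS hQ]]; split=> //; exists I; split=> // st' h1 h2 h3; apply: QQ'; exact: hQ.
Qed.

Lemma wp_frame p Q st : wp p Q st ->
  wp p (fun st' => Q st' /\ forall k, k \notin writes p -> st' k =1 st k) st.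
Proof.
elim: p Q st => [|k x y|k x|p IHp q IHq|x p IHp q IHq|r l p IHp] Q st /=.
- by [].
- by case=> h hQ; split=> //; split=> // k'; rewrite inE /upd => /negbTE kk i; rewrite kk.
- by case=> h hQ; split=> //; split=> // k'; rewrite inE /upd => /negbTE kk i; rewrite kk.
- move=> /IHp; apply: wp_mono => st1 [/IHq h1 f1]; apply: wp_mono h1 => st2 [hQ f2].
  split=> // k; rewrite mem_cat negb_or => /andP[k1 k2] i.
  by rewrite f2 // f1.
- by case: ifP => _ => [/IHq|/IHp]; apply: wp_mono => st1 [hQ f1]; split=> // k;
     rewrite mem_cat negb_or => /andP[k1 k2]; exact: f1.
- case=> hW [I [h0 hS hQ]]; split=> //.
  exists (fun j st' => I j st' /\ forall k, k \notin r :: writes p -> st' k =1 st k).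
  split.
  + by split=> // k; rewrite inE negb_or /upd => /andP[/negbTE kr _] i; rewrite kr.
  + move=> j st' jl [hI fI] e1 e2; apply: wp_mono (IHp _ _ (hS j st' jl hI e1 e2)).
    move=> st'' [[h1 h2 h3] f1]; split=> //; split=> // k kr i; rewrite /upd.
    by move: (kr); rewrite inE negb_or => /andP[/negbTE -> kw] /=; rewrite f1 // fI.
  + by move=> st' [hI fI] e1 e2; split=> //; exact: hQ.
Qed.

(** The rule by which all loops below are verified: with counter and bound outside [writes p], the
    frame property takes over their bookkeeping, and the invariant need not mention unchanged
    arrays. *)
Lemma wp_for r l p Q st (I : nat -> state -> Prop) :
  r \notin writes p -> l \notin writes p -> l != r -> st l 0 <= W ->
  I 0 (upd st r 0 0) ->
  (forall j st', j < st l 0 -> I j st' -> st' r 0 = j ->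
     (forall k, k \notin r :: writes p -> st' k =1 st k) ->
     wp p (fun st'' => I j.+1 (upd st'' r 0 j.+1)) st') ->
  (forall st', I (st l 0) st' ->
     (forall k, k \notin r :: writes p -> st' k =1 st k) -> Q st') ->
  wp (HFor r l p) Q st.
Proof.
move=> rp lp lr hW h0 hS hQ; split=> //.
exists (fun j st' => I j st' /\ forall k, k \notin r :: writes p -> st' k =1 st k).
split.
- by split=> // k; rewrite inE negb_or /upd => /andP[/negbTE kr _] i; rewrite kr.
- move=> j st' jl [hI fI] e1 e2; apply: wp_mono (wp_frame (hS j st' jl hI e1 fI)).
  move=> st'' [h1 f1]; split; [split=> //|by rewrite f1|by rewrite f1].
  move=> k kr i; rewrite /upd.
  by move: (kr); rewrite inE negb_or => /andP[/negbTE -> kw] /=; rewrite f1 // fI.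
- by move=> st' [hI fI] _ _; exact: hQ.
Qed.

Lemma bounded_upd st k i v : bounded b st -> v < 2 ^ b -> bounded b (upd st k i v).
Proof. by move=> hb hv k' i'; rewrite /upd; case: ifP. Qed.

End WP.

Lemma exec_set k x y : cok (HSet k x y) -> exists K, forall inp b st, 0 < b ->
  bounded b st ->
  exists t, exec inp (cc (HSet k x y)) (flat st) t (flat (upd st k (hev st x) (hev st y)))
    /\ t <= K * b + bitlen (hev st y).
Proof.
move=> /and3P[k32 ox oy]; have [K1 h1] := expr_cost (HA k x); have [K2 h2] := expr_cost y.
exists (K1 + K2 + K1) => inp b st b0 hb.
have [|_ c1] := h1 inp b st _ b0 hb; first by rewrite /= k32.
have [_ c2] := h2 inp b st oy b0 hb.
eexists; split.
  have := ExStore inp (flat st) (Add (Mul (Const 32) (ce x)) (Const k)) (ce y).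
  by rewrite /= !eval_ce // update_flat //; exact.
move: c1; rewrite /= !eval_ce // !mulnDl => c1; lia.
Qed.

(** Soundness of [wp] together with the cost: each operation on stored numbers of b bits costs O(b),
    and each level of nesting multiplies the number of steps by at most W + 1. K depends on the
    program alone. *)
Theorem exec_wp p : cok p -> exists K, forall inp b W st Q, 0 < b -> W < 2 ^ b ->
  bounded b st -> wp inp b W p Q st ->
  exists t st', [/\ exec inp (cc p) (flat st) t (flat st'), bounded b st', Q st' &
    t <= K * b * W.+1 ^ loops p].
Proof.
elim: p => [|k x y|k x|p IHp q IHq|x p IHp q IHq|r l p IHp].
- move=> _; exists 1 => inp b W st Q b0 Wb hb hQ; exists 1, st; split=> //; first exact: ExSkip.
  by rewrite expn0; lia.
- move=> ok; have [K h] := exec_set ok; exists K.+1 => inp b W st Q b0 Wb hb [hv hQ].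
  have [t [ht tK]] := h inp b st b0 hb; exists t, (upd st k (hev st x) (hev st y)).
  split=> //; first exact: bounded_upd.
  by rewrite expn0 muln1 mulSn; have := bitlen_le b0 hv; lia.
- move=> /andP[k32 ox]; have [K h] := expr_cost x.
  exists (2 * K + 2 * bitlen k + 2) => inp b W st Q b0 Wb hb [hv hQ].
  have [v c] := h inp b st ox b0 hb.
  eexists; exists (upd st k 0 (inp (hev st x))); split.
  + have := ExStore inp (flat st) (Const k) (Input (ce x)).
    rewrite /= eval_ce // update_flat0 //; exact.
  + exact: bounded_upd.
  + exact: hQ.
  + have := bitlen_le b0 hv; have : bitlen k <= bitlen k * b by rewrite leq_pmulr.
    by rewrite expn0 muln1 !mulnDl /= ?eval_ce // -!mulnA; lia.
- move=> /andP[okp okq]; have [Kp hp] := IHp okp; have [Kq hq] := IHq okq.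
  exists (Kp + Kq) => inp b W st Q b0 Wb hb /= h.
  have [t1 [st1 [e1 b1 q1 c1]]] := hp _ _ _ _ _ b0 Wb hb h.
  have [t2 [st2 [e2 b2 q2 c2]]] := hq _ _ _ _ _ b0 Wb b1 q1.
  exists (t1 + t2), st2; split=> //; first exact: ExSeq e1 e2.
  rewrite !mulnDl; apply: leq_add.
    by apply: leq_trans c1 _; rewrite leq_mul2l leq_pexp2l ?orbT // leq_maxl.
  by apply: leq_trans c2 _; rewrite leq_mul2l leq_pexp2l ?orbT // leq_maxr.
- move=> /and3P[ox okp okq]; have [Kp hp] := IHp okp; have [Kq hq] := IHq okq.
  have [K h] := expr_cost x.
  exists (K + Kp + Kq) => inp b W st Q b0 Wb hb /=.
  have [v c] := h inp b st ox b0 hb.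
  have w0 m : 0 < W.+1 ^ m by rewrite expn_gt0.
  have cK : ecost inp (flat st) (ce x) <= K * b * W.+1 ^ maxn (loops p) (loops q).
    by apply: leq_trans c _; rewrite leq_pmulr.
  case: ifP => [/eqP x0|/negbT x0] hw.
    have [t1 [st1 [e1 b1 q1 c1]]] := hq _ _ _ _ _ b0 Wb hb hw.
    eexists; exists st1; split; [by apply: ExIfFalse e1; rewrite eval_ce|by []|by []|].
    have : t1 <= Kq * b * W.+1 ^ maxn (loops p) (loops q).
      by apply: leq_trans c1 _; rewrite leq_mul2l leq_pexp2l ?orbT // leq_maxr.
    by rewrite !mulnDl; lia.
  have [t1 [st1 [e1 b1 q1 c1]]] := hp _ _ _ _ _ b0 Wb hb hw.
  eexists; exists st1; split; [by apply: ExIfTrue e1; rewrite eval_ce|by []|by []|].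
  have : t1 <= Kp * b * W.+1 ^ maxn (loops p) (loops q).
    by apply: leq_trans c1 _; rewrite leq_mul2l leq_pexp2l ?orbT // leq_maxl.
  by rewrite !mulnDl; lia.
- move=> /and4P[r32 l32 lr okp]; have [Kp hp] := IHp okp.
  have okt : eok (HSub (reg l) (reg r)) by rewrite /= l32 r32.
  have [K h] := expr_cost (HSub (reg l) (reg r)).
  have oks : cok (HSet r (HC 0) (HAdd (reg r) (HC 1))) by rewrite /= r32.
  have [Ks hs] := exec_set oks.
  exists (2 * bitlen 0 + 2 * bitlen r + 2 * K + Kp + Ks + 1).
  move=> inp b W st Q b0 Wb hb [lW [I [hI0 hIS hIQ]]].
  set P := W.+1 ^ loops p; have P0 : 0 < P by rewrite expn_gt0.
  set A := K * b + Kp * b * P + (Ks + 1) * b.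
  have loop m : forall j st', j + m = st l 0 -> I j st' -> st' r 0 = j -> st' l 0 = st l 0 ->
      bounded b st' ->
      exists t st'', [/\ exec inp (While (ce (HSub (reg l) (reg r)))
        (Seq (cc p) (Store (Add (Mul (Const 32) (Const 0)) (Const r))
                       (ce (HAdd (reg r) (HC 1)))))) (flat st') t (flat st''),
        bounded b st'', Q st'' & t <= m * A + K * b].
    elim: m => [|m IHm] j st' jm hI er el hb'.
      have [_ c] := h inp b st' okt b0 hb'.
      eexists; exists st'; split; [apply: ExWhileFalse| by [] | |].
      - by rewrite eval_ce //= el er -jm addn0 subnn.
      - by apply: hIQ => //; rewrite ?er -jm addn0.
      - by rewrite add0n.
    have jl : j < st l 0 by lia.
    have [t1 [st1 [e1 b1 [q1 qr ql] c1]]] := hp _ _ _ _ _ b0 Wb hb' (hIS j st' jl hI er el).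
    have [t2 [e2 c2]] := hs inp b st1 b0 b1.
    have v2 : hev st1 (HAdd (reg r) (HC 1)) = j.+1 by rewrite /= qr addn1.
    have jb : j.+1 < 2 ^ b by apply: leq_ltn_trans Wb; apply: leq_trans lW.
    rewrite v2 in e2 c2.
    have [|||||t3 [st3 [e3 b3 q3 c3]]] := IHm j.+1 (upd st1 r 0 j.+1).
    - by lia.
    - exact: q1.
    - by rewrite /upd !eqxx.
    - by rewrite /upd (negbTE lr).
    - exact: bounded_upd.
    have [_ c] := h inp b st' okt b0 hb'.
    eexists; exists st3; split; [|by []|by []|].
      apply: ExWhileTrue e3; last exact: ExSeq e1 e2.
      by rewrite eval_ce //= el er subn_eq0 -ltnNge.
    have := bitlen_le b0 jb; rewrite /A mulSn mulnDl mul1n => hbl.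
    move: c1; rewrite -/P => c1; lia.
  have b00 : 0 < 2 ^ b by rewrite expn_gt0.
  have [|||||t [st' [e1 b1 q1 c1]]] := loop (st l 0) 0 (upd st r 0 0).
  - by [].
  - exact: hI0.
  - by rewrite /upd !eqxx.
  - by rewrite /upd (negbTE lr).
  - exact: bounded_upd.
  exists (bitlen r + bitlen 0 + bitlen r + bitlen 0 + t), st'; split=> //.
    apply: ExSeq e1.
    have := ExStore inp (flat st) (Const r) (Const 0).
    rewrite /= update_flat0 //; exact.
  have lA : st l 0 * A <= W * A by rewrite leq_mul2r lW orbT.
  have rb : bitlen r <= bitlen r * b by rewrite leq_pmulr.
  have zb : bitlen 0 <= bitlen 0 * b by rewrite leq_pmulr.
  rewrite expnS -/P.
  set B := 2 * bitlen 0 + 2 * bitlen r + 2 * K + Kp + Ks + 1.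
  have AB : A + (K * b + (2 * bitlen r + 2 * bitlen 0) * b) <= B * b * P.
    have x1 : K * b <= K * b * P by rewrite leq_pmulr.
    have x2 : (Ks + 1) * b <= (Ks + 1) * b * P by rewrite leq_pmulr.
    have x3 : (2 * bitlen r + 2 * bitlen 0) * b <= (2 * bitlen r + 2 * bitlen 0) * b * P.
      by rewrite leq_pmulr.
    rewrite /A /B.
    have -> : (2 * bitlen 0 + 2 * bitlen r + 2 * K + Kp + Ks + 1) * b * P =
      K * b * P + Kp * b * P + (Ks + 1) * b * P +
      (K * b * P + (2 * bitlen r + 2 * bitlen 0) * b * P) by ring.
    lia.
  have : (W.+1) * (A + (K * b + (2 * bitlen r + 2 * bitlen 0) * b)) <= W.+1 * (B * b * P).
    by rewrite leq_mul2l AB.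
  rewrite [W.+1 * (B * b * P)](_ : _ = B * b * (W.+1 * P)); last by ring.
  rewrite mulSn mulnDr; move: (B * b * (W.+1 * P)) => Z.
  move: (W * (_ + _)) => Y.
  rewrite mulnDl -!mulnA; lia.
Qed.

End Programs.

Arguments wp : simpl never.
Arguments upd : simpl never.

Definition wpE := (wp_skipE, wp_setE, wp_loadE, wp_seqE).

(** * Evaluation of the truncated ratios *)

Notation "p ;; q" := (HSeq p q) (at level 61, right associativity).
Notation "r <- x" := (HSet r (HC 0) x) (at level 60, x at level 55).

Section Vertices.
Local Open Scope nat_scope.
Variable n : nat.
Hypothesis n_gt0 : 0 < n.

Definition ord_of (k : nat) : 'I_n := Ordinal (ltn_pmod k n_gt0).

Definition vtx (k : nat) : node n := if k < n then inl (ord_of k) else inr (ord_of k).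

Definition vidx (v : node n) : nat := match v with inl i => i | inr j => n + j end.

Lemma vidx_lt v : vidx v < 2 * n.
Proof. by case: v => [i|j] /=; [have := ltn_ord i | have := ltn_ord j]; lia. Qed.

Lemma vidxK v : vtx (vidx v) = v.
Proof.
case: v => [i|j]; rewrite /vtx /=.
  by rewrite ltn_ord; congr inl; apply: val_inj; rewrite /= modn_small.
rewrite ltnNge leq_addr /=; congr inr; apply: val_inj.
by rewrite /= modnDl modn_small.
Qed.

Lemma vtxK k : k < 2 * n -> vidx (vtx k) = k.
Proof.
move=> k2; rewrite /vtx; case: ltnP => kn /=; first by rewrite modn_small.
by rewrite -{1}(subnKC kn) modnDl modn_small; lia.
Qed.

Lemma vtx_inj k l : k < 2 * n -> l < 2 * n -> vtx k = vtx l -> k = l.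
Proof. by move=> hk hl h; rewrite -(vtxK hk) -(vtxK hl) h. Qed.

Lemma is_row_vtx k : is_row (vtx k) = (k < n).
Proof. by rewrite /vtx; case: ifP. Qed.

End Vertices.

(** * Truncated ratios as explicit fractions, and their bit lengths *)

Section TreeValues.
Local Open Scope nat_scope.
Variables (n : nat) (G : bigraph n).
Hypothesis n_gt0 : 0 < n.
Local Notation N := (2 * n).
Local Notation vtx := (vtx n_gt0).
Variables cn cd : nat -> nat.

(* Numerators and denominators of the truncated ratios when the vertex [k] has
   the weight [cn k / cd k]. *)
Definition add_frac (P : nat * nat) (q : nat * nat) := (P.1 * q.2 + q.1 * P.2, P.2 * q.2).

Fixpoint fold_frac (q : nat -> nat * nat) (P : pred nat) (z : nat * nat) m :=
  if m is m'.+1 then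
    let r := fold_frac q P z m' in if P m' then add_frac r (q m') else r
  else z.

Definition swap_pair (P : nat * nat) := (P.2, P.1).

Fixpoint tree_frac t (A : {set node n}) v : nat * nat :=
  if t is t'.+1 then
    swap_pair (fold_frac (fun w => tree_frac t' (A :\ vtx w) w)
      (fun w => (vtx w \in A) && adj G (vtx v) (vtx w)) (cn v, cd v) N)
  else if v < n then (cd v, cn v) else (0, 1).

Lemma eq_fold_frac q q' (P P' : pred nat) z m : (forall w, w < m -> P w = P' w) ->
  (forall w, w < m -> P w -> q w = q' w) ->
  fold_frac q P z m = fold_frac q' P' z m.
Proof.
clear n_gt0; elim: m => //= m IH hP hq; rewrite IH; first last.
- by move=> w wm; apply: hq; lia.
- by move=> w wm; apply: hP; lia.
rewrite -hP //; case: ifP => // Pm; rewrite hq //.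
Qed.

Lemma fold_frac_lt q (P : pred nat) z m c B : z.1 < 2 ^ c -> z.2 < 2 ^ c ->
  (forall w, w < m -> P w -> (q w).1 < 2 ^ B /\ (q w).2 < 2 ^ B) ->
  let r := fold_frac q P z m in
  r.1 < 2 ^ (c + m * B.+1) /\ r.2 < 2 ^ (c + m * B.+1).
Proof.
clear n_gt0; move=> z1 z2; elim: m => [|m IH] h /=; first by rewrite mul0n addn0.
have [|r1 r2] := IH _; first by move=> w wm; apply: h; lia.
have le : c + m * B.+1 <= c + m.+1 * B.+1 by lia.
case: ifP => Pm; last by split; [exact: ltn_2expW r1 le|exact: ltn_2expW r2 le].
have [q1 q2] := h m (ltnSn m) Pm.
have -> : c + m.+1 * B.+1 = (c + m * B.+1) + B + 1 by lia.
move: (c + m * B.+1) r1 r2 => u r1 r2.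
rewrite !expnD expn1; move: (2 ^ u) (2 ^ B) r1 r2 q1 q2 => X Y r1 r2 q1 q2 /=; split.
  by have := ltn_mul r1 q2; have := ltn_mul q1 r2; lia.
by have := ltn_mul r2 q2; lia.
Qed.

(** Fractions are never reduced: adding N of them with entries of B bits takes c0 + N (B + 1) bits,
    so with N <= c0 each level multiplies the length by at most N + 2. *)
Definition bits c0 t := c0 * (N.+2) ^ t.

Lemma bits_step c0 t : N <= c0 -> c0 + N * (bits c0 t).+1 <= bits c0 t.+1.
Proof.
clear n_gt0; move=> h; rewrite /bits expnS; have : 0 < N.+2 ^ t by rewrite expn_gt0.
move: (N.+2 ^ t) => y y0; have : c0 <= c0 * y by rewrite leq_pmulr.
have -> : c0 * (N.+2 * y) = N * (c0 * y) + 2 * (c0 * y) by ring.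
move: (c0 * y) => z hz; rewrite mulnS; move: (N * z); lia.
Qed.

Lemma bits_mono c0 t u : t <= u -> bits c0 t <= bits c0 u.
Proof. by move=> tu; rewrite leq_mul2l leq_pexp2l ?orbT. Qed.

Lemma tree_frac_lt c0 t A v : N <= c0 -> 0 < c0 ->
  (forall k, k < N -> cn k < 2 ^ c0 /\ cd k < 2 ^ c0) -> v < N ->
  (tree_frac t A v).1 < 2 ^ bits c0 t /\ (tree_frac t A v).2 < 2 ^ bits c0 t.
Proof.
move=> Nc c00 hc; elim: t A v => [|t IH] A v vN /=.
  rewrite /bits expn0 muln1; have [h1 h2] := hc v vN.
  case: ifP => // _; split; first by rewrite expn_gt0.
  by rewrite -{1}(expn0 2) ltn_exp2l.
have [h1 h2] := hc v vN.
have [|r1 r2] := @fold_frac_lt (fun w => tree_frac t (A :\ vtx w) w)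
  (fun w => (vtx w \in A) && adj G (vtx v) (vtx w)) (cn v, cd v) N c0 (bits c0 t) h1 h2.
  by move=> w wN _; exact: IH.
by split; [exact: ltn_2expW r2 (bits_step t Nc)|exact: ltn_2expW r1 (bits_step t Nc)].
Qed.

Section Value.
Variable R : realType.
Local Open Scope ring_scope.
Hypothesis c_pos : forall k, (k < N)%N -> (0 < cn k)%N && (0 < cd k)%N.

Definition frac (P : nat * nat) : R := P.1%:R / P.2%:R.

Lemma fold_fracE q (P : pred nat) z m : (0 < z.2)%N -> (forall w, (w < m)%N -> P w -> (0 < (q w).2)%N) ->
  (0 < (fold_frac q P z m).2)%N /\
  frac (fold_frac q P z m) = frac z + \sum_(w < m | P w) frac (q w).
Proof.
move=> z2; elim: m => [|m IH] h /=; first by rewrite big_ord0 addr0.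
have [|r2 rE] := IH _; first by move=> w wm; apply: h; exact: ltnW.
rewrite big_mkcond big_ord_recr /= -big_mkcond /=.
case: ifP => Pm; last by rewrite addr0.
have q2 := h m (ltnSn m) Pm; split; first by rewrite muln_gt0 r2.
rewrite addrA -rE /frac /= natrD !natrM; field.
by rewrite !pnatr_eq0 -!lt0n r2 q2.
Qed.

Definition weight_of (v : node n) : R := (cn (vidx v))%:R / (cd (vidx v))%:R.

Lemma weight_of_gt0 v : 0 < weight_of v.
Proof.
by have /andP[h1 h2] := c_pos (vidx_lt n_gt0 v); rewrite divr_gt0 ?ltr0n.
Qed.

Lemma sum_vtx (P : pred (node n)) (F : node n -> R) :
  \sum_(v | P v) F v = \sum_(w < N | P (vtx w)) F (vtx w).
Proof.
rewrite (reindex (fun w : 'I_N => vtx w)) //=.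
exists (fun v => Ordinal (vidx_lt n_gt0 v)) => [w _|v _]; last by rewrite vidxK.
by apply: val_inj; rewrite /= vtxK.
Qed.

Lemma tree_fracE t A v : (v < N)%N ->
  (0 < (tree_frac t A v).2)%N /\
  frac (tree_frac t A v) = trunc_ratio (adj G) (@is_row n) weight_of t A (vtx v).
Proof.
elim: t A v => [|t IH] A v vN /=.
  rewrite is_row_vtx; have /andP[h1 h2] := c_pos vN.
  by case: ifP => _; rewrite /frac /= ?mul0r // /weight_of vtxK // invf_div.
have /andP[h1 h2] := c_pos vN.
have [//||r2 rE] := @fold_fracE (fun w => tree_frac t (A :\ vtx w) w)
  (fun w => (vtx w \in A) && adj G (vtx v) (vtx w)) (cn v, cd v) N.
  by move=> w wN _; have [] := IH (A :\ vtx w) w wN.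
set r := fold_frac _ _ _ _ in r2 rE *.
have rE' : frac r = weight_of (vtx v) + \sum_(w in A | adj G (vtx v) w)
    trunc_ratio (adj G) (@is_row n) weight_of t (A :\ w) w.
  rewrite rE /weight_of vtxK // sum_vtx; congr (_ + _); apply: eq_bigr => w _.
  by have [] := IH (A :\ vtx w) w (ltn_ord w).
have r0 : 0 < frac r.
  rewrite rE' ltr_pwDl ?weight_of_gt0 // sumr_ge0 // => w _.
  by rewrite trunc_ratio_ge0 // => u; exact: weight_of_gt0.
split; last by rewrite -rE' /frac /= invf_div.
by move: r0; rewrite /frac /swap_pair /=; case: (r.1) => //; rewrite mul0r ltxx.
Qed.

End Value.
End TreeValues.

(** * Bottom-up evaluation over words of vertices *)

Section TreeProgram.
Local Open Scope nat_scope.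

Definition hmod x y := HSub x (HMul (HDiv x y) y).

Definition hneq x y := HAdd (HSub x y) (HSub y x).

Lemma hev_mod st x y : hev st (hmod x y) = hev st x %% hev st y.
Proof. by rewrite /= {1}(divn_eq (hev st x) (hev st y)) addnC addnK. Qed.

Lemma hev_neq st x y : (hev st (hneq x y) == 0) = (hev st x == hev st y).
Proof. by rewrite /= addn_eq0 !subn_eq0 eqn_leq. Qed.

(* Register 2 holds n, 3 holds N = 2 n, 10 and 11 the depth T and T + 1.  Array 4
   is the adjacency matrix, 5 and 6 hold the weights as fractions, 7 and 8 the
   values of the cells, and 9 the set of nodes that have not been deleted.
   The cells of level [L] are indexed by the words of [L] vertices, in base
   [N]; register 12 holds the word and register 16 its length.  Register 18
   is cleared when the vertex in register 14 occurs in the word. *)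
Definition test_word := 18 <- HC 1 ;; 21 <- reg 12 ;;
  HFor 15 16 (HIf (hneq (hmod (reg 21) (reg 3)) (reg 14)) HSkip (18 <- HC 0) ;;
              21 <- HDiv (reg 21) (reg 3)).

Definition child := HAdd (HMul (reg 12) (reg 3)) (reg 14).

Definition add_child :=
  19 <- HAdd (HMul (reg 19) (HA 8 child)) (HMul (HA 7 child) (reg 20)) ;;
  20 <- HMul (reg 20) (HA 8 child).

Definition cell_prog :=
  22 <- hmod (reg 12) (reg 3) ;; 19 <- HA 5 (reg 22) ;; 20 <- HA 6 (reg 22) ;;
  HFor 14 3 (test_word ;;
    HIf (HMul (HMul (reg 18) (HA 9 (reg 14)))
              (HA 4 (HAdd (HMul (reg 22) (reg 3)) (reg 14)))) add_child HSkip) ;;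
  HSet 7 (reg 12) (reg 20) ;; HSet 8 (reg 12) (reg 19).

Definition leaf_prog := 13 <- HC 1 ;; HFor 15 11 (13 <- HMul (reg 13) (reg 3)) ;;
  HFor 12 13 (22 <- hmod (reg 12) (reg 3) ;;
    HIf (HSub (reg 2) (reg 22))
      (HSet 7 (reg 12) (HA 6 (reg 22)) ;; HSet 8 (reg 12) (HA 5 (reg 22)))
      (HSet 7 (reg 12) (HC 0) ;; HSet 8 (reg 12) (HC 1))).

Definition tree_prog := leaf_prog ;;
  HFor 17 10 (13 <- HDiv (reg 13) (reg 3) ;; 16 <- HSub (reg 10) (reg 17) ;;
              HFor 12 13 cell_prog).

Variables (n : nat) (G : bigraph n).
Hypothesis n_gt0 : 0 < n.
Local Notation N := (2 * n).
Local Notation vtx := (vtx n_gt0).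
Variables (inp : nat -> nat) (b W c0 T : nat) (cn cd : nat -> nat) (A0 : {set node n}).
Hypothesis W_lt : W < 2 ^ b.
Hypothesis words_W : N ^ T.+1 <= W.
Hypothesis T_W : T < W.
Hypothesis c0_ge : N <= c0.
Hypothesis bits_b : bits n c0 T.+1 <= b.
Hypothesis c_lt : forall k, k < N -> cn k < 2 ^ c0 /\ cd k < 2 ^ c0.

Let N_gt0 : 0 < N. Proof. by rewrite muln_gt0. Qed.
Let N_W : N <= W.
Proof. by apply: leq_trans words_W; rewrite expnS leq_pmulr // expn_gt0 N_gt0. Qed.
Let c0_gt0 : 0 < c0. Proof. exact: leq_trans c0_ge. Qed.
Let b_gt1 : 1 < 2 ^ b.
Proof. by apply: leq_ltn_trans W_lt; apply: leq_trans N_W. Qed.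
Let lt_b t v : v < 2 ^ bits n c0 t -> t <= T.+1 -> v < 2 ^ b.
Proof.
by move=> h tT; apply: ltn_2expW h _; apply: leq_trans bits_b; exact: bits_mono.
Qed.
Let c_b k : k < N -> cn k < 2 ^ b /\ cd k < 2 ^ b.
Proof.
by move=> /c_lt[h1 h2]; split; apply: (@lt_b 0); rewrite ?/bits ?expn0 ?muln1.
Qed.

(** A word spells a walk from its root; the last letter x %% N is the current vertex, and all
    letters are deleted. Words that are no self-avoiding walks have cells too, but their values do
    not enter those of the walks. *)
Fixpoint word_set L x : {set node n} :=
  if L is L'.+1 then word_set L' (x %/ N) :\ vtx (x %% N) else A0.

Definition graph_env (st : state) := [/\ st 2 0 = n, st 3 0 = N &
  forall u w, u < N -> w < N -> st 4 (u * N + w) = adj G (vtx u) (vtx w)].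

Definition tree_env (st : state) := [/\ graph_env st, st 10 0 = T, st 11 0 = T.+1,
  forall u, u < N -> st 5 u = cn u /\ st 6 u = cd u &
  forall u, u < N -> st 9 u = (vtx u \in A0)].

Lemma graph_env_frame st st' : (forall k, k \in [:: 2; 3; 4] -> st' k =1 st k) ->
  graph_env st -> graph_env st'.
Proof.
move=> fr [h2 h3 h4]; split; rewrite ?fr // => u w uN wN.
by rewrite fr // h4.
Qed.

Lemma tree_env_frame st st' :
  (forall k, k \in [:: 2; 3; 4; 5; 6; 9; 10; 11] -> st' k =1 st k) ->
  tree_env st -> tree_env st'.
Proof.
move=> fr [h1 h2 h3 h4 h5]; split; rewrite ?fr //.
- by apply: graph_env_frame h1 => k kk; apply: fr; move: kk; rewrite !inE => /or3P[] ->;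
    rewrite ?orbT.
- by move=> u uN; rewrite !fr //; exact: h4.
- by move=> u uN; rewrite fr //; exact: h5.
Qed.

Lemma wp_test_word L x w Q st : st 3 0 = N -> st 12 0 = x -> st 14 0 = w -> w < N ->
  st 16 0 = L -> L <= W -> x <= W ->
  (forall st', (forall k, k \notin writes test_word -> st' k =1 st k) ->
     (st' 18 0 != 0) && (vtx w \in A0) = (vtx w \in word_set L x) -> Q st') ->
  wp inp b W test_word Q st.
Proof.
move=> e3 e12 e14 wN e16 LW xW hQ; rewrite /test_word !wpE /=; split=> //; split.
  by rewrite ?updE /= e12; exact: leq_ltn_trans W_lt.
apply: (@wp_for _ _ _ _ _ _ _ _ (fun j st' =>
  st' 21 0 <= x /\
  (st' 18 0 != 0) && (vtx w \in word_set (L - j) (st' 21 0)) = (vtx w \in word_set L x))) => //.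
- by rewrite ?updE /= e16.
- by rewrite ?updE /= e12 subn0.
- move=> j st' jl [yx hI] ej fr; rewrite ?updE /= e16 in jl.
  have f3 : st' 3 0 = N by rewrite fr.
  have f14 : st' 14 0 = w by rewrite fr.
  have Lj : L - j = (L - j.+1).+1 by lia.
  move: hI; rewrite Lj /= finset.in_setD1.
  have y1 : st' 21 0 %/ N <= x by apply: leq_trans (leq_div _ _) yx.
  have y2 : st' 21 0 %/ N < 2 ^ b by apply: leq_ltn_trans W_lt; exact: leq_trans xW.
  have vE : (vtx w == vtx (st' 21 0 %% N)) = (st' 21 0 %% N == w).
    apply/eqP/eqP => [/(vtx_inj wN)|<-//]; rewrite ltn_mod => /(_ N_gt0) //.
  rewrite vE wp_seqE wp_ifE hev_neq hev_mod /= f3 f14.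
  case: (eqVneq (st' 21 0 %% N) w) => yw hI; rewrite !wpE /= ?updE /= ?f3.
    by do ?split=> //; [rewrite expn_gt0 | rewrite -hI andbF].
  by do ?split=> //.
- move=> st' [_ hI] fr; rewrite ?updE /= e16 subnn in hI; apply: hQ => // k kk i.
  by rewrite fr; [rewrite !(upd_out _ _ _ _ _ kk) | apply: notin_sub kk].
Qed.

Local Notation tfrac := (tree_frac G n_gt0 cn cd).

Let step t L x := fold_frac (fun w => tfrac t (word_set L x :\ vtx w) w)
  (fun w => (vtx w \in word_set L x) && adj G (vtx (x %% N)) (vtx w))
  (cn (x %% N), cd (x %% N)).

Let step_b t L x m : t <= T -> m <= N ->
  (step t L x m).1 < 2 ^ b /\ (step t L x m).2 < 2 ^ b.
Proof.
move=> tT mN; have [h1 h2] := c_lt (ltn_pmod x N_gt0).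
have [|r1 r2] := @fold_frac_lt (fun w => tfrac t (word_set L x :\ vtx w) w)
  (fun w => (vtx w \in word_set L x) && adj G (vtx (x %% N)) (vtx w))
  (cn (x %% N), cd (x %% N)) m c0 (bits n c0 t) h1 h2.
  by move=> w wm _; apply: tree_frac_lt => //; exact: leq_trans mN.
have le : c0 + m * (bits n c0 t).+1 <= bits n c0 t.+1.
  by apply: leq_trans (bits_step t c0_ge); rewrite leq_add2l leq_mul2r mN orbT.
by split; apply: (@lt_b t.+1) => //; [exact: ltn_2expW r1 le|exact: ltn_2expW r2 le].
Qed.

Let words_le L : L <= T.+1 -> N ^ L <= W.
Proof. by move=> h; apply: leq_trans words_W; rewrite leq_pexp2l. Qed.

Lemma word_setS L x w : w < N -> word_set L.+1 (x * N + w) = word_set L x :\ vtx w.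
Proof. by move=> wN /=; rewrite divnMDl // divn_small // addn0 modnMDl modn_small. Qed.

Lemma wp_cell t L x Q st : tree_env st -> st 12 0 = x -> st 16 0 = L ->
  t <= T -> L <= T -> x < N ^ L ->
  (forall w, w < N ->
     (st 7 (x * N + w), st 8 (x * N + w)) = tfrac t (word_set L.+1 (x * N + w)) w) ->
  (forall st', (forall k, k \notin writes cell_prog -> st' k =1 st k) ->
     (forall y, y != x -> st' 7 y = st 7 y /\ st' 8 y = st 8 y) ->
     (st' 7 x, st' 8 x) = tfrac t.+1 (word_set L x) (x %% N) -> Q st') ->
  wp inp b W cell_prog Q st.
Proof.
move=> env e12 e16 tT LT xL hch hQ; rewrite /cell_prog !wpE hev_mod.
have [[e2 e3 e4] e10 e11 e56 e9] := env.
have vN : x %% N < N by rewrite ltn_mod.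
have xW : x <= W by apply: ltnW; apply: leq_trans xL (words_le _); apply: leqW.
have [cnb cdb] := c_b vN; have [c1 c2] := e56 _ vN.
rewrite /= e12 e3 ?updE /= ?e12 ?e3 c1 c2; split; first by apply: leq_ltn_trans W_lt; exact: leq_trans (ltnW vN) N_W.
split=> //; split=> //.
apply: (@wp_for _ _ _ _ _ _ _ _ (fun j st' => (st' 19 0, st' 20 0) = step t L x j)) => //.
- by rewrite ?updE /= e3.
- move=> j st' jl hI ej fr; rewrite ?updE /= e3 in jl.
  have f k : k \notin 14 :: writes (test_word ;; HIf (HMul (HMul (reg 18) (HA 9 (reg 14)))
              (HA 4 (HAdd (HMul (reg 22) (reg 3)) (reg 14)))) add_child HSkip) ++ [:: 22] ->
      st' k =1 st k.
    by move=> kk i; rewrite fr; [rewrite !(upd_out _ _ _ _ _ kk) | apply: notin_sub kk].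
  have f22 : st' 22 0 = x %% N by rewrite fr.
  rewrite wp_seqE; apply: (@wp_test_word L x j) => //; rewrite ?f //.
    by apply: ltnW; exact: leq_ltn_trans T_W.
  move=> st2 f2 h2.
  have g12 : st2 12 0 = x by rewrite f2 // f.
  have g3 : st2 3 0 = N by rewrite f2 // f.
  have g14 : st2 14 0 = j by rewrite f2.
  have g22 : st2 22 0 = x %% N by rewrite f2.
  have g9 : st2 9 j = (vtx j \in A0) by rewrite f2 // f // e9.
  have g4 : st2 4 (x %% N * N + j) = adj G (vtx (x %% N)) (vtx j).
    by rewrite f2 // f // e4.
  rewrite wp_ifE /= g14 g22 g3 g9 g4.
  have -> : (st2 18 0 * (vtx j \in A0) * adj G (vtx (x %% N)) (vtx j) == 0) =
     ~~ ((vtx j \in word_set L x) && adj G (vtx (x %% N)) (vtx j)).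
    by rewrite -h2 !muln_eq0; case: (st2 18 0 == 0); case: (vtx j \in A0); case: (adj _ _ _).
  have s2 : (st2 19 0, st2 20 0) = step t L x j by rewrite !f2.
  have [b1 b2] := step_b L x tT (jl : j.+1 <= N).
  move: b1 b2; rewrite {1 2}/step /= -/(step t L x j).
  case: ifP => /= hP b1 b2; last by rewrite wpE ?updE /= s2 /step /= hP.
  have := hch j jl; rewrite word_setS // => hc.
  rewrite -s2 -hc /= in b1 b2.
  have f7 i : st2 7 i = st 7 i by rewrite f2 // f.
  have f8 i : st2 8 i = st 8 i by rewrite f2 // f.
  rewrite /add_child !wpE /= ?updE /= g12 g3 g14 f7 f8; split=> //; split=> //.
  by rewrite /step /= hP -/(step t L x j) -s2 -hc.
move=> st' hI fr; rewrite ?updE /= e3 in hI.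
have f k : k \notin writes cell_prog -> st' k =1 st k.
  by move=> kk i; rewrite fr; [rewrite !(upd_out _ _ _ _ _ kk) | apply: notin_sub kk].
have [b1 b2] := step_b L x tT (leqnn N); rewrite -hI /= in b1 b2.
have g12 : st' 12 0 = x by rewrite fr.
rewrite !wpE /= g12; split=> //; rewrite ?updE /=; split=> //.
rewrite ?updE /= g12; apply: hQ.
- by move=> k kk i; rewrite !(upd_out _ _ _ _ _ kk) // f.
- by move=> y /negbTE yx; rewrite ?updE /= yx !fr.
- by rewrite ?updE /= eqxx -/(step t L x N) -hI.
Qed.

Let expN_b L : L <= T.+1 -> N ^ L < 2 ^ b.
Proof. by move=> h; apply: leq_ltn_trans W_lt; exact: words_le. Qed.

Definition level t (st : state) := st 13 0 = N ^ (T.+1 - t) /\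
  forall x, x < N ^ (T.+1 - t) ->
    (st 7 x, st 8 x) = tfrac t (word_set (T.+1 - t) x) (x %% N).

Lemma wp_leaf Q st : tree_env st ->
  (forall st', (forall k, k \notin writes leaf_prog -> st' k =1 st k) ->
     level 0 st' -> Q st') ->
  wp inp b W leaf_prog Q st.
Proof.
move=> env hQ; have [[e2 e3 e4] e10 e11 e56 e9] := env.
rewrite /leaf_prog !wpE /=; split=> //.
apply: (@wp_for _ _ _ _ _ _ _ _ (fun j st' => st' 13 0 = N ^ j)) => //.
- by rewrite updE /= e11.
- move=> j st' jl hI ej fr; rewrite updE /= e11 in jl.
  have f3 : st' 3 0 = N by rewrite fr.
  by rewrite wp_setE /= !updE /= hI f3 -expnSr; split=> //; exact: expN_b.
move=> st1 h13 f1; rewrite updE /= e11 in h13.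
have g k : k \notin writes leaf_prog -> st1 k =1 st k.
  by move=> kk i; rewrite f1; [rewrite !(upd_out _ _ _ _ _ kk) | apply: notin_sub kk].
apply: (@wp_for _ _ _ _ _ _ _ _ (fun j st' =>
  forall x, x < j -> (st' 7 x, st' 8 x) = tfrac 0 A0 (x %% N))) => //.
- by rewrite h13.
- move=> j st' jl hI ej fr; rewrite h13 in jl.
  have vN : j %% N < N by rewrite ltn_mod.
  have f k : k \notin writes leaf_prog -> st' k =1 st k.
    by move=> kk i; rewrite fr; [rewrite ?(upd_out _ _ _ _ _ kk) // g | apply: notin_sub kk].
  have f3 : st' 3 0 = N by rewrite f.
  have f2 : st' 2 0 = n by rewrite f.
  have [c1 c2] := e56 _ vN; have [cnb cdb] := c_b vN.
  rewrite !wpE hev_mod /= ej f3; split; first by apply: leq_ltn_trans W_lt; exact: leq_trans (ltnW vN) N_W.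
  have next u w : (u, w) = tfrac 0 A0 (j %% N) -> forall st2, st2 7 =1 (fun i => if i == j then u else st' 7 i) ->
      st2 8 =1 (fun i => if i == j then w else st' 8 i) ->
      forall x, x < j.+1 -> (st2 7 x, st2 8 x) = tfrac 0 A0 (x %% N).
    move=> huw st2 h7 h8 x; rewrite ltnS leq_eqVlt h7 h8 => /orP[/eqP ->|xj].
      by rewrite eqxx.
    by rewrite (ltn_eqF xj) hI.
  rewrite wp_ifE /= !updE /= f2 subn_eq0; case: leqP => nv; rewrite !wpE /= !updE /= ?ej.
    split; first by rewrite expn_gt0.
    split; first exact: b_gt1.
    by apply: (@next 0 1) => [|i|i]; rewrite ?updE //= ltnNge nv.
  have h5 : st' 5 (j %% N) = cn (j %% N) by rewrite f.
  have h6 : st' 6 (j %% N) = cd (j %% N) by rewrite f.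
  rewrite h6 h5; split=> //; split=> //.
  by apply: (@next (cd (j %% N)) (cn (j %% N))) => [|i|i]; rewrite ?updE //= nv.
move=> st' hI fr; apply: hQ.
  by move=> k kk i; rewrite fr; [rewrite ?(upd_out _ _ _ _ _ kk) // g | apply: notin_sub kk].
rewrite h13 in hI; rewrite /level subn0 fr //; split=> //.
Qed.

(** All levels share the arrays 7 and 8. Cell x is overwritten only after its children x N, ..., x N
    + N - 1 have been read, and later cells need children from (x + 1) N > x on; hence the
    increasing order of x is safe. *)
Lemma wp_tree Q st : tree_env st ->
  (forall st', (forall k, k \notin writes tree_prog -> st' k =1 st k) ->
     (forall v, v < N -> (st' 7 v, st' 8 v) = tfrac T (A0 :\ vtx v) v) -> Q st') ->
  wp inp b W tree_prog Q st.
Proof.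
move=> env hQ; rewrite /tree_prog wp_seqE; apply: wp_leaf => // st1 f1 l1.
have [[e2 e3 e4] e10 e11 e56 e9] := env.
apply: (@wp_for _ _ _ _ _ _ _ _ level) => //.
- by rewrite f1 // e10 ltnW.
- move=> t st' tT [h13 hc] et fr; rewrite f1 // e10 in tT.
  have f k : k \notin writes tree_prog -> st' k =1 st k.
    by move=> kk i; rewrite fr ?f1 //; apply: notin_sub kk.
  have f3 : st' 3 0 = N by rewrite f.
  have Tt : T.+1 - t = (T - t).+1 by lia.
  have d13 : st' 13 0 %/ st' 3 0 = N ^ (T - t) by rewrite h13 f3 Tt expnS mulKn.
  rewrite !wpE /= d13; split; first by apply: expN_b; lia.
  rewrite !updE /= f // e10 et; split.
    by apply: leq_ltn_trans W_lt; apply: ltnW; apply: leq_ltn_trans T_W; exact: leq_subr.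
  apply: (@wp_for _ _ _ _ _ _ _ _ (fun x st2 =>
    (forall y, y < x -> (st2 7 y, st2 8 y) = tfrac t.+1 (word_set (T - t) y) (y %% N)) /\
    (forall y, x * N <= y -> y < N ^ (T.+1 - t) ->
       (st2 7 y, st2 8 y) = tfrac t (word_set (T.+1 - t) y) (y %% N)))) => //.
  + by rewrite !updE /=; apply: words_le; lia.
  + by split=> // y _ yN; rewrite !updE /= hc.
  + move=> x st2 xl [hlo hhi] ex fr2; rewrite !updE /= in xl.
    have g k : k \notin writes tree_prog -> st2 k =1 st k.
      by move=> kk i; rewrite fr2; [rewrite !(upd_out _ _ _ _ _ kk) // f | apply: notin_sub kk].
    have g16 : st2 16 0 = T - t by rewrite fr2.
    apply: (@wp_cell t (T - t) x) => //.
    * apply: tree_env_frame env => k kk; apply: g.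
      by move: kk; rewrite !inE; do ![case/orP]; move=> /eqP ->.
    * exact: ltnW.
    * exact: leq_subr.
    * move=> w wN; have yl : x * N + w < N ^ (T.+1 - t).
        rewrite Tt expnSr; have : (x.+1) * N <= N ^ (T - t) * N by rewrite leq_mul2r xl orbT.
        by rewrite mulSn; lia.
      by rewrite hhi ?leq_addr // Tt modnMDl (modn_small wN).
    * move=> st3 f3' h3 hx; split=> y; rewrite !updE /=.
        rewrite ltnS leq_eqVlt => /orP[/eqP ->//|yx].
        by have [-> ->] := h3 y (negbT (ltn_eqF yx)); exact: hlo.
      rewrite mulSn => xy yN; have yx : y != x.
        apply: contraTneq xy => ->; rewrite -ltnNge.
        by apply: leq_trans (_ : N + x <= _); [lia | rewrite leq_add2l leq_pmulr].
      by have [-> ->] := h3 y yx; apply: hhi => //; lia.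
  + move=> st2 [hlo _] fr2; rewrite !updE /= in hlo.
    split; first by rewrite updE /= fr2 // !updE /= subSS.
    by move=> x; rewrite subSS !updE /=; exact: hlo.
move=> st' [_ hc] fr; rewrite f1 // e10 in hc; apply: hQ.
  by move=> k kk i; rewrite fr ?f1 //; apply: notin_sub kk.
move=> v vN; rewrite subSnn expn1 in hc.
have := hc v vN; rewrite /= (modn_small vN) //.
Qed.

End TreeProgram.

(** * Program for the search *)

Section SearchProgram.
Local Open Scope nat_scope.

Definition sum_prog rv num den :=
  HFor 14 3 (HIf (HA 4 (HAdd (HMul (reg rv) (reg 3)) (reg 14)))
    (19 <- HAdd (HMul (reg 19) den) (HMul num (reg 20)) ;;
     20 <- HMul (reg 20) den) HSkip).

(* Register 24 holds [s ^ 2]. *)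
Definition rows_prog :=
  HFor 23 2 (19 <- HC 0 ;; 20 <- HC 1 ;; sum_prog 23 (HC 1) (HA 5 (reg 14)) ;;
    HSet 5 (reg 23) (reg 19) ;; HSet 6 (reg 23) (HMul (reg 20) (reg 24))).

(* Leaves an overweight column in register 25, or 0 if there is none. *)
Definition check_prog := 25 <- HC 0 ;;
  HFor 23 2 (19 <- HC 0 ;; 20 <- HC 1 ;; 22 <- HAdd (reg 2) (reg 23) ;;
    sum_prog 22 (HA 7 (reg 14)) (HA 8 (reg 14)) ;;
    HIf (HSub (HMul (reg 19) (HA 8 (reg 22)))
          (HMul (HMul (HMul (HMul (HC 16) (reg 24))
             (HMul (HA 5 (reg 22)) (HA 5 (reg 22)))) (HA 7 (reg 22))) (reg 20)))
      (25 <- reg 22) HSkip).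

Definition round_prog := rows_prog ;; tree_prog ;; check_prog ;;
  HIf (reg 25) (HSet 5 (reg 25) (HMul (HC 2) (HA 5 (reg 25)))) HSkip.

Variables (n : nat) (G : bigraph n).
Hypothesis n_gt0 : 0 < n.
Local Notation N := (2 * n).
Local Notation vtx := (vtx n_gt0).
Variables (inp : nat -> nat) (b W T s I : nat).
Local Notation c0 := (N * (I + 3) + 2 * s + 1).
Hypothesis W_lt : W < 2 ^ b.
Hypothesis words_W : N ^ T.+1 <= W.
Hypothesis T_W : T < W.
Hypothesis bits_b : bits n c0 T.+1 <= b.
Hypothesis s_gt0 : 0 < s.

Let N_gt0 : 0 < N. Proof. by rewrite muln_gt0. Qed.
Let n_lt_N : n < N. Proof. by rewrite mul2n -addnn -{1}[n]addn0 ltn_add2l. Qed.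
Let N_W : N <= W.
Proof. by apply: leq_trans words_W; rewrite expnS leq_pmulr // expn_gt0 N_gt0. Qed.
Let n_W : n <= W. Proof. exact: leq_trans (ltnW n_lt_N) N_W. Qed.
Let N_c0 : N <= c0.
Proof. by rewrite -addnA; apply: leq_trans (leq_addr _ _); rewrite leq_pmulr // addn3. Qed.
Let c0_gt0 : 0 < c0. Proof. by rewrite addn1. Qed.
Let b_gt1 : 1 < 2 ^ b.
Proof. by apply: leq_ltn_trans W_lt; apply: leq_trans N_W. Qed.
Let lt_b t v : v < 2 ^ bits n c0 t -> t <= T.+1 -> v < 2 ^ b.
Proof.
by move=> h tT; apply: ltn_2expW h _; apply: leq_trans bits_b; exact: bits_mono.
Qed.
Let gt1 B : 0 < B -> 1 < 2 ^ B.
Proof. by move=> h; rewrite -{1}(expn0 2) ltn_exp2l. Qed.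
Let lt_c0 v : v < 2 ^ c0 -> v < 2 ^ b.
Proof. by move=> h; apply: (@lt_b 0) => //; rewrite /bits expn0 muln1. Qed.

Lemma wp_sum rv num den v q z Q st :
  rv \notin [:: 14; 19; 20] -> graph_env G n_gt0 st -> st rv 0 = v -> v < N ->
  (forall w st', w < N -> (forall k, k \notin [:: 14; 19; 20] -> st' k =1 st k) ->
     st' 14 0 = w -> hev st' num = (q w).1 /\ hev st' den = (q w).2) ->
  st 19 0 = z.1 -> st 20 0 = z.2 ->
  (forall m, m <= N ->
     let r := fold_frac q (fun w => adj G (vtx v) (vtx w)) z m in r.1 < 2 ^ b /\ r.2 < 2 ^ b) ->
  (forall st', (forall k, k \notin [:: 14; 19; 20] -> st' k =1 st k) ->
     (st' 19 0, st' 20 0) = fold_frac q (fun w => adj G (vtx v) (vtx w)) z N -> Q st') ->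
  wp inp b W (sum_prog rv num den) Q st.
Proof.
move=> hrv [e2 e3 e4] erv vN hq e19 e20 hb hQ.
apply: (@wp_for _ _ _ _ _ _ _ _ (fun j st' => (st' 19 0, st' 20 0) =
  fold_frac q (fun w => adj G (vtx v) (vtx w)) z j)) => //.
- by rewrite e3.
- by rewrite !updE /= e19 e20; case: (z).
- move=> j st' jl hI ej fr; rewrite e3 in jl.
  have f k : k \notin [:: 14; 19; 20] -> st' k =1 st k.
    by move=> kk i; rewrite fr; [|apply: notin_sub kk].
  have f3 : st' 3 0 = N by rewrite f.
  have g4 : st' 4 (v * N + j) = adj G (vtx v) (vtx j) by rewrite f // e4.
  have [b1 b2] := hb j.+1 jl; move: b1 b2.
  rewrite wp_ifE /= ej f3 (f rv hrv) erv g4.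
  case: (adj G _ _) => /=; last by rewrite wpE !updE.
  have [q1 q2] := hq j st' jl f ej.
  rewrite -hI /add_frac /= => b1 b2; rewrite !wpE /= q1 q2 !updE /=; split=> //.
  have [q1' q2'] := hq j (upd st' 19 0 (st' 19 0 * (q j).2 + (q j).1 * st' 20 0)) jl
    (fun k kk i => etrans (upd_out _ _ _ _ (isT : 19 \in [:: 14; 19; 20]) kk) (f k kk i))
    (ej : upd st' 19 0 _ 14 0 = j).
  by rewrite q2' ?updE.
move=> st' hI fr; rewrite e3 in hI; exact: hQ.
Qed.

Variable X : nat -> nat.
Hypothesis X_lt : forall w, X w < 2 ^ I.+1.

Definition row_frac k :=
  fold_frac (fun w => (1, X w)) (fun w => adj G (vtx k) (vtx w)) (0, 1) N.

Definition wnum k := if k < n then (row_frac k).1 else X k.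

Definition wden k := if k < n then (row_frac k).2 * s ^ 2 else 1.

Let row_fold_lt k m : m <= N ->
  let r := fold_frac (fun w => (1, X w)) (fun w => adj G (vtx k) (vtx w)) (0, 1) m in
  r.1 < 2 ^ (1 + N * (I.+1).+1) /\ r.2 < 2 ^ (1 + N * (I.+1).+1).
Proof.
move=> mN; have [//|//||r1 r2] := @fold_frac_lt (fun w => (1, X w))
  (fun w => adj G (vtx k) (vtx w)) (0, 1) m 1 I.+1.
  by move=> w _ _; split; [exact: gt1|exact: X_lt].
have le : 1 + m * I.+2 <= 1 + N * I.+2 by rewrite leq_add2l leq_mul2r mN.
by split; [exact: ltn_2expW r1 le|exact: ltn_2expW r2 le].
Qed.

(** The exponent is made of a row sum of at most N reciprocals of numbers of I + 1 bits and of the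
    factor s ^ 2, which is below 2 ^ (2 s). *)
Lemma weights_lt k : wnum k < 2 ^ c0 /\ wden k < 2 ^ c0.
Proof.
have [r1 r2] := row_fold_lt k (leqnn N); rewrite -/(row_frac k) in r1 r2.
have le : 1 + N * I.+2 + 2 * s <= c0.
  have : N * I.+2 <= N * (I + 3) by rewrite leq_mul2l; lia.
  by move: (N * I.+2) (N * (I + 3)); lia.
rewrite /wnum /wden; case: ifP => _; split.
- by apply: ltn_2expW r1 (leq_trans _ le); exact: leq_addr.
- apply: ltn_2expW le; rewrite expnD; apply: ltn_mul => //.
  by rewrite mulnC expnM ltn_exp2r // ltn_expl.
- apply: ltn_2expW (X_lt k) _; apply: leq_trans le.
  by apply: leq_trans (leq_addr _ _); nia.
- by apply: gt1; rewrite c0_gt0.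
Qed.

Definition search_env (st : state) :=
  [/\ graph_env G n_gt0 st, st 10 0 = T, st 11 0 = T.+1 & st 24 0 = s ^ 2].

Lemma search_env_frame st st' :
  (forall k, k \in [:: 2; 3; 4; 10; 11; 24] -> st' k =1 st k) ->
  search_env st -> search_env st'.
Proof.
move=> fr [h1 h2 h3 h4]; split; rewrite ?fr //.
by apply: graph_env_frame h1 => k kk; apply: fr; move: kk; rewrite !inE => /or3P[] ->;
    rewrite ?orbT.
Qed.

Lemma wp_rows Q st : search_env st ->
  (forall w, n <= w < N -> st 5 w = X w /\ st 6 w = 1) ->
  (forall st', (forall k, k \notin writes rows_prog -> st' k =1 st k) ->
     (forall w, w < N -> st' 5 w = wnum w /\ st' 6 w = wden w) -> Q st') ->
  wp inp b W rows_prog Q st.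
Proof.
move=> env eX hQ; have [[e2 e3 e4] e10 e11 e24] := env.
apply: (@wp_for _ _ _ _ _ _ _ _ (fun j st' =>
  (forall w, w < j -> st' 5 w = wnum w /\ st' 6 w = wden w) /\
  (forall w, n <= w < N -> st' 5 w = X w /\ st' 6 w = 1))) => //.
- by rewrite e2.
- move=> j st' jl [hlo hhi] ej fr; rewrite e2 in jl.
  have f k : k \notin writes rows_prog -> st' k =1 st k.
    by move=> kk i; rewrite fr; [|apply: notin_sub kk].
  have b0 : 0 < 2 ^ b by rewrite expn_gt0.
  rewrite !wpE /=; split; first exact: b0.
  split; first exact: b_gt1.
  (* Array 5 already holds new weights at earlier rows, but a row has no neighbours among the rows,
     so these entries are never added. *)
  have eqf m : fold_frac (fun w => (1, if w < n then st' 5 w else X w))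
      (fun w => adj G (vtx j) (vtx w)) (0, 1) m =
      fold_frac (fun w => (1, X w)) (fun w => adj G (vtx j) (vtx w)) (0, 1) m.
    by apply: eq_fold_frac => // w wm; rewrite /vtx jl; case: ltnP.
  apply: (@wp_sum _ _ _ j (fun w => (1, if w < n then st' 5 w else X w)) (0, 1)) => //.
  + by split; rewrite ?updE /= ?f // => u w uN wN; rewrite !updE /= f // e4.
  + exact: ltn_trans n_lt_N.
  + move=> w st2 wN f2 e14; rewrite /= e14 f2 // !updE /=; split=> //.
    by case: ltnP => // nw; have [-> _] := hhi w (introT andP (conj nw wN)).
  + move=> m mN; rewrite eqf.
    have [r1 r2] := row_fold_lt j mN; have le : 1 + N * I.+2 <= c0.
      have : N * I.+2 <= N * (I + 3) by rewrite leq_mul2l; lia.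
      by move: (N * I.+2) (N * (I + 3)); lia.
    by split; apply: lt_c0; [exact: ltn_2expW r1 le|exact: ltn_2expW r2 le].
  move=> st2 f2; rewrite eqf -/(row_frac j) => h2.
  have [w1 w2] := weights_lt j; rewrite /wnum /wden jl -h2 /= in w1 w2.
  have g23 : st2 23 0 = j by rewrite f2.
  have g24 : st2 24 0 = s ^ 2 by rewrite f2 // !updE /= f.
  rewrite !wpE /= g23 !updE /= g24; split; first exact: lt_c0.
  split; first exact: lt_c0.
  split=> w.
    rewrite !updE /= ltnS leq_eqVlt => /orP[/eqP ->|wj].
      by rewrite g23 !eqxx /wnum /wden jl -h2.
    by rewrite g23 (ltn_eqF wj) !f2 // !updE /=; exact: hlo.
  move=> /andP[nw wN]; have wj : w == j = false by apply/negbTE; rewrite gtn_eqF //; exact: leq_trans nw.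
  by rewrite !updE /= g23 wj !f2 // !updE /=; apply: hhi; rewrite nw.
move=> st' [hlo hhi] fr; rewrite e2 in hlo; apply: hQ.
  by move=> k kk i; rewrite fr; [|apply: notin_sub kk].
move=> w wN; case: (ltnP w n) => nw; first exact: hlo.
by rewrite /wnum /wden ltnNge nw; apply: hhi; rewrite nw.
Qed.

Definition tree_val v := tree_frac G n_gt0 wnum wden T ([set: node n]%SET :\ vtx v) v.

Definition nbr_sum v := fold_frac tree_val (fun w => adj G (vtx v) (vtx w)) (0, 1) N.

(** [overweight] with denominators cleared, so that only natural numbers are compared. *)
Definition heavy v :=
  16 * s ^ 2 * (X v * X v) * (tree_val v).1 * (nbr_sum v).2 <
  (nbr_sum v).1 * (tree_val v).2.

Let tree_val_lt v : v < N ->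
  (tree_val v).1 < 2 ^ bits n c0 T /\ (tree_val v).2 < 2 ^ bits n c0 T.
Proof. by move=> vN; apply: tree_frac_lt => // k _; exact: weights_lt. Qed.

Let nbr_sum_lt v m : m <= N ->
  let r := fold_frac tree_val (fun w => adj G (vtx v) (vtx w)) (0, 1) m in
  r.1 < 2 ^ b /\ r.2 < 2 ^ b.
Proof.
move=> mN; have p1 : (0, 1).1 < 2 ^ c0 by rewrite expn_gt0.
have p2 : (0, 1).2 < 2 ^ c0 by apply: gt1; rewrite c0_gt0.
have [|r1 r2] := @fold_frac_lt tree_val (fun w => adj G (vtx v) (vtx w)) (0, 1) m
   c0 (bits n c0 T) p1 p2.
  by move=> w wm _; apply: tree_val_lt; exact: leq_trans mN.
have le : c0 + m * (bits n c0 T).+1 <= bits n c0 T.+1.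
  by apply: leq_trans (bits_step T N_c0); rewrite leq_add2l leq_mul2r mN orbT.
by split; apply: (@lt_b T.+1) => //; [exact: ltn_2expW r1 le|exact: ltn_2expW r2 le].
Qed.

(** The value 0 can signal that no column was found, because columns have indices from n > 0 on. *)
Lemma wp_check Q st : search_env st -> (forall v, n <= v < N -> st 5 v = X v) ->
  (forall v, v < N -> (st 7 v, st 8 v) = tree_val v) ->
  (forall st', (forall k, k \notin writes check_prog -> st' k =1 st k) ->
     (st' 25 0 = 0 /\ forall v, n <= v < N -> ~~ heavy v) \/
     (n <= st' 25 0 < N /\ heavy (st' 25 0)) -> Q st') ->
  wp inp b W check_prog Q st.
Proof.
move=> env eX e78 hQ; have [[e2 e3 e4] e10 e11 e24] := env.
have b0 : 0 < 2 ^ b by rewrite expn_gt0.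
rewrite /check_prog !wpE /=; split; first exact: b0.
apply: (@wp_for _ _ _ _ _ _ _ _ (fun j st' =>
     (st' 25 0 = 0 /\ forall v, n <= v < n + j -> ~~ heavy v) \/
     (n <= st' 25 0 < n + j /\ heavy (st' 25 0)))) => //.
- by rewrite updE /= e2.
- by left; split=> // v; rewrite addn0; lia.
- move=> j st' jl hI ej fr; rewrite updE /= e2 in jl.
  have f k : k \notin writes check_prog -> st' k =1 st k.
    by move=> kk i; rewrite fr; [rewrite !(upd_out _ _ _ _ _ kk) | apply: notin_sub kk].
  have vN : n + j < N by lia.
  have f2 : st' 2 0 = n by rewrite f.
  have nj : n <= n + j < N by rewrite leq_addr vN.
  rewrite !wpE /=; split; first exact: b0.
  split; first exact: b_gt1.
  rewrite !updE /= f2 ej; split; first by apply: leq_ltn_trans W_lt; exact: leq_trans (ltnW vN) N_W.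
  apply: (@wp_sum _ _ _ (n + j) tree_val (0, 1)) => //.
  + by split; rewrite ?updE /= ?f // => u w uN wN; rewrite !updE /= f // e4.
  + move=> w st2 wN g2 e14; rewrite /= e14 !g2 // !updE /= !f //.
    by rewrite -e78.
  + by move=> m mN; exact: nbr_sum_lt.
  move=> st2 g2; rewrite -/(nbr_sum _) => h2.
  have g22 : st2 22 0 = n + j by rewrite g2.
  have g24 : st2 24 0 = s ^ 2 by rewrite g2 // !updE /= f.
  have g5 : st2 5 (n + j) = X (n + j) by rewrite g2 // !updE /= f // eX.
  have g25 : st2 25 0 = st' 25 0 by rewrite g2.
  have g78 : (st2 7 (n + j), st2 8 (n + j)) = tree_val (n + j).
    by rewrite !g2 // !updE /= !f // e78.
  rewrite wp_ifE /= g22 g24 g5 subn_eq0.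
  have -> : (st2 19 0 * st2 8 (n + j) <=
      16 * s ^ 2 * (X (n + j) * X (n + j)) * st2 7 (n + j) * st2 20 0) = ~~ heavy (n + j).
    by rewrite /heavy -h2 -g78 -leqNgt.
  case hv: (heavy (n + j)); rewrite /= !wpE /= ?g22.
    split; first by apply: leq_ltn_trans W_lt; exact: leq_trans (ltnW vN) N_W.
    by right; rewrite !updE /= hv; split=> //; lia.
  rewrite !updE /= g25; case: hI => [[h0 h1]|[h0 h1]]; [left|right]; split=> //.
    move=> v hv'; have [->|ne] := eqVneq v (n + j); first by rewrite hv.
    by apply: h1; move: hv' ne; lia.
  by move: h0; lia.
move=> st' hI fr; rewrite updE /= e2 addnn -mul2n in hI; apply: hQ => // k kk i.
by rewrite fr; [rewrite !(upd_out _ _ _ _ _ kk) | apply: notin_sub kk].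
Qed.

Definition columns (Y : nat -> nat) (st : state) :=
  forall w, n <= w < N -> st 5 w = Y w /\ st 6 w = 1.

Lemma wp_round Q st : search_env st -> columns X st ->
  (forall u, u < N -> st 9 u = 1) ->
  (forall st', (forall k, k \notin writes round_prog -> st' k =1 st k) ->
     (columns X st' /\ forall v, n <= v < N -> ~~ heavy v) \/
     (exists v, [/\ n <= v < N, heavy v &
        columns (fun w => if w == v then 2 * X v else X w) st']) -> Q st') ->
  (forall v, 2 * X v < 2 ^ I.+1) ->
  wp inp b W round_prog Q st.
Proof.
move=> env eX e9 hQ X2; have [[e2 e3 e4] e10 e11 e24] := env.
rewrite /round_prog !wpE; apply: wp_rows => // st1 f1 h1.
rewrite wpE; apply: (@wp_tree n G n_gt0 inp b W c0 T wnum wden [set: node n]%SET) => //.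
- by move=> k _; exact: weights_lt.
- split; rewrite ?f1 //; first by split; rewrite ?f1 // => u w uN wN; rewrite f1 // e4.
  by move=> u uN; rewrite f1 // e9 // inE.
move=> st2 f2 h2; rewrite wpE; apply: wp_check.
- apply: search_env_frame env => k kk; have := kk; rewrite !inE => kk' i.
  by rewrite f2 ?f1 //; move: kk'; do ![case/orP]; move=> /eqP ->.
- move=> v /andP[nv vN]; rewrite f2 //; have [-> _] := h1 v vN.
  by rewrite /wnum ltnNge nv.
- by move=> v vN; rewrite h2.
move=> st3 f3 h3.
have c3 : columns X st3.
  move=> w /andP[nw wN]; rewrite !f3 // !f2 //; have [-> ->] := h1 w wN.
  by rewrite /wnum /wden ltnNge nw.
have fr k : k \notin writes round_prog -> st3 k =1 st k.
  move=> kk i; rewrite f3; last by apply: notin_sub kk.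
  rewrite f2; last by apply: notin_sub kk.
  by rewrite f1 //; apply: notin_sub kk.
rewrite wp_ifE /=; case: h3 => [[-> h3]|[h3 hv]].
  by rewrite /= wpE; apply: hQ => //; left.
have -> : st3 25 0 == 0 = false by apply/negbTE; rewrite -lt0n; move: h3; lia.
have [x1 x2] := c3 _ h3.
rewrite wpE /= x1; split.
  by apply: lt_c0; apply: ltn_2expW (X2 _) _; nia.
apply: hQ.
  by move=> k kk i; rewrite (upd_out _ _ _ _ _ kk) // fr.
right; exists (st3 25 0); split=> // w hw; have [y1 y2] := c3 w hw.
by rewrite !updE /= y1 y2.
Qed.

Section Values.
Variable R : realType.
Local Open Scope ring_scope.

Definition col_weights (Y : nat -> nat) (v : node n) : R :=
  if is_row v then 1 else (Y (vidx v))%:R.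

Hypothesis X_gt0 : forall w, (0 < X w)%N.

Lemma col_weights_gt0 v : 0 < col_weights X v.
Proof. by rewrite /col_weights; case: ifP => // _; rewrite ltr0n. Qed.

Hypothesis row_nbr : forall i : node n, is_row i -> exists j, adj G i j.

Lemma row_fracE k : (k < n)%N -> (0 < (row_frac k).2)%N /\
  frac R (row_frac k) = \sum_(j | adj G (vtx k) j) (col_weights X j)^-1.
Proof.
move=> kn; have [//||r2 rE] := @fold_fracE R (fun w => (1%N, X w))
  (fun w => adj G (vtx k) (vtx w)) (0%N, 1%N) N; first by move=> w _ _ /=.
split=> //; rewrite rE {1}/frac /= mul0r add0r (sum_vtx n_gt0); apply: eq_bigr => w akw.
rewrite /frac /= div1r /col_weights (adj_row akw) is_row_vtx kn /=.
by rewrite vtxK.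
Qed.

Lemma weights_pos k : (k < N)%N -> (0 < wnum k)%N && (0 < wden k)%N.
Proof.
move=> kN; rewrite /wnum /wden; case: ifP => kn; last by rewrite X_gt0.
have [r2 rE] := row_fracE kn; rewrite muln_gt0 r2 expn_gt0 s_gt0 /= andbT.
have [|j aj] := @row_nbr (vtx k); first by rewrite is_row_vtx.
have : 0 < frac R (row_frac k).
  rewrite rE (bigD1 j) //= ltr_pwDl ?invr_gt0 ?col_weights_gt0 //.
  by rewrite sumr_ge0 // => i _; rewrite invr_ge0 ltW // col_weights_gt0.
by rewrite /frac; case: ((row_frac k).1) => //; rewrite mul0r ltxx.
Qed.

Lemma weight_ofE v : weight_of wnum wden R v =
  wts (adj G) (@is_row n) s%:R (col_weights X) v.
Proof.
rewrite /weight_of /wnum /wden /wts; case: v => [i|j].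
  have [r2 rE] := row_fracE (ltn_ord i).
  have vi : vtx i = inl i := vidxK n_gt0 (inl i).
  rewrite vi in rE; rewrite /= ltn_ord -rE /frac natrM natrX.
  move: (row_frac i).1 (row_frac i).2 r2 => p q q0; field.
  by rewrite !pnatr_eq0 -!lt0n s_gt0 q0.
by rewrite /= ltnNge leq_addr /= divr1 /col_weights /=.
Qed.

Local Notation x := (col_weights X).
Local Notation Wx := (wts (adj G) (@is_row n) s%:R x).

Lemma tree_valE v : (v < N)%N -> (0 < (tree_val v).2)%N /\
  frac R (tree_val v) = trunc_ratio (adj G) (@is_row n) Wx T (~: [set vtx v]) (vtx v).
Proof.
move=> vN; have [h1 h2] := @tree_fracE n G n_gt0 wnum wden R weights_pos T
  ([set: node n]%SET :\ vtx v) v vN.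
have E : [set: node n]%SET :\ vtx v = ~: [set vtx v].
  by apply/setP => u; rewrite !inE andbT.
split=> //; rewrite /tree_val h2 E (_ : weight_of wnum wden R = Wx) //.
by apply/funext => u; exact: weight_ofE.
Qed.

Lemma heavyE v : (n <= v < N)%N -> heavy v <-> overweight G s%:R T x (vtx v).
Proof.
move=> /andP[nv vN].
have [t2 tE] := tree_valE vN.
have [//||r2 rE] := @fold_fracE R tree_val
  (fun w => adj G (vtx v) (vtx w)) (0%N, 1%N) N.
  by move=> w wN _; have [] := tree_valE wN.
rewrite -/(nbr_sum v) in r2 rE.
rewrite /overweight (sum_vtx n_gt0) -tE.
rewrite (eq_bigr (fun w : 'I_N => frac R (tree_val w))); last first.
  by move=> w _; have [_ ->] := tree_valE (ltn_ord w).
have -> : \sum_(w < N | adj G (vtx v) (vtx w)) frac R (tree_val w) = frac R (nbr_sum v).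
  by rewrite rE {2}/frac /= mul0r add0r.
have -> : x (vtx v) = (X v)%:R by rewrite /col_weights is_row_vtx ltnNge nv /= vtxK.
rewrite /heavy /frac mulrA ltr_pdivrMr ?ltr0n // [ltRHS]mulrAC ltr_pdivlMr ?ltr0n //.
rewrite -(ltr_nat R) !natrM; set lhs := (Y in Y < _ <-> _).
by rewrite (_ : 16 * s%:R ^+ 2 * _ * _ * _ = lhs) // /lhs; ring.
Qed.

End Values.
End SearchProgram.

(** * The loop of the search, and the output *)

Section MainLoops.
Local Open Scope nat_scope.

Definition search_prog := HFor 26 27 round_prog.

Definition output_prog := rows_prog ;; 0 <- HC 1 ;; 1 <- HC 1 ;;
  HFor 28 2 (0 <- HMul (reg 0) (HA 5 (HAdd (reg 2) (reg 28)))) ;;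
  HFor 28 2 (tree_prog ;; 0 <- HMul (reg 0) (HA 8 (reg 28)) ;;
             1 <- HMul (reg 1) (HA 7 (reg 28)) ;; HSet 9 (reg 28) (HC 0)).

Variables (n : nat) (G : bigraph n).
Hypothesis n_gt0 : 0 < n.
Local Notation N := (2 * n).
Local Notation vtx := (vtx n_gt0).
Variables (inp : nat -> nat) (b W T s I : nat).
Local Notation c0 := (N * (I + 3) + 2 * s + 1).
Hypothesis W_lt : W < 2 ^ b.
Hypothesis words_W : N ^ T.+1 <= W.
Hypothesis T_W : T < W.
Hypothesis bits_b : bits n c0 T.+1 <= b.
Hypothesis s_gt0 : 0 < s.
Variable R : realType.
Hypothesis row_nbr : forall i : node n, is_row i -> exists j, adj G i j.

Let b_gt0 : 0 < 2 ^ b. Proof. by rewrite expn_gt0. Qed.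
Let n_W : n <= W.
Proof.
apply: leq_trans words_W; rewrite expnS; apply: (@leq_trans N); first lia.
by rewrite leq_pmulr // expn_gt0; lia.
Qed.
Let N_c0 : N <= c0.
Proof. by rewrite -addnA; apply: leq_trans (leq_addr _ _); rewrite leq_pmulr // addn3. Qed.
Let lt_bT v : v < 2 ^ (c0 + N * (bits n c0 T).+1) -> v < 2 ^ b.
Proof.
move=> h; apply: ltn_2expW h _; apply: leq_trans bits_b; exact: bits_step.
Qed.

(** A round doubles at most one column weight, so after r rounds all of them are below 2 ^ r.+1.
    This keeps the bit lengths polynomial in the number of rounds. *)
Lemma wp_search (eta : R) Q st :
  (2 <= s%:R :> R)%R -> (0 <= eta <= 1)%R ->
  (forall x : node n -> R, (forall v, 0 < x v)%R ->
     accurate G (wts (adj G) (@is_row n) s%:R x) T eta) ->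
  0 < permanent G -> 8 * n ^ 3 * s ^ 2 <= I -> I <= W ->
  search_env G n_gt0 T s st -> st 27 0 = I -> columns n (fun=> 1) st ->
  (forall u, u < N -> st 9 u = 1) ->
  (forall st', (forall k, k \notin writes search_prog -> st' k =1 st k) ->
     (exists X : nat -> nat, [/\ forall w, 0 < X w, forall w, X w < 2 ^ I.+1,
        columns n X st',
        tame (adj G) (@is_row n) s%:R (col_weights R X : node n -> R) &
        forall j : node n, ~~ is_row j -> ~ overweight G s%:R T (col_weights R X) j]) ->
     Q st') ->
  wp inp b W search_prog Q st.
Proof.
move=> s2 eta01 acc per0 hI IW env e27 e1 e9 hQ.
apply: (@wp_for _ _ _ _ _ _ _ _ (fun r st' => exists X : nat -> nat,
   [/\ forall w, 0 < X w, forall w, X w < 2 ^ r.+1, columns n X st' &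
     search_inv G s%:R T r (col_weights R X : node n -> R)])) => //.
- by rewrite e27.
- exists (fun=> 1); split=> //.
  apply: search_inv0 => // v; rewrite /col_weights; by case: ifP.
- move=> r st' rI [X [X0 Xr cX sX]] er fr; rewrite e27 in rI.
  have XI w : X w < 2 ^ I.+1 by apply: ltn_2expW (Xr w) _; exact: ltnW.
  have env' : search_env G n_gt0 T s st'.
    apply: search_env_frame env => k kk; apply: fr.
    by move: kk; rewrite !inE; do ![case/orP]; move=> /eqP ->.
  have hx (v : node n) : (0 < col_weights R X v)%R by exact: col_weights_gt0.
  apply: (wp_round inp W_lt words_W T_W bits_b s_gt0 XI env' cX).
  + by move=> u uN; rewrite fr // e9.
  + move=> st2 f2 [[c2 hv]|[v [hv hvy c2]]].
      exists X; split=> //.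
        by move=> w; apply: ltn_2expW (Xr w) _.
      apply: (search_inv_settled _ _ sX) => j rj.
      have vj := vidxK n_gt0 j; rewrite -vj.
      move/(heavyE n_gt0 T s_gt0 R X0 row_nbr) => h.
      have hj : n <= vidx j < N.
        by case: j rj {vj h} => j //= _; rewrite leq_addr /=; have := ltn_ord j; lia.
      by have /negP := hv _ hj; apply; exact: h.
    exists (fun w => if w == v then 2 * X v else X w); split=> //.
    * by move=> w; case: eqP => // _; rewrite muln_gt0 X0.
    * move=> w; case: eqP => _; last by apply: ltn_2expW (Xr w) _.
      by rewrite expnS ltn_pmul2l.
    have -> : col_weights R (fun w => if w == v then 2 * X v else X w) =
        double (col_weights R X) (vtx v) :> (node n -> R).
      move/andP: hv => [nv vN].
      apply/funext => u; rewrite /double /col_weights is_row_vtx (ltnNge v) nv /=.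
      rewrite vtxK //; have [->|ne] := eqVneq u (vtx v).
        by rewrite is_row_vtx ltnNge nv vtxK // eqxx natrM.
      case: ifP => // _; case: eqP => // uv; case/eqP: ne.
      by rewrite -uv vidxK.
    have rk : ~~ is_row (vtx v) by rewrite is_row_vtx -leqNgt; case/andP: hv.
    apply: (search_inv_double s2 eta01 row_nbr sX (acc _ hx) rk).
    exact/(heavyE n_gt0 T s_gt0 R X0 row_nbr hv).
  + by move=> v; rewrite expnS ltn_pmul2l //; apply: ltn_2expW (Xr v) _.
move=> st' [X [X0 Xr cX sX]] fr; rewrite e27 in Xr sX; apply: hQ => //.
exists X; split=> //; first by case: sX.
apply: (search_inv_end s2 row_nbr n_gt0 _ per0 sX).
by rewrite -!natrX -!natrM ler_nat.
Qed.

(** Clearing entry j of array 9 passes from one set [rows_from] to the next, as the telescoping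
    product requires. The factors are inverse ratios, so denominators go to register 0 and
    numerators to register 1. *)
Lemma wp_output X Q st : (forall w, 0 < X w) -> (forall w, X w < 2 ^ I.+1) ->
  search_env G n_gt0 T s st -> columns n X st -> (forall u, u < N -> st 9 u = 1) ->
  (forall v A, 0 < trunc_ratio (adj G) (@is_row n)
     (wts (adj G) (@is_row n) s%:R (col_weights R X)) T A (inl v))%R ->
  (forall st', st' 1 0 != 0 ->
     ((st' 0 0)%:R / (st' 1 0)%:R = estimate G
        (wts (adj G) (@is_row n) s%:R (col_weights R X)) T :> R)%R -> Q st') ->
  wp inp b W output_prog Q st.
Proof.
move=> X0 XI env cX e9 tpos hQ; have [[e2 e3 e4] e10 e11 e24] := env.
rewrite /output_prog wp_seqE; apply: (wp_rows inp W_lt words_W T_W bits_b s_gt0 XI env cX).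
move=> st1 f1 h1; rewrite !wpE /=.
have b1 : 1 < 2 ^ b by apply: leq_ltn_trans W_lt; apply: leq_trans n_W.
split; first exact: b1.
split; first exact: b1.
have lt_prod m (F : nat -> nat) B : (forall i, i < m -> F i < 2 ^ B) ->
    \prod_(i < m) F i < 2 ^ (m * B + 1).
  elim: m => [|m IH] hF; first by rewrite big_ord0.
  rewrite big_ord_recr /= mulSn -addnA [B + _]addnC expnD.
  apply: ltn_mul; last exact: hF.
  by apply: IH => i im; apply: hF; exact: ltnW.
apply: (@wp_for _ _ _ _ _ _ _ _ (fun j st' => st' 0 0 = \prod_(i < j) X (n + i))) => //.
- by rewrite !updE /= f1 // e2.
- by rewrite !updE /= big_ord0.
- move=> j st' jl hI ej fr; rewrite !updE /= f1 // e2 in jl.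
  have f2 : st' 2 0 = n by rewrite fr // !updE /= f1.
  rewrite wpE /= f2 ej hI.
  have h5 : st' 5 (n + j) = X (n + j).
    rewrite fr // !updE /=; have [-> _] := h1 (n + j) ltac:(lia).
    by rewrite /wnum ltnNge leq_addr.
  rewrite h5 !updE /=; split; last by rewrite big_ord_recr.
  have := lt_prod j.+1 (fun i => X (n + i)) I.+1 (fun i _ => XI _).
  rewrite big_ord_recr /= => h; apply: lt_bT; apply: ltn_2expW h _.
  apply: (@leq_trans c0); last exact: leq_addr.
  by rewrite leq_add2r; nia.
move=> st2 h2 f2; rewrite !updE /= f1 // e2 in h2.
pose tv k := tree_frac G n_gt0 (wnum G n_gt0 X) (wden G n_gt0 s X) T (rows_from n k.+1) k.
have tv_lt k : k < n -> (tv k).1 < 2 ^ bits n c0 T /\ (tv k).2 < 2 ^ bits n c0 T.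
  move=> kn; apply: tree_frac_lt; [exact: N_c0|by rewrite addn1| |lia].
  by move=> i _; exact: (weights_lt G n_gt0 W_lt words_W T_W bits_b s_gt0 XI).
have out_lt j F : j < n -> (forall k, k < n -> F k < 2 ^ bits n c0 T) ->
    (\prod_(i < n) X (n + i)) * \prod_(i < j.+1) F i < 2 ^ b.
  move=> jn hF; have p1 := lt_prod n (fun i => X (n + i)) I.+1 (fun i _ => XI _).
  have p2 : \prod_(i < j.+1) F i < 2 ^ (j.+1 * bits n c0 T + 1).
    by apply: lt_prod => i ij; apply: hF; lia.
  apply: lt_bT; apply: (@ltn_2expW _ ((n * I.+1 + 1) + (j.+1 * bits n c0 T + 1))).
    by rewrite expnD ltn_mul.
  have : j.+1 * bits n c0 T <= N * bits n c0 T by rewrite leq_mul2r; lia.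
  have : n * I.+1 + N <= N * (I + 3) by nia.
  move: (bits n c0 T) => B; rewrite mulnS; lia.
apply: (@wp_for _ _ _ _ _ _ _ _ (fun j st' =>
  [/\ st' 0 0 = (\prod_(i < n) X (n + i)) * \prod_(i < j) (tv i).2,
      st' 1 0 = \prod_(i < j) (tv i).1 &
      forall u, u < N -> st' 9 u = (vtx u \in rows_from n j)])) => //.
- by rewrite f2 // !updE /= f1 // e2.
- split; rewrite ?updE /= ?big_ord0 ?muln1 //.
    by rewrite f2.
  by move=> u uN; rewrite updE /= f2 // !updE /= f1 // e9 // rows_from0 inE.
- move=> j st' jl [h0 h1' h9] ej fr; rewrite f2 // !updE /= f1 // e2 in jl.
  have fk k : k \notin writes output_prog -> st' k =1 st k.
    move=> kk i; rewrite fr; last by apply: notin_sub kk.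
    rewrite f2; last by apply: notin_sub kk.
    by rewrite !(upd_out _ _ _ _ _ kk) // f1 //; apply: notin_sub kk.
  rewrite wp_seqE; apply: (@wp_tree n G n_gt0 inp b W c0 T
    (wnum G n_gt0 X) (wden G n_gt0 s X) (rows_from n j)) => //.
  + by move=> k _; exact: (weights_lt G n_gt0 W_lt words_W T_W bits_b s_gt0 XI).
  + split; rewrite ?fk //; first by split; rewrite ?fk // => u w uN wN; rewrite fk // e4.
    by move=> u uN; rewrite !fr // !f2 // !updE /=; exact: h1.
  move=> st3 f3 h3.
  have jN : j < N by lia.
  have g28 : st3 28 0 = j by rewrite f3.
  have gtv : (st3 7 j, st3 8 j) = tv j.
    rewrite h3 // /tv /vtx jl; congr (tree_frac _ _ _ _ _ _ _).
    have := rows_from_setD1 (ord_of n_gt0 j).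
    by rewrite /= modn_small.
  have [l1 l2] := tv_lt j jl.
  have o0 := out_lt j (fun k => (tv k).2) jl (fun k kn => proj2 (tv_lt k kn)).
  have o1 := out_lt j (fun k => (tv k).1) jl (fun k kn => proj1 (tv_lt k kn)).
  rewrite big_ord_recr /= mulnA -gtv /= in o0.
  have g0 : st3 0 0 = (\prod_(i < n) X (n + i)) * \prod_(i < j) (tv i).2 by rewrite f3.
  have g1 : st3 1 0 = \prod_(i < j) (tv i).1 by rewrite f3.
  rewrite !wpE /= g28 !updE /= g28 g0 g1; split; first exact: o0.
  split.
    apply: leq_ltn_trans o1; rewrite big_ord_recr /= -gtv /= leq_pmull //.
    by rewrite prodn_gt0.
  split; first exact: b_gt0.
  split.
  + by rewrite big_ord_recr /= mulnA -gtv.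
  + by rewrite big_ord_recr /= -gtv.
  + move=> u uN; rewrite ?updE /= ?g28 f3 // h9 // /rows_from !inE /vtx.
    have [->|uj] := eqVneq u j; first by rewrite jl /= modn_small // ltnn.
    case: ltnP => // un; rewrite /= modn_small //.
    by rewrite leq_eqVlt eq_sym (negbTE uj).
move=> st' [h0 h1' _] fr; rewrite f2 // !updE /= f1 // e2 in h0 h1'.
have cpos : forall k, k < N -> (0 < wnum G n_gt0 X k) && (0 < wden G n_gt0 s X k).
  by move=> k; exact: (weights_pos n_gt0 s_gt0 R X0 row_nbr).
have wE : weight_of (wnum G n_gt0 X) (wden G n_gt0 s X) R =
    wts (adj G) (@is_row n) s%:R (col_weights R X) :> (node n -> R).
  by apply/funext => u; exact: weight_ofE.
have tvE (i : 'I_n) : 0 < (tv i).2 /\ (frac R (tv i) = trunc_ratio (adj G) (@is_row n)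
    (wts (adj G) (@is_row n) s%:R (col_weights R X)) T (rows_from n i.+1) (inl i))%R.
  have iN : i < N by have := ltn_ord i; lia.
  have [p1 p2] := @tree_fracE n G n_gt0 (wnum G n_gt0 X) (wden G n_gt0 s X) R cpos T
    (rows_from n i.+1) i iN.
  split=> //; rewrite /tv p2 wE; congr (trunc_ratio _ _ _ _ _ _).
  exact: (vidxK n_gt0 (inl i)).
have tv1 (i : 'I_n) : 0 < (tv i).1.
  have [_ te] := tvE i; have := tpos i (rows_from n i.+1); rewrite -te /frac.
  by case: ((tv i).1) => //; rewrite mul0r ltxx.
apply: hQ; first by rewrite h1' -lt0n prodn_gt0.
rewrite h0 h1' /estimate natrM !natr_prod -mulrA mulrC; congr (_ * _)%R.
rewrite -prodf_div; apply: eq_bigr => i _.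
by have [_ <-] := tvE i; rewrite /frac invf_div.
Qed.

End MainLoops.

(** * Program for the parameters *)

Section Setup.
Local Open Scope nat_scope.

Definition entry_addr i j := HAdd (HMul (HC 2) (HAdd (HMul i (reg 2)) (HSub j (reg 2)))) (HC 1).

Definition graph_prog := HFor 23 3 (HFor 14 3 (
  HIf (HSub (reg 2) (reg 23))
    (HIf (HSub (reg 2) (reg 14)) (29 <- HC 0) (HLoad 29 (entry_addr (reg 23) (reg 14))))
    (HIf (HSub (reg 2) (reg 14)) (HLoad 29 (entry_addr (reg 14) (reg 23))) (29 <- HC 0)) ;;
  HSet 4 (HAdd (HMul (reg 23) (reg 3)) (reg 14)) (reg 29))).

(* Leaves [2 ^ a] and [a] in the registers 30 and 31. *)
Definition exponent_prog := 30 <- HC 1 ;; 31 <- HC 0 ;;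
  HFor 23 2 (HIf (HSub (reg 2) (reg 30))
    (HLoad 29 (HAdd (HMul (HC 2) (reg 31)) (HC 2)) ;;
     HIf (reg 29) HSkip (30 <- HMul (HC 2) (reg 30) ;; 31 <- HAdd (reg 31) (HC 1)))
    HSkip).

(* Leaves in the registers 20 and 21 the least power of 2 not below the row degrees,
   and its exponent. *)
Definition degree_prog := 20 <- HC 1 ;; 21 <- HC 0 ;;
  HFor 23 2 (19 <- HC 0 ;; HFor 14 3 (
    19 <- HAdd (reg 19) (HA 4 (HAdd (HMul (reg 23) (reg 3)) (reg 14))) ;;
    HIf (HSub (reg 19) (reg 20))
      (20 <- HMul (HC 2) (reg 20) ;; 21 <- HAdd (reg 21) (HC 1)) HSkip)).

Definition param_prog E :=
  21 <- HAdd (reg 21) (HC 1) ;;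
  20 <- HAdd (HAdd (HAdd (HC E) (reg 31)) (reg 21)) (HC 1) ;;
  22 <- HMul (HMul (HMul (HC 20) (HC E)) (HMul (reg 30) (reg 21))) (reg 20) ;;
  24 <- HMul (reg 22) (reg 22) ;;
  19 <- HMul (HMul (HC 20) (reg 22)) (reg 20) ;;
  HIf (HSub (reg 19) (reg 3)) (10 <- reg 3) (10 <- reg 19) ;;
  11 <- HAdd (reg 10) (HC 1) ;;
  27 <- HMul (HMul (HC 8) (HMul (reg 2) (HMul (reg 2) (reg 2)))) (reg 24).

Definition init_prog :=
  HFor 23 2 (HSet 5 (HAdd (reg 2) (reg 23)) (HC 1) ;; HSet 6 (HAdd (reg 2) (reg 23)) (HC 1)) ;;
  HFor 23 3 (HSet 9 (reg 23) (HC 1)).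

Definition setup_prog E := 3 <- HMul (HC 2) (reg 2) ;; graph_prog ;; exponent_prog ;;
  degree_prog ;; param_prog E ;; init_prog.

Variables (n : nat) (G : bigraph n).
Hypothesis n_gt0 : 0 < n.
Local Notation N := (2 * n).
Local Notation vtx := (vtx n_gt0).
Variables (inp : nat -> nat) (b W : nat).
Hypothesis b_gt1 : 1 < 2 ^ b.
Hypothesis N_W : N <= W.
Hypothesis W_lt : W < 2 ^ b.
Hypothesis inp_entry : forall i j : 'I_n, inp (2 * (i * n + j) + 1) = G i j.

Let b_gt0 : 0 < 2 ^ b. Proof. exact: ltnW. Qed.
Let n_W : n <= W. Proof. by apply: leq_trans N_W; lia. Qed.

Lemma wp_graph Q st : st 2 0 = n -> st 3 0 = N ->
  (forall st', (forall k, k \notin writes graph_prog -> st' k =1 st k) ->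
     graph_env G n_gt0 st' -> Q st') ->
  wp inp b W graph_prog Q st.
Proof.
move=> e2 e3 hQ.
apply: (@wp_for _ _ _ _ _ _ _ _ (fun i st' => forall u w, u < i -> w < N ->
  st' 4 (u * N + w) = adj G (vtx u) (vtx w))) => //.
- by rewrite e3.
- move=> i st1 il h1 ei f1; rewrite e3 in il.
  apply: (@wp_for _ _ _ _ _ _ _ _ (fun j st' =>
    (forall u w, u < i -> w < N -> st' 4 (u * N + w) = adj G (vtx u) (vtx w)) /\
    (forall w, w < j -> st' 4 (i * N + w) = adj G (vtx i) (vtx w)))) => //.
  + by rewrite f1 // e3.
  + move=> j st2 jl [h2 h3] ej f2; rewrite f1 // e3 in jl.
    have g2 : st2 2 0 = n by rewrite f2 // f1.
    have g3 : st2 3 0 = N by rewrite f2 // f1.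
    have g23 : st2 23 0 = i by rewrite f2.
    have next st3 (v : nat) : (forall k, k \notin [:: 29] -> st3 k =1 st2 k) -> v = adj G (vtx i) (vtx j) ->
        st3 29 0 = v -> wp inp b W (HSet 4 (HAdd (HMul (reg 23) (reg 3)) (reg 14)) (reg 29))
          (fun st'' => (forall u w, u < i -> w < N ->
               upd st'' 14 0 j.+1 4 (u * N + w) = adj G (vtx u) (vtx w)) /\
            (forall w, w < j.+1 -> upd st'' 14 0 j.+1 4 (i * N + w) = adj G (vtx i) (vtx w))) st3.
      move=> f3 -> h29; rewrite wpE /= h29 !f3 // g3 g23 ej; split.
        by case: (adj _ _ _).
      split=> [u w ui wN|w]; rewrite ?updE /= f3 //.
        have -> : u * N + w == i * N + j = false; last exact: h2.
        apply/negbTE; apply: contraTneq ui => /(congr1 (fun z => z %/ N)).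
        by rewrite !divnMDl ?muln_gt0 ?n_gt0 // !divn_small // !addn0 => ->; rewrite ltnn.
      rewrite ltnS leq_eqVlt => /orP[/eqP ->|wj]; first by rewrite eqxx.
      have -> : i * N + w == i * N + j = false by rewrite eqn_add2l (ltn_eqF wj).
      exact: h3.
    have out k (v : nat) : k \notin [:: 29] -> upd st2 29 0 v k =1 st2 k.
      by move=> kk x; rewrite (upd_out _ _ _ _ _ kk).
    have ordE u v : u < n -> n <= v < N ->
        inp (2 * (u * n + (v - n)) + 1) = adj G (vtx u) (vtx v).
      move=> un /andP[nv vN]; rewrite /vtx un ltnNge nv /= -inp_entry /= modn_small //.
      by rewrite -{2}(subnK nv) modnDr modn_small //; lia.
    rewrite wp_seqE !wp_ifE /= g2 g23 ej !subn_eq0.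
    case: (leqP n i) => hi; case: (leqP n j) => hj; rewrite wpE /= ?g2 ?g23 ?ej.
    * split; first exact: b_gt0.
      apply: (next _ 0); [by move=> k; exact: out| |by []].
      have -> : vtx i = inr (ord_of n_gt0 i) by rewrite /vtx ltnNge hi.
      have -> : vtx j = inr (ord_of n_gt0 j) by rewrite /vtx ltnNge hj.
      exact: (erefl 0).
    * rewrite ordE ?hi //; split; first by case: (adj _ _ _).
      apply: (next _ (adj G (vtx j) (vtx i))); [by move=> k; exact: out| |by []].
      by rewrite (adj_sym G (vtx j)).
    * rewrite ordE ?hj //; split; first by case: (adj _ _ _).
      by apply: (next _ (adj G (vtx i) (vtx j))); [by move=> k; exact: out| |].
    * split; first exact: b_gt0.
      apply: (next _ 0); [by move=> k; exact: out| |by []].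
      by rewrite /vtx hi hj.
  + move=> st2 [h2 h3] f2; rewrite f1 // e3 in h3 => u w; rewrite updE /= ltnS leq_eqVlt.
    by case/orP=> [/eqP ->|ui] wN; [exact: h3 | exact: h2].
move=> st' h fr; rewrite e3 in h; apply: hQ => //.
by split; rewrite ?fr.
Qed.

Variable a : nat.
(* The truncation in cell [2 m + 2] is not 0 when [1 <= 2 ^ m alpha].  Stopping at
   [n <= 2 ^ m] bounds the running time in terms of n for every alpha. *)
Definition exponent_ok m := (n <= 2 ^ m) || (inp (2 * m + 2) != 0).
Hypothesis a_ok : exponent_ok a.
Hypothesis a_min : forall m, m < a -> ~~ exponent_ok m.
Hypothesis inp_exponent : forall m, m <= a -> inp (2 * m + 2) < 2 ^ b.

Lemma exponent_le : 2 ^ a <= N.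
Proof.
clear inp_exponent n_W b_gt0 b_gt1 N_W W_lt a_ok.
case: (posnP a) => [->|a0]; first by rewrite expn0; lia.
have := a_min (m := a.-1); rewrite prednK // leqnn => /(_ isT).
rewrite negb_or -ltnNge => /andP[h _]; rewrite -(prednK a0) expnS; lia.
Qed.

Lemma wp_exponent Q st : st 2 0 = n ->
  (forall st', (forall k, k \notin writes exponent_prog -> st' k =1 st k) ->
     st' 30 0 = 2 ^ a -> st' 31 0 = a -> Q st') ->
  wp inp b W exponent_prog Q st.
Proof.
move=> e2 hQ; rewrite /exponent_prog !wpE /=; split=> //; split=> //.
have aN := exponent_le.
have aW : a <= W by apply: leq_trans N_W; apply: leq_trans aN; exact/ltnW/ltn_expl.
apply: (@wp_for _ _ _ _ _ _ _ _ (fun j st' => exists m,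
   [/\ st' 30 0 = 2 ^ m, st' 31 0 = m, m <= a & m = a \/ m = j])) => //.
- by rewrite ?updE /= e2.
- by exists 0; rewrite ?updE /=; split=> //; right.
- move=> j st' jl [m [h30 h31 ma hm]] ej fr; rewrite ?updE /= e2 in jl.
  have f2 : st' 2 0 = n by rewrite fr // ?updE.
  have stop : exponent_ok m -> m = a.
    by move=> ok; apply/eqP; rewrite eqn_leq ma leqNgt /=; apply: contraL ok => /a_min.
  rewrite wp_ifE /= f2 h30 subn_eq0; case: leqP => hn.
    rewrite wpE; exists m; rewrite ?updE /=; split=> //; left.
    by apply: stop; rewrite /exponent_ok hn.
  rewrite !wpE /= h31; split; first exact: inp_exponent.
  rewrite wp_ifE /= ?updE /=; case: eqP => hz.
    have lt : m < a.
      rewrite ltn_neqAle ma andbT; apply: contraTneq a_ok => <-.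
      by rewrite /exponent_ok hz eqxx orbF -ltnNge.
    rewrite !wpE /= ?updE /= h30 h31; split.
      apply: leq_ltn_trans W_lt; apply: leq_trans N_W; apply: leq_trans aN.
      by rewrite -expnS leq_exp2l.
    split; first by apply: leq_ltn_trans W_lt; rewrite addn1; exact: leq_trans lt aW.
    exists m.+1; rewrite ?updE /= addn1 expnS; split=> //.
    by case: hm => [me|->]; [move: lt; rewrite me ltnn|right].
  rewrite wpE; exists m; rewrite ?updE /=; split=> //; left; apply: stop.
  by rewrite /exponent_ok; move/eqP: hz => ->; rewrite orbT.
move=> st' [m [h30 h31 ma hm]] fr; rewrite ?updE /= e2 in hm.
have ma' : m = a.
  case: hm => // mn; apply/eqP; rewrite eqn_leq ma leqNgt /=; apply/negP => /a_min.
  by rewrite /exponent_ok mn (ltnW (ltn_expl _ _)).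
apply: hQ; rewrite -?ma' // => k kk i.
by rewrite fr; [rewrite !(upd_out _ _ _ _ _ kk) | apply: notin_sub kk].
Qed.

Variables D dl : nat.
Hypothesis row_degree_le : forall i : 'I_n, #|[set j | adj G (inl i) j]| <= D.
Hypothesis row_degree_max : exists i : 'I_n, #|[set j | adj G (inl i) j]| = D.
Hypothesis D_le : D <= 2 ^ dl.
Hypothesis dl_min : forall m, m < dl -> 2 ^ m < D.

Lemma dl_le : 2 ^ dl <= N.
Proof.
clear inp_exponent n_W b_gt0 b_gt1 N_W W_lt a_ok a_min D_le.
case: (posnP dl) => [->|d0]; first by rewrite expn0; lia.
have : 2 ^ dl.-1 < D by apply: dl_min; rewrite prednK.
have [i <-] := row_degree_max.
have : #|[set j | adj G (inl i) j]| <= n.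
  rewrite -[leqRHS](card_is_col n); apply/subset_leq_card/fintype.subsetP => -[r|j];
    by rewrite !inE.
by rewrite -{2}(prednK d0) expnS; lia.
Qed.

(** The running count grows by at most 1 per matrix entry, so a single doubling per entry restores
    the power of 2. *)
Lemma wp_degree Q st : graph_env G n_gt0 st ->
  (forall st', (forall k, k \notin writes degree_prog -> st' k =1 st k) ->
     st' 21 0 = dl -> Q st') ->
  wp inp b W degree_prog Q st.
Proof.
move=> [e2 e3 e4] hQ; rewrite /degree_prog !wpE /=; split=> //; split=> //.
pose cnt i m := \sum_(w < m) adj G (vtx i) (vtx w).
have dN := dl_le.
have cntE i : i < n -> cnt i N = #|[set j | adj G (inl (ord_of n_gt0 i)) j]|.
  move=> iN; rewrite -sum1dep_card big_mkcond /= (reindex (fun w : 'I_N => vtx w)) /=.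
    by apply: eq_bigr => w _; rewrite {1}/vtx iN; case: (vtx w) => //= j; case: (G _ _).
  exists (fun v => Ordinal (vidx_lt n_gt0 v)) => [w _|v _]; last by rewrite vidxK.
  by apply: val_inj; rewrite /= vtxK.
have cntD i : i < n -> cnt i N <= D by move=> iN; rewrite cntE.
have cnt_mono i m k : m <= k -> cnt i m <= cnt i k.
  move=> mk; rewrite /cnt (big_ord_widen k (fun w => nat_of_bool (adj G (vtx i) (vtx w))) mk).
  by rewrite big_mkcond leq_sum // => w _; case: ifP.
apply: (@wp_for _ _ _ _ _ _ _ _ (fun i st' => exists m,
   [/\ st' 20 0 = 2 ^ m, st' 21 0 = m, m <= dl & forall u, u < i -> cnt u N <= 2 ^ m])) => //.
- by rewrite ?updE /= e2.
- by exists 0; rewrite ?updE.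
- move=> i st1 il [m0 [h20 h21 md hu]] ei f1; rewrite ?updE /= e2 in il.
  have g1 k : k \notin writes degree_prog -> st1 k =1 st k.
    by move=> kk x; rewrite f1; [rewrite !(upd_out _ _ _ _ _ kk) | apply: notin_sub kk].
  rewrite !wpE /=; split=> //.
  apply: (@wp_for _ _ _ _ _ _ _ _ (fun w st' => exists m,
   [/\ st' 20 0 = 2 ^ m, st' 21 0 = m, m <= dl,
       forall u, u < i -> cnt u N <= 2 ^ m & st' 19 0 = cnt i w /\ cnt i w <= 2 ^ m])) => //.
  + by rewrite ?updE /= g1 // e3.
  + by exists m0; rewrite ?updE /= /cnt big_ord0; split.
  + move=> w st2 wl [m [k20 k21 kd ku [k19 kw]]] ew f2; rewrite ?updE /= g1 // e3 in wl.
    have g2 k : k \notin writes degree_prog -> st2 k =1 st k.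
      by move=> kk x; rewrite f2; [rewrite !(upd_out _ _ _ _ _ kk) // g1 | apply: notin_sub kk].
    have i23 : st2 23 0 = i by rewrite f2 // ?updE.
    have iN : i < N by lia.
    have next : st2 19 0 + st2 4 (i * N + w) = cnt i w.+1.
      by rewrite k19 g2 // e4 // /cnt big_ord_recr.
    have cD : cnt i w.+1 <= D by apply: leq_trans (cntD i il); exact: cnt_mono.
    have Db : cnt i w.+1 < 2 ^ b.
      by apply: leq_ltn_trans W_lt; apply: leq_trans N_W; apply: leq_trans cD (leq_trans D_le dN).
    have step1 : cnt i w.+1 <= (2 ^ m).+1.
      by rewrite /cnt big_ord_recr /= -/(cnt i w); case: (adj _ _ _); lia.
    have k3 : st2 3 0 = N by rewrite g2.
    rewrite !wpE /= i23 ew k3 next; split=> //.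
    rewrite wp_ifE /= ?updE /= k20 subn_eq0; case: leqP => hc.
      by rewrite wpE; exists m; rewrite ?updE /=; split.
    have lt : m < dl.
      rewrite ltnNge; apply: contraTN (leq_trans hc cD) => h; rewrite -leqNgt.
      by apply: leq_trans D_le _; rewrite leq_exp2l.
    rewrite !wpE /= ?updE /= k20 k21 -expnS addn1; split.
      apply: leq_ltn_trans W_lt; apply: leq_trans N_W; apply: leq_trans dN.
      by rewrite leq_exp2l.
    split.
      apply: leq_ltn_trans W_lt; apply: leq_trans N_W; apply: leq_trans dN.
      by apply: leq_trans lt (ltnW (ltn_expl _ _)).
    have m2 : 2 ^ m <= 2 ^ m.+1 by rewrite leq_exp2l.
    have m3 : (2 ^ m).+1 <= 2 ^ m.+1 by rewrite ltn_exp2l.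
    exists m.+1; rewrite ?updE /=; split=> //; last by split=> //; exact: leq_trans step1 m3.
    by move=> u ui; apply: leq_trans (ku u ui) m2.
  move=> st2 [m [k20 k21 kd ku [_ kw]]] f2; rewrite ?updE /= g1 // e3 in kw.
  exists m; rewrite ?updE /=; split=> // u; rewrite ltnS leq_eqVlt.
  by case/orP=> [/eqP ->|]; [exact: kw | exact: ku].
move=> st' [m [h20 h21 md hu]] fr; rewrite ?updE /= e2 in hu; apply: hQ.
  by move=> k kk i; rewrite fr; [rewrite !(upd_out _ _ _ _ _ kk) | apply: notin_sub kk].
rewrite h21; apply/eqP; rewrite eqn_leq md leqNgt /=; apply/negP => /dl_min.
have [i iD] := row_degree_max; have := hu i (ltn_ord i); rewrite cntE //.
have -> : ord_of n_gt0 i = i by apply: val_inj; rewrite /= modn_small.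
by rewrite iD => h; rewrite ltnNge h.
Qed.

Variable E : nat.
Local Notation L := dl.+1.
Local Notation J := (E + a + L + 1).
Local Notation s := (scale a L E J).
Local Notation T := (depth n a L E J).
Local Notation I := (8 * n ^ 3 * s ^ 2).
Hypothesis small : forall v, v <= N * (I + 3) + 2 * s + 1 -> v < 2 ^ b.
Hypothesis s_small : s ^ 2 < 2 ^ b.
Hypothesis E_gt0 : 0 < E.

Lemma wp_param Q st : st 2 0 = n -> st 3 0 = N -> st 30 0 = 2 ^ a -> st 31 0 = a ->
  st 21 0 = dl ->
  (forall st', (forall k, k \notin writes (param_prog E) -> st' k =1 st k) ->
     st' 10 0 = T -> st' 11 0 = T.+1 -> st' 24 0 = s ^ 2 -> st' 27 0 = I -> Q st') ->
  wp inp b W (param_prog E) Q st.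
Proof.
move=> e2 e3 e30 e31 e21 hQ.
have sE : 20 * E * (2 ^ a * L) * J = s by [].
have ss : s <= s ^ 2 by rewrite -mulnn leq_pmull // /scale !muln_gt0 expn_gt0 E_gt0 addn1.
have Js : 20 * J <= s.
  have z0 : 0 < E * (2 ^ a * L) by rewrite !muln_gt0 E_gt0 expn_gt0.
  have -> : s = (E * (2 ^ a * L)) * (20 * J) by rewrite /scale; ring.
  by rewrite leq_pmull.
have Jb : J < 2 ^ b by apply: leq_ltn_trans s_small; apply: leq_trans ss; apply: leq_trans Js; lia.
have Lb : L < 2 ^ b by apply: leq_ltn_trans Jb; lia.
have sb : s < 2 ^ b by apply: leq_ltn_trans s_small.
have tb : 20 * s * J < 2 ^ b.
  apply: leq_ltn_trans s_small; rewrite -mulnA mulnCA -mulnn leq_mul2l.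
  by rewrite Js orbT.
have Tb : T.+1 < 2 ^ b.
  apply: small; apply: leq_trans (_ : N + 1 <= _); first by rewrite (addn1 N) ltnS geq_minr.
  rewrite leq_add2r; apply: (@leq_trans (N * (I + 3))); last exact: leq_addr.
  by rewrite leq_pmulr // addn3.
have Ib : I < 2 ^ b.
  apply: small; apply: (@leq_trans (N * (I + 3))).
    by apply: (@leq_trans (I + 3)); [exact: leq_addr | rewrite leq_pmull //; lia].
  exact: leq_trans (leq_addr _ _) (leq_addr _ _).
rewrite /param_prog !wpE /= e21 (addn1 dl); split=> //.
rewrite ?updE /= e31; split=> //.
rewrite ?updE /= e30; split; first by rewrite sE.
rewrite ?updE /= sE mulnn; split=> //.
rewrite ?updE /=; split=> //.
rewrite wp_ifE /= ?updE /= e3 subn_eq0.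
have nnn : 8 * (n * (n * n)) * s ^ 2 = I by rewrite !expnS expn0; ring.
case: leqP => hT; rewrite !wpE /= ?updE /=.
  split; first exact: tb.
  have TE : T = 20 * s * J by rewrite /depth (minn_idPl hT).
  rewrite -TE (addn1 T); split=> //; rewrite ?updE /= e2 nnn; split=> //.
  apply: hQ; rewrite ?updE //= => k kk i; rewrite !(upd_out _ _ _ _ _ kk) //.
rewrite e3; split; first by apply: leq_ltn_trans W_lt.
have TE : T = N by rewrite /depth (minn_idPr (ltnW hT)).
rewrite -TE (addn1 T); split=> //; rewrite ?updE /= e2 nnn; split=> //.
apply: hQ; rewrite ?updE //= => k kk i; rewrite !(upd_out _ _ _ _ _ kk) //.
Qed.

Lemma wp_init Q st : st 2 0 = n -> st 3 0 = N ->
  (forall st', (forall k, k \notin writes init_prog -> st' k =1 st k) ->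
     columns n (fun=> 1) st' -> (forall u, u < N -> st' 9 u = 1) -> Q st') ->
  wp inp b W init_prog Q st.
Proof.
move=> e2 e3 hQ; rewrite /init_prog wp_seqE.
apply: (@wp_for _ _ _ _ _ _ _ _ (fun j st' =>
   forall w, n <= w < n + j -> st' 5 w = 1 /\ st' 6 w = 1)) => //.
- by rewrite e2.
- by move=> w; lia.
- move=> j st' jl h ej fr; rewrite e2 in jl.
  have f2 : st' 2 0 = n by rewrite fr.
  rewrite !wpE /= f2 ej; split=> //; split=> // w; rewrite ?updE /= f2 ej.
  have [->|ne] := eqVneq w (n + j); first by [].
  by move=> hw; apply: h; move: hw ne; lia.
move=> st1 h1 f1; rewrite e2 in h1.
apply: (@wp_for _ _ _ _ _ _ _ _ (fun j st' => forall u, u < j -> st' 9 u = 1)) => //.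
- by rewrite f1 // e3.
- move=> j st' jl h ej fr; rewrite !wpE /= ej; split=> // u; rewrite ?updE /=.
  by rewrite ltnS leq_eqVlt; case: eqP => //= _; exact: h.
move=> st2 h2 f2; rewrite f1 // e3 in h2; apply: hQ => //.
- by move=> k kk i; rewrite f2; [rewrite f1 //; apply: notin_sub kk | apply: notin_sub kk].
- by move=> w hw; rewrite !f2 //; apply: h1; move: hw; lia.
Qed.

Lemma wp_setup Q st : st 2 0 = n ->
  (forall st', search_env G n_gt0 T s st' -> st' 27 0 = I -> columns n (fun=> 1) st' ->
     (forall u, u < N -> st' 9 u = 1) -> Q st') ->
  wp inp b W (setup_prog E) Q st.
Proof.
move=> e2 hQ; rewrite /setup_prog !wpE /= e2; split; first exact: leq_ltn_trans W_lt.
apply: wp_graph => // st1 f1 g1; have [k2 k3 k4] := g1.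
rewrite wpE; apply: wp_exponent => // st2 f2 h30 h31.
have g2 : graph_env G n_gt0 st2.
  by apply: graph_env_frame g1 => k kk; apply: f2; move: kk; rewrite !inE => /or3P[] /eqP ->.
rewrite wpE; apply: wp_degree => // st3 f3 h21.
have g3 : graph_env G n_gt0 st3.
  by apply: graph_env_frame g2 => k kk; apply: f3; move: kk; rewrite !inE => /or3P[] /eqP ->.
have [m2 m3 m4] := g3.
rewrite wpE; apply: wp_param => //; rewrite ?f3 // => st4 f4 h10 h11 h24 h27.
apply: wp_init; rewrite ?f4 // => st5 f5 c5 a5; apply: hQ => //; last by rewrite f5.
split; rewrite ?f5 //.
by apply: graph_env_frame g3 => k kk i; rewrite f5 ?f4 //; move: kk; rewrite !inE => /or3P[] /eqP ->.
Qed.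

End Setup.

(** * Correctness and running time *)

(* For [n = 1] expansion says nothing, but the permanent is the only entry. *)
Definition main_prog E := HLoad 2 (HC 0) ;;
  HIf (HSub (reg 2) (HC 1)) (setup_prog E ;; search_prog ;; output_prog)
    (HLoad 0 (HC 1) ;; 1 <- HC 1).

Section Encoding.
Variables (R : realType) (n : nat) (alpha : R) (G : bigraph n).
Hypothesis alpha_gt0 : 0 < alpha.
Local Notation inp := (encode alpha G).

Lemma entryE (i j : 'I_n) : entry G i j = G i j.
Proof.
rewrite /entry; congr nat_of_bool; apply/existsP/idP => [[x /existsP[y]]|Gij].
  by move=> /and3P[/eqP/val_inj -> /eqP/val_inj ->].
by exists i; apply/existsP; exists j; rewrite !eqxx.
Qed.

Lemma encode_entry (i j : 'I_n) : inp (2 * (i * n + j) + 1)%N = G i j.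
Proof.
rewrite addn1 /encode mul2n odd_double doubleK.
have n0 : (0 < n)%N by apply: leq_ltn_trans (ltn_ord i).
by rewrite divnMDl // modnMDl modn_small // divn_small // addn0 entryE.
Qed.

Lemma encode_exponent m : inp (2 * m + 2)%N = Num.truncn (2 ^+ m * alpha).
Proof. by rewrite addnS addn1 /encode /= mul2n odd_double /= uphalf_double. Qed.

Hypothesis n_gt1 : (1 < n)%N.
Hypothesis expG : expander alpha G.

Lemma side_V (A : {set node n}) :
  A \subset [set v | is_row v] \/ A \subset [set v | ~~ is_row v] ->
  A \subset V1 n \/ A \subset V2 n.
Proof.
case=> /fintype.subsetP h; [left|right]; apply/fintype.subsetP => -[i|i] /h; rewrite inE //= => _.
  exact: imset_f.
exact: imset_f.
Qed.

Lemma expander_nbrs (A : {set node n}) :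
  A \subset [set v | is_row v] \/ A \subset [set v | ~~ is_row v] ->
  (#|A|.*2 <= n)%N -> (1 + alpha) * #|A|%:R <= #|nbrs (adj G) A|%:R.
Proof.
move=> /side_V sA hA; apply: expG => //.
by rewrite ler_pdivlMr // -natrM ler_nat muln2.
Qed.

(** If the truncation is not 0, then alpha >= 2 ^ -a. If instead n <= 2 ^ a, integrality suffices: A
    has at least one neighbour more than elements, and 1 is at least #|A| / 2 ^ a. *)
Lemma expander_exponent a (A : {set node n}) : exponent_ok n inp a ->
  A \subset [set v | is_row v] \/ A \subset [set v | ~~ is_row v] ->
  (#|A|.*2 <= n)%N -> ((2 ^ a).+1 * #|A| <= 2 ^ a * #|nbrs (adj G) A|)%N.
Proof.
move=> ok sA hA; have h := expander_nbrs sA hA.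
have A0 : 0 <= #|A|%:R :> R by [].
have K0 : (0 : R) < 2 ^+ a by rewrite exprn_gt0.
case/orP: ok => [na|].
  have [->|Apos] := posnP #|A|; first by rewrite muln0.
  have : (#|A| < #|nbrs (adj G) A|)%N.
    rewrite -(ltr_nat R); apply: lt_le_trans h.
    by rewrite ltr_pMl ?ltr0n // ltrDl.
  by move=> lt; move: (2 ^ a)%N na hA lt => z; nia.
rewrite encode_exponent -lt0n truncn_gt0 => ha.
rewrite -(ler_nat R) !natrM -natr1 natrX.
have := ler_wpM2l (ltW K0) h; have := ler_wpM2r A0 ha.
lra.
Qed.

Lemma node_nbr (v : node n) : exists w, adj G v w.
Proof.
have sA : [set v] \subset [set u : node n | is_row u] \/
    [set v] \subset [set u : node n | ~~ is_row u].
  by rewrite !finset.sub1set !inE; case: (is_row v); [left|right].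
have := expander_nbrs sA; rewrite cards1 mulr1 => /(_ n_gt1) h.
have /card_gt0P[w] : (0 < #|nbrs (adj G) [set v]|)%N.
  by rewrite -(ltr0n R); apply: lt_le_trans h; rewrite ltr_pwDl // ltW.
by move=> /nbrsP[u]; rewrite inE => /eqP -> vw; exists w.
Qed.

(** A set of n./2 rows has at most n <= 3 n./2 neighbours. The bound limits the length of the
    truncations that are read and settles exponent 0 in [pow_exponent_le]. *)
Lemma alpha_le2 : alpha <= 2.
Proof.
have : (n./2 <= #|[set v : node n | is_row v]|)%N by rewrite card_is_row; lia.
case/card_geqP => l [ul sl lA]; pose A := [set x in l].
have cA : #|A| = n./2 by rewrite cardsE -sl; apply/card_uniqP.
have sA : A \subset [set v : node n | is_row v].
  by apply/fintype.subsetP => x xA; apply: lA; move: xA; rewrite inE.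
have hA : (#|A|.*2 <= n)%N by rewrite cA; lia.
have := expander_nbrs (or_introl sA) hA; rewrite cA.
have : (#|nbrs (adj G) A| <= 3 * n./2)%N.
  apply: (@leq_trans n); last lia.
  apply: leq_trans (eq_leq (card_is_col n)); apply: subset_leq_card.
  exact: (nbrs_cols (@adj_row _ G)).
rewrite -(ler_nat R) natrM => h1 h2; have := le_trans h2 h1.
by rewrite ler_pM2r ?ltr0n; [lra | lia].
Qed.

Lemma ex_exponent : exists m, exponent_ok n inp m.
Proof. by exists n; rewrite /exponent_ok ltnW // ltn_expl. Qed.

Definition exponent := ex_minn ex_exponent.

Lemma exponent_okP : exponent_ok n inp exponent.
Proof. by rewrite /exponent; case: ex_minnP. Qed.

Lemma exponent_min m : (m < exponent)%N -> ~~ exponent_ok n inp m.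
Proof.
rewrite /exponent; case: ex_minnP => a _ amin ma; apply/negP => /amin.
by rewrite leqNgt ma.
Qed.

(** At the previous exponent the truncation is still 0, so 2 ^ exponent exceeds 1 / alpha by a
    factor 2 at most. *)
Lemma pow_exponent_le : (2 ^+ exponent : R) <= 2 / alpha.
Proof.
have [->|e0] := posnP exponent.
  by rewrite expr0 ler_pdivlMr // mul1r alpha_le2.
have := exponent_min (m := exponent.-1); rewrite prednK // leqnn => /(_ isT).
rewrite negb_or => /andP[_]; rewrite negbK encode_exponent -leqn0 leqNgt truncn_gt0 -ltNge => h.
by rewrite -(prednK e0) exprS ler_pM2l // -[leRHS]mul1r ler_pdivlMr // ltW.
Qed.

Definition max_row_degree := (\max_(i < n) #|[set j | adj G (inl i) j]|)%N.

Lemma row_degree_le_max (i : 'I_n) : (#|[set j | adj G (inl i) j]| <= max_row_degree)%N.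
Proof. exact: (leq_bigmax i). Qed.

Lemma max_row_degree_attained : exists i : 'I_n, #|[set j | adj G (inl i) j]| = max_row_degree.
Proof.
have n0 : (0 < #|'I_n|)%N by rewrite card_ord ltnW.
have [i iP] : {i : 'I_n | max_row_degree = #|[set j | adj G (inl i) j]|}.
  exact: bigop.eq_bigmax.
by exists i.
Qed.

Lemma max_row_degree_gt0 : (0 < max_row_degree)%N.
Proof.
have [i <-] := max_row_degree_attained; have [w vw] := node_nbr (inl i).
by apply/card_gt0P; exists w; rewrite inE.
Qed.

Lemma ex_degree_log : exists m, (max_row_degree <= 2 ^ m)%N.
Proof. by exists max_row_degree; exact/ltnW/ltn_expl. Qed.

Definition degree_log := ex_minn ex_degree_log.

Lemma degree_logP : (max_row_degree <= 2 ^ degree_log)%N.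
Proof. by rewrite /degree_log; case: ex_minnP. Qed.

Lemma degree_log_min m : (m < degree_log)%N -> (2 ^ m < max_row_degree)%N.
Proof.
rewrite /degree_log; case: ex_minnP => a _ amin ma; rewrite ltnNge; apply/negP => /amin.
by rewrite leqNgt ma.
Qed.

Variable E : nat.
Hypothesis E_gt1 : (1 < E)%N.
Local Notation a := exponent.
Local Notation L := degree_log.+1.
Local Notation J := (E + a + L + 1)%N.
Local Notation s := (scale a L E J).
Local Notation T := (depth n a L E J).
Local Notation I := (8 * n ^ 3 * s ^ 2)%N.
Local Notation N := (2 * n)%N.
Local Notation c0 := (N * (I + 3) + 2 * s + 1)%N.

Definition word_bound := bits n c0 T.+1.
Definition loop_bound := (N ^ T.+1 + I)%N.

Let n_gt0 : (0 < n)%N. Proof. exact: ltnW. Qed.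
Let J_gt : (E + a + L < J)%N. Proof. by rewrite addn1. Qed.
Let s_gt0 : (0 < s)%N. Proof. exact: scale_gt0. Qed.

Let c0_le (v : nat) : (v <= c0)%N -> (v < 2 ^ word_bound)%N.
Proof.
move=> h; apply: leq_ltn_trans h _; apply: leq_trans (ltn_expl c0 (isT : 1 < 2)%N) _.
by rewrite leq_exp2l // /word_bound /bits leq_pmulr // expn_gt0.
Qed.

Let I_lt_c0 : (I < c0)%N.
Proof.
rewrite (addn1 (_ + 2 * s)) ltnS; apply: (@leq_trans (N * (I + 3))); last exact: leq_addr.
by apply: (@leq_trans (I + 3)); [exact: leq_addr | rewrite leq_pmull // muln_gt0].
Qed.

Lemma loop_bound_lt : (loop_bound < 2 ^ word_bound)%N.
Proof.
apply: leq_trans (ltn_expl _ (isT : 1 < 2)%N) _; rewrite leq_exp2l // /loop_bound /word_bound /bits.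
have : (N ^ T.+1 <= N.+2 ^ T.+1)%N by rewrite leq_exp2r // leqW.
have : (0 < N.+2 ^ T.+1)%N by rewrite expn_gt0.
by move: I_lt_c0; move: I c0 (N ^ _)%N (N.+2 ^ _)%N => u v x y; nia.
Qed.

Lemma wp_main_prog (eps : R) : 0 < eps -> expR (6 / E%:R) <= 1 + eps ->
  wp inp word_bound loop_bound (main_prog E) (fun st => st 1%N 0%N != 0%N /\
    approximates eps G ((st 0%N 0%N)%:R / (st 1%N 0%N)%:R)) (fun _ _ => 0%N).
Proof.
move=> eps0 hE; rewrite /main_prog !wpE /=.
have nc0 : (n <= c0)%N.
  apply: leq_trans (leq_trans (leq_addr _ _) (leq_addr _ _)).
  by apply: (@leq_trans N); [rewrite leq_pmull | rewrite leq_pmulr // addn3].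
have Nc0 : (N <= c0)%N.
  apply: leq_trans (leq_trans (leq_addr _ _) (leq_addr _ _)).
  by rewrite leq_pmulr // addn3.
have N_W : (N <= loop_bound)%N.
  apply: leq_trans (leq_addr _ _); rewrite expnS leq_pmulr // expn_gt0.
  by rewrite muln_gt0 n_gt0.
have word_W : (N ^ T.+1 <= loop_bound)%N by exact: leq_addr.
have T_W : (T < loop_bound)%N.
  apply: leq_trans word_W; apply: leq_trans (ltnW (ltn_expl T.+1 (isT : 1 < 2)%N)) _.
  by rewrite leq_exp2r //; lia.
have s2I : (s ^ 2 <= I)%N.
  by rewrite leq_pmull // muln_gt0 expn_gt0 n_gt0.
have b1 : (1 < 2 ^ word_bound)%N by apply: leq_ltn_trans (c0_le nc0).
have row_nbr (i : node n) : is_row i -> exists j, adj G i j by move=> _; exact: node_nbr.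
have s2 : 2 <= s%:R :> R by rewrite ler_nat; apply: leq_trans (scale_ge20 _ _ _ _).
have E0 : (0 < E)%N by exact: ltnW.
have ER : (0 : R) < E%:R by rewrite ltr0n.
have eta01 : 0 <= (E%:R^-1 : R) <= 1.
  by rewrite invr_ge0 ltW //= invf_le1 // ler1n.
have D_L : (max_row_degree.+1 <= 2 ^ L)%N.
  by have := degree_logP; rewrite expnS; have := max_row_degree_gt0; lia.
have hD (i : node n) : is_row i -> (#|[set j | adj G i j]| <= max_row_degree)%N.
  by case: i => // i _; exact: row_degree_le_max.
have hexp := fun A => @expander_exponent a A exponent_okP.
have per0 : (0 < permanent G)%N.
  exact: (permanent_gt0 n_gt1 hexp hD).
have acc (x : node n -> R) (hx : forall v, 0 < x v) :=
  depth_accurate n_gt1 E_gt1 (ltn0Sn degree_log) J_gt row_nbr hx.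
split; first exact: c0_le.
rewrite wp_ifE /= ?updE /= subn_eq0 leqNgt n_gt1 /=.
rewrite !wpE; apply: (@wp_setup n G n_gt0 inp word_bound loop_bound b1 N_W
  loop_bound_lt encode_entry a exponent_okP exponent_min _ max_row_degree degree_log
  row_degree_le_max max_row_degree_attained degree_logP degree_log_min E) => //.
- move=> m ma; apply: c0_le; rewrite encode_exponent.
  apply: (@leq_trans I); last exact: ltnW.
  have m2 : (2 ^ m <= 2 * n)%N.
    apply: leq_trans (exponent_le n_gt0 exponent_min); by rewrite leq_exp2l.
  rewrite -(ler_nat R); apply: le_trans (_ : 2 ^+ m * alpha <= _).
    by rewrite truncn_le mulr_ge0 ?exprn_ge0 // ltW.
  apply: (@le_trans _ _ ((2 * n)%:R * 2)).
    by rewrite ler_pM ?exprn_ge0 ?(ltW alpha_gt0) ?alpha_le2 // -natrX ler_nat.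
  rewrite -natrM ler_nat; have : (0 < s ^ 2)%N by rewrite expn_gt0 s_gt0.
  have : (n <= n ^ 3)%N by rewrite -{1}(expn1 n) leq_pexp2l.
  by move: (n ^ 3)%N (s ^ 2)%N => x y; nia.
- by apply: c0_le; apply: leq_trans s2I _; exact: ltnW.
move=> st1 env1 h27 c1 a1; rewrite wpE.
have bits_b : (bits n c0 T.+1 <= word_bound)%N by [].
have I_W : (I <= loop_bound)%N by exact: leq_addl.
apply: (wp_search inp loop_bound_lt word_W T_W bits_b s_gt0 row_nbr
   s2 eta01 acc per0 (leqnn I) I_W env1 h27 c1 a1) => st2 f2 [X [X0 XI cX tX hX]].
have env2 : search_env G n_gt0 T s st2.
  apply: search_env_frame env1 => k kk; apply: f2.
  by move: kk; rewrite !inE; do ![case/orP]; move=> /eqP ->.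
have hx (v : node n) : 0 < col_weights R X v by exact: col_weights_gt0.
have hc := wts_gt0 s2 row_nbr hx.
apply: (wp_output inp loop_bound_lt word_W T_W bits_b s_gt0 row_nbr X0 XI env2 cX).
- by move=> u uN; rewrite f2 // a1.
- move=> i A; case: (T) => [|t] /=; rewrite invr_gt0; first exact: hc.
  by apply: trunc_den_gt0.
move=> st3 q0 qE; split=> //; rewrite qE.
exact: (estimate_approximates n_gt1 E_gt1 (ltn0Sn degree_log) J_gt row_nbr hexp hD D_L
  max_row_degree_gt0 eps0 hE hx tX hX).
Qed.

Local Notation y := N.+2.

(* Five nested loops of less than [loop_bound] <= [c0 * y ^ T.+1] rounds, on numbers
   of at most [c0 * y ^ T.+1] bits, and [c0] = O([y ^ 10]). *)
Definition time_degree := (6 * T + 66)%N.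

Lemma exponent_small : (2 ^ a <= N)%N.
Proof. exact: (exponent_le n_gt0 exponent_min). Qed.

Lemma degree_log_small : (2 ^ degree_log <= N)%N.
Proof. exact: (dl_le n_gt0 max_row_degree_attained degree_log_min). Qed.

Lemma scale_poly : (s <= 80 * E * (E + 5) * n ^ 3)%N.
Proof.
have aN := exponent_small; have dN := degree_log_small.
have a1 : (a < 2 ^ a)%N by exact: ltn_expl.
have d1 : (degree_log < 2 ^ degree_log)%N by exact: ltn_expl.
have JE : (J <= (E + 5) * n)%N by nia.
have -> : (80 * E * (E + 5) * n ^ 3 = 20 * E * (N * N) * ((E + 5) * n))%N by ring.
rewrite /scale; apply: leq_mul JE; rewrite leq_mul2l; apply/orP; right.
by apply: leq_mul => //; lia.
Qed.

Lemma c0_poly : (c0 <= 25 * (80 * E * (E + 5)) ^ 2 * y ^ 10)%N.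
Proof.
have sE := scale_poly; set F := (80 * E * (E + 5))%N in sE *.
have F0 : (0 < F)%N by rewrite /F !muln_gt0; move: E_gt1; lia.
have I1 : (I <= 8 * F ^ 2 * n ^ 9)%N.
  have -> : (8 * F ^ 2 * n ^ 9 = 8 * n ^ 3 * (F * n ^ 3) ^ 2)%N by ring.
  by rewrite leq_mul2l leq_exp2r // sE orbT.
have p k : (k <= 10)%N -> (n ^ k <= n ^ 10)%N by move=> k10; rewrite leq_pexp2l.
have F2 : (F <= F ^ 2)%N by rewrite -mulnn leq_pmull.
have F1 : (0 < F ^ 2)%N by rewrite expn_gt0 F0.
have n10 : (0 < n ^ 10)%N by rewrite expn_gt0 n_gt0.
have h1 : (N * (I + 3) <= 22 * (F ^ 2 * n ^ 10))%N.
  apply: (@leq_trans (N * (8 * F ^ 2 * n ^ 9 + 3))); first by rewrite leq_mul2l leq_add2r I1 orbT.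
  have e1 : (N * (8 * F ^ 2 * n ^ 9) = 16 * (F ^ 2 * n ^ 10))%N by ring.
  have e2 : (n <= F ^ 2 * n ^ 10)%N.
    by apply: leq_trans (leq_pmull _ F1); rewrite -{1}(expn1 n) p.
  by rewrite mulnDr e1; lia.
have h2 : (s <= F ^ 2 * n ^ 10)%N.
  by apply: leq_trans sE _; apply: leq_mul => //; exact: p.
apply: (@leq_trans (25 * (F ^ 2 * n ^ 10))); first lia.
by rewrite mulnA leq_mul2l leq_exp2r //; apply/orP; right; lia.
Qed.

Lemma cost_poly : (word_bound * loop_bound.+1 ^ 5 <=
  (25 * (80 * E * (E + 5)) ^ 2) ^ 6 * y ^ time_degree)%N.
Proof.
rewrite /time_degree.
have wb : (loop_bound.+1 <= word_bound)%N.
  rewrite /loop_bound /word_bound /bits.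
  have : (N ^ T.+1 < y ^ T.+1)%N by rewrite ltn_exp2r // ltnW.
  move: I_lt_c0; clear; move: I c0 (N ^ _)%N (y ^ _)%N => u v x z uv xz.
  have : (v + z <= (v * z).+1)%N by case: v z uv xz => [|v] [|z] //; lia.
  by lia.
apply: (@leq_trans (word_bound ^ 6)).
  by rewrite (expnS word_bound 5) leq_mul2l leq_exp2r // wb orbT.
have -> : (6 * T + 66 = (10 + T.+1) * 6)%N by lia.
rewrite expnM -expnMn leq_exp2r // expnD mulnA leq_mul2r.
by rewrite c0_poly orbT.
Qed.

Lemma depth_sq : (T%:R ^+ 2 : R) <= 40 ^+ 2 * E%:R * L%:R * J%:R ^+ 2 * (alpha^-1 * n%:R).
Proof.
have h : (T ^ 2 <= 2 * n * (20 * s * J))%N.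
  by rewrite -mulnn mulnC leq_mul // /depth ?geq_minl ?geq_minr.
have {}h : (T%:R ^+ 2 : R) <= (2 * n * (20 * s * J))%:R by rewrite -natrX ler_nat.
apply: le_trans h _.
rewrite /scale !natrM natrX.
have K2 := pow_exponent_le.
rewrite [leLHS](_ : _ = 800 * E%:R * L%:R * J%:R ^+ 2 * n%:R * 2 ^+ a); last by ring.
rewrite [leRHS](_ : _ = 800 * E%:R * L%:R * J%:R ^+ 2 * n%:R * (2 / alpha)); last by ring.
apply: ler_wpM2l K2; apply: mulr_ge0 (ler0n _ _).
apply: mulr_ge0; last by rewrite exprn_ge0 // ler0n.
by apply: mulr_ge0 (ler0n _ _); apply: mulr_ge0 (ler0n _ _); exact: ler0n.
Qed.

Let ln2_ge : 2^-1 <= ln (2 : R).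
Proof.
have := @ln_le_sub1 R 2^-1; rewrite lnV ?posrE // invr_gt0 => /(_ (ltr0n _ 2)); lra.
Qed.

Lemma log_small m : (2 ^ m <= N)%N -> m%:R <= 2 + 2 * ln (n%:R : R).
Proof.
move=> h; have n0 : (0 : R) < n%:R by rewrite ltr0n.
have : ln ((2 : R) ^+ m) <= ln (2 * n%:R).
  by rewrite ler_ln ?posrE ?exprn_gt0 ?mulr_gt0 // -natrX -natrM ler_nat.
rewrite lnXn // lnM ?posrE // -[ln 2 *+ m]mulr_natl.
have l2 : ln (2 : R) <= 1 by apply: le_trans (ln_le_sub1 _) _ => //; lra.
have : m%:R / 2 <= m%:R * ln 2 :> R by rewrite ler_wpM2l ?ler0n.
lra.
Qed.

(** With l = ln n, the product E L J ^ 2 is O(l ^ 4 / eps), so the depth is at most 400 S l ^ 2; the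
    third logarithm comes from the base [y]. Bounding E by l / eps, valid for large n, keeps the
    constant independent of eps. The 5000 is 6 * 400 * 2 = 4800 for the depth plus the lower order
    terms. *)
Lemma time_exponent (eps K : R) : 0 < eps -> 1 <= K ->
  E%:R + 6 + E%:R * eps + ln K + 2 * eps + 4 <= ln (n%:R : R) ->
  K * y%:R ^+ time_degree <=
  expR (5000 * (Num.sqrt (eps^-1 * alpha^-1 * n%:R) * ln n%:R ^+ 3)).
Proof.
rewrite /time_degree =>  eps0 K1; set l := ln n%:R => hl.
have n0 : (0 : R) < n%:R by rewrite ltr0n.
have E0 : (0 : R) < E%:R by rewrite ltr0n ltnW.
have lK : 0 <= ln K by rewrite ln_ge0.
have Ee : 0 <= E%:R * eps by rewrite mulr_ge0 // ltW.
have l1 : 1 <= l by lra.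
have l0 : 0 < l by lra.
set S := Num.sqrt _.
have S2 : S ^+ 2 = eps^-1 * alpha^-1 * n%:R.
  by rewrite sqr_sqrtr // !mulr_ge0 ?invr_ge0 // ltW.
have S0 : 0 <= S by exact: sqrtr_ge0.
have nl : l <= n%:R by apply: le_trans (ln_le_sub1 n0) _; lra.
have S1 : 1 <= S.
  rewrite -(ler_pXn2r (n := 2)) ?nnegrE // expr1n S2.
  have ea : eps * alpha <= n%:R.
    apply: le_trans (ler_wpM2l (ltW eps0) alpha_le2) _; lra.
  by rewrite -invfM mulrC ler_pdivlMr ?mulr_gt0 // mul1r.
have La : L%:R <= 3 * l :> R.
  by have := log_small degree_log_small; rewrite -/l -natr1; lra.
have Ja : J%:R <= 5 * l :> R.
  have := log_small degree_log_small; have := log_small exponent_small.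
  by rewrite -/l !natrD -natr1; lra.
have El : E%:R <= eps^-1 * l by rewrite ler_pdivlMl // mulrC; lra.
have l2 : 0 <= l ^+ 2 by apply: exprn_ge0; exact: ltW.
have e0 : 0 <= eps^-1 * l * l * l ^+ 2.
  by apply: mulr_ge0 l2; do 2![apply: mulr_ge0 (ltW l0)]; rewrite invr_ge0 ltW.
have Tl : T%:R <= 400 * (S * l ^+ 2).
  have r0 : 0 <= 400 * (S * l ^+ 2) by exact: mulr_ge0 (ler0n _ 400) (mulr_ge0 S0 l2).
  rewrite -(ler_pXn2r (n := 2)) ?nnegrE ?ler0n //.
  apply: le_trans depth_sq _.
  have -> : (400 * (S * l ^+ 2)) ^+ 2 =
      40 ^+ 2 * (100 * (eps^-1 * l * l * l ^+ 2)) * (alpha^-1 * n%:R).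
    rewrite [LHS](_ : _ = 40 ^+ 2 * 100 * l ^+ 4 * S ^+ 2); last by ring.
    by rewrite S2; ring.
  have an : 0 <= alpha^-1 * n%:R by rewrite mulr_ge0 ?invr_ge0 // ltW.
  apply: ler_wpM2r => //.
  have J2 : J%:R ^+ 2 <= 25 * l ^+ 2 :> R.
    have -> : 25 * l ^+ 2 = (5 * l) ^+ 2 by ring.
    by rewrite ler_pXn2r ?nnegrE ?ler0n // mulr_ge0 // ltW.
  have ELJ : E%:R * L%:R * J%:R ^+ 2 <= eps^-1 * l * (3 * l) * (25 * l ^+ 2).
    have EL0 : 0 <= E%:R * L%:R :> R by apply: mulr_ge0; exact: ler0n.
    apply: ler_pM EL0 (exprn_ge0 2 (ler0n _ _)) _ J2.
    by apply: ler_pM (ler0n _ _) (ler0n _ _) El La.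
  rewrite [leLHS](_ : _ = 40 ^+ 2 * (E%:R * L%:R * J%:R ^+ 2)); last by ring.
  apply: (ler_wpM2l (exprn_ge0 2 (ler0n _ 40))); apply: (le_trans ELJ).
  rewrite [leLHS](_ : _ = 75 * (eps^-1 * l * l * l ^+ 2)); last by ring.
  by apply: (ler_wpM2r e0); rewrite ler_nat.
have y0 : (0 : R) < y%:R by rewrite ltr0n.
have ly : ln (y%:R : R) <= 2 * l.
  have -> : 2 * l = ln (n%:R ^+ 2) by rewrite lnXn // mulr_natl.
  rewrite ler_ln ?posrE ?exprn_gt0 // -natrX ler_nat.
  have n4 : (4 <= n)%N by rewrite -(ler_nat R); lra.
  rewrite -mulnn; apply: (@leq_trans (n * 4)); last by rewrite leq_mul2l n4 orbT.
  by move: n4; clear; lia.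
have K0 : 0 < K by lra.
rewrite -[leLHS]lnK ?posrE ?mulr_gt0 ?exprn_gt0 // ler_expR lnM ?posrE ?exprn_gt0 // lnXn //.
rewrite -[_ *+ (6 * T + 66)]mulr_natl natrD natrM.
have l3 : l <= l ^+ 3.
  by rewrite -{1}(expr1 l) ler_weXn2l.
have Sl3 : l <= S * l ^+ 3.
  by apply: le_trans l3 _; rewrite ler_peMl // exprn_ge0 // ltW.
have Tl2 : T%:R * ln (y%:R : R) <= 800 * (S * l ^+ 3).
  apply: (@le_trans _ _ (T%:R * (2 * l))); first by rewrite ler_wpM2l ?ler0n.
  apply: (@le_trans _ _ (400 * (S * l ^+ 2) * (2 * l))).
    by apply: ler_wpM2r Tl; apply: mulr_ge0 (ltW l0).
  by rewrite [leLHS](_ : _ = 800 * (S * l ^+ 3)); [|ring].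
have : ln K <= l by lra.
rewrite mulrDl -mulrA; lra.
Qed.

(** Only the branch 20 s J of the minimum matters: 2 ^ a, L and J are bounded in terms of alpha and
    the degree, independently of n. *)
Lemma depth_bounded d : (max_degree G <= d)%N ->
  (T <= 400 * E * (Num.truncn (2 / alpha) * d.+1) * (E + Num.truncn (2 / alpha) + d + 2) ^ 2)%N.
Proof.
move=> hd; set A := Num.truncn _.
have a2 : (2 ^ a <= A)%N.
  rewrite /A truncn_ge_nat ?divr_ge0 ?(ltW alpha_gt0) // natrX.
  exact: pow_exponent_le.
have aA : (a <= A)%N by apply: leq_trans a2; exact/ltnW/ltn_expl.
have dd : (degree_log <= d)%N.
  have [->//|d0] := posnP degree_log.
  have := degree_log_min (m := degree_log.-1); rewrite prednK // leqnn => /(_ isT) h.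
  have md : (max_row_degree <= d)%N.
    apply: leq_trans hd; apply/bigmax_leqP => i _.
    exact: (leq_bigmax (inl i : node n)).
  have := ltn_expl degree_log.-1 (isT : 1 < 2)%N; move: (2 ^ _)%N h; lia.
have JJ : (J <= E + A + d + 2)%N by lia.
apply: (leq_trans (geq_minl _ _)); rewrite /scale.
have -> : (20 * (20 * E * (2 ^ a * L) * J) * J = 400 * E * (2 ^ a * L) * J ^ 2)%N by ring.
apply: leq_mul; last by rewrite leq_exp2r.
by rewrite leq_mul2l leq_mul ?orbT.
Qed.

End Encoding.

Lemma permanent1 (G : bigraph 1) : permanent G = entry G 0 0.
Proof.
rewrite (entryE G ord0 ord0) /permanent (big_pred1 1%g) => [|s].
  by rewrite big_ord1 perm1.
by apply/esym/eqP/permP => i; rewrite !ord1.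
Qed.

(** The precision enters the program only through the constant E, so K is uniform in all inputs.
    Registers 0 and 1 are the cells 0 and 1 of the machine, where the output is expected. *)
Lemma main_prog_runs E : (1 < E)%N -> exists K : nat,
  forall (R : realType) n (alpha eps : R) (G : bigraph n),
  (0 < n)%N -> 0 < alpha -> expander alpha G ->
  0 < eps -> expR (6 / E%:R) <= 1 + eps ->
  exists t p q, [/\ runs (cc (main_prog E)) (encode alpha G) t p q,
    approximates eps G (p%:R / q%:R)
    & (t <= K * (2 * n).+2 ^ time_degree alpha G E)%N].
Proof.
move=> E1; have okE : cok (main_prog E) by [].
have [K hK] := exec_wp okE.
pose F := (25 * (80 * E * (E + 5)) ^ 2)%N.
have F0 : (0 < F)%N by rewrite /F muln_gt0 expn_gt0 !muln_gt0; lia.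
have bounded0 b : bounded b (fun _ _ => 0%N) by move=> k i; rewrite expn_gt0.
exists (K * F ^ 6)%N => R n alpha eps G n0 alpha0 expG eps0 hE.
have lE : loops (main_prog E) = 5 by [].
move: n0; rewrite leq_eqVlt => /orP[/eqP n1|n1].
  subst n.
  have hw : wp (encode alpha G) 1 1 (main_prog E)
      (fun st => st 0%N 0%N = entry G 0 0 /\ st 1%N 0%N = 1%N) (fun _ _ => 0%N).
    rewrite /main_prog !wpE /=; split=> //.
    rewrite wp_ifE /= ?updE /= !wpE /=; split; last by split.
    by rewrite /entry; case: existsP.
  have [t [m [ex _ [m0 m1] tK]]] := hK _ 1%N 1%N _ _ isT isT (bounded0 1%N) hw.
  exists t, (entry G 0 0), 1%N; split.
  - by exists (flat m); split=> //; exact/esym.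
  - rewrite /approximates permanent1 divr1 expr1; move: (entry G 0 0) => k.
    split; first by rewrite ler_pdivrMl ?ler_peMl ?ltr_pwDl ?lerDl ?(ltW eps0).
    by rewrite ler_peMl // lerDl ltW.
  - apply: (leq_trans tK); rewrite lE muln1 -mulnA leq_mul2l; apply/orP; right.
    apply: (@leq_trans (4 ^ 66)); last first.
      apply: (@leq_trans (4 ^ time_degree alpha G E)).
        by rewrite leq_exp2l // leq_addl.
      by rewrite leq_pmull // expn_gt0 F0.
    by rewrite (_ : 4 = 2 ^ 2)%N // -expnM leq_exp2l.
have wb0 : (0 < word_bound alpha G E)%N by rewrite /word_bound /bits muln_gt0 expn_gt0 addn1.
have [t [m [ex _ [m1 ap] tK]]] := hK _ _ _ _ _ wb0 (loop_bound_lt G alpha0 n1 E1)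
  (bounded0 _) (wp_main_prog alpha0 n1 expG E1 eps0 hE).
exists t, (m 0%N 0%N), (m 1%N 0%N); split=> //; first by exists (flat m); split.
apply: (leq_trans tK); rewrite lE -!(mulnA K) leq_mul2l; apply/orP; right.
exact: (cost_poly G alpha0 n1 E1).
Qed.

Theorem theorem2 (R : realType) :
  exists C : R, 0 < C /\
  forall eps : R, 0 < eps ->
  exists P : cmd,
  [/\ (* correctness on every valid input *)
      forall (n : nat) (alpha : R) (G : bigraph n),
        (0 < n)%N -> 0 < alpha -> expander alpha G ->
        exists t p q : nat,
          runs P (encode alpha G) t p q /\
          approximates eps G (p%:R / q%:R),
      (* running time *)
      exists n0 : nat,
        forall (n : nat) (alpha : R) (G : bigraph n) (t p q : nat),
          (0 < n)%N -> (n0 <= n)%N -> 0 < alpha -> expander alpha G ->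
          runs P (encode alpha G) t p q ->
          t%:R <= expR (C * (Num.sqrt (eps^-1 * alpha^-1 * n%:R)
                             * ln n%:R ^+ 3))
    & (* polynomial running time for constant alpha and bounded degree *)
      forall (alpha : R) (D : nat), 0 < alpha ->
      exists c d : nat,
        forall (n : nat) (G : bigraph n) (t p q : nat),
          (0 < n)%N -> expander alpha G -> (max_degree G <= D)%N ->
          runs P (encode alpha G) t p q ->
          (t <= c * n ^ d)%N ].
Proof.
exists 5000; split=> [|eps eps0]; first by rewrite ltr0n.
have l0 : 0 < ln (1 + eps) by rewrite ln_gt0 // ltrDl.
(* Ensures 6 / E <= ln (1 + eps); adding 2 rounds up and makes E exceed 1. *)
pose E := (Num.truncn (6 / ln (1 + eps))).+2.
have E1 : (1 < E)%N by [].
have hE : expR (6 / E%:R) <= 1 + eps.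
  rewrite -ler_ln ?posrE ?expR_gt0 ?addr_gt0 // expRK ler_pdivrMr ?ltr0n // mulrC.
  rewrite -ler_pdivrMr //; apply: le_trans (ltW (truncnS_gt _)) _.
  by rewrite ler_nat.
have [K hK] := main_prog_runs E1.
exists (cc (main_prog E)); split=> [n alpha G n0 alpha0 expG||alpha D alpha0].
- have [t [p [q [rn ap _]]]] := hK R n alpha eps G n0 alpha0 expG eps0 hE.
  by exists t, p, q.
- pose K1 : R := K.+1%:R.
  (* Makes ln n dominate all constants in the hypothesis of [time_exponent]; the last summand also
     excludes n = 1. *)
  exists (Num.truncn (expR (E%:R + 6 + E%:R * eps + ln K1 + 2 * eps + 4))).+2.
  move=> n alpha G t p q n0 nn alpha0 expG rn.
  have [t' [p' [q' [rn' _ ht]]]] := hK R n alpha eps G n0 alpha0 expG eps0 hE.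
  have [[m [ex _ _ _]] [m' [ex' _ _ _]]] := (rn, rn').
  have [tt _] := exec_det ex ex'; rewrite {}tt.
  have n1 : (1 < n)%N by apply: leq_trans nn.
  apply: le_trans (time_exponent alpha0 n1 expG E1 (K := K1) eps0 _ _).
  + rewrite -natrX -natrM ler_nat; apply: (leq_trans ht).
    by rewrite leq_mul2r leqnSn orbT.
  + by rewrite ler1n.
  + rewrite -[leLHS]expRK ler_ln ?posrE ?expR_gt0 ?ltr0n //.
    apply: le_trans (ltW (truncnS_gt _)) _.
    by rewrite ler_nat; apply: ltnW.
- pose A := Num.truncn (2 / alpha).
  (* The final + 2 covers n = 1, where the depth is at most 2 n = 2 and [depth_bounded] does not
     apply. *)
  pose T0 := (400 * E * (A * D.+1) * (E + A + D + 2) ^ 2 + 2)%N.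
  exists (K * 4 ^ (6 * T0 + 66))%N, (6 * T0 + 66)%N => n G t p q n0 expG hD rn.
  have [t' [p' [q' [rn' _ ht]]]] := hK R n alpha eps G n0 alpha0 expG eps0 hE.
  have [[m [ex _ _ _]] [m' [ex' _ _ _]]] := (rn, rn').
  have [tt _] := exec_det ex ex'; rewrite {}tt.
  apply: (leq_trans ht); rewrite -mulnA -expnMn leq_mul2l; apply/orP; right.
  apply: (@leq_trans ((4 * n) ^ time_degree alpha G E)).
    by rewrite leq_exp2r; [lia | rewrite /time_degree addnS].
  rewrite leq_pexp2l ?muln_gt0 // /time_degree leq_add2r leq_mul2l /=.
  move: n0 expG; rewrite leq_eqVlt => /orP[/eqP n1|n1] expG.
    apply: leq_trans (geq_minr _ _) _; rewrite -n1; exact: leq_addl.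
  apply: leq_trans (leq_addr _ _); exact: depth_bounded.
Qed.
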